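(* Suppose that $\mathrm{P}_{\theta}(qR>2)=1$ and that the function $r:(0,\infty)\to\mathbb R$ satisfies: (i) $\displaystyle 0\le r\le\frac{2\left(q\min(nq,p)-2\right)}{nq+p-2\min(nq,p)+3}$; (ii) $r$ is non-decreasing; (iii) $r$ is differentiable and $r'$ is bounded. Then, under the quadratic loss $L(\theta,\delta)=\mathrm{tr}\left((\delta-\theta)^{\top}\Sigma^{-1}(\delta-\theta)\right)$, the estimator $$\delta_r(X,S)=\left(I_p-\frac{r(F)}{F}SS^{+}\right)X$$ dominates the estimator $\delta^0(X)=X$, that is, for all $\theta$ (and $\Sigma$), $$\mathrm E_\theta[L(\theta,\delta_r(X,S))]\le\mathrm E_\theta[L(\theta,\delta^0(X))].$$
   Context: Fix integers $n,p,q\ge1$, a $p\times q$ real matrix $\theta$ and a $p\times p$ symmetric positive definite matrix $\Sigma$ (both unknown parameters). The random $p\times q$ matrix $X\sim\mathcal N_{p\times q}(\theta,\Sigma\otimes I_q)$ has independent columns, the $j$-th column being $\mathcal N_p(\theta_{\cdot j},\Sigma)$. The random $nq\times p$ matrix $Y\sim\mathcal N_{nq\times p}(0,I_{nq}\otimes(\Sigma/q))$ has i.i.d. rows distributed as $\mathcal N_p(0,\Sigma/q)$. Set $S=Y^{\top}Y$; $X$ and $S$ are independent. $\mathrm P_\theta,\mathrm E_\theta$ denote probability and expectation under this model. $S^{+}$ is the Moore–Penrose inverse of $S$, $R=\mathrm{rank}(S)$, and $F=\mathrm{tr}(X^{\top}S^{+}X)$ (which is positive almost surely). *)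

(* Defs.v *)
From HB Require Import structures.
From mathcomp Require Import all_boot all_order all_algebra.
From mathcomp Require Import all_classical all_reals all_analysis.

Set Implicit Arguments.
Unset Strict Implicit.
Unset Printing Implicit Defensive.

Import Order.TTheory GRing.Theory Num.Theory.
Import numFieldNormedType.Exports.

Local Open Scope classical_set_scope.
Local Open Scope ring_scope.

Definition posdefmx (R : realType) (p : nat) (A : 'M[R]_p) : Prop :=
  A^T = A /\ forall x : 'cV[R]_p, x != 0 -> 0 < (x^T *m A *m x) 0 0.

Definition penrose (R : realType) (m n : nat) (A : 'M[R]_(m, n))
    (G : 'M[R]_(n, m)) : Prop :=
  [/\ A *m G *m A = A, G *m A *m G = G,
      (A *m G)^T = A *m G & (G *m A)^T = G *m A].

Definition mppinvmx (R : realType) (m n : nat) (A : 'M[R]_(m, n)) :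
    'M[R]_(n, m) :=
  xget 0 [set G | penrose A G].

Lemma penrose_unique (R : realType) (m n : nat) (A : 'M[R]_(m, n))
    (G H : 'M[R]_(n, m)) : penrose A G -> penrose A H -> G = H.
Proof.
move=> [a1 a2 a3 a4] [b1 b2 b3 b4].
have e1 : A *m G = A *m H.
  transitivity ((A *m G)^T *m (A *m H)^T).
    by rewrite -trmx_mul mulmxA b1 a3.
  by rewrite a3 b3 mulmxA a1.
have e2 : G *m A = H *m A.
  transitivity ((G *m A)^T *m (H *m A)^T).
    by rewrite a4 b4 -mulmxA (mulmxA A) b1.
  by rewrite -trmx_mul -mulmxA (mulmxA A) a1 b4.
by rewrite -a2 e2 -mulmxA e1 mulmxA b2.
Qed.

Lemma gram_unitmx (R : realType) (m n : nat) (A : 'M[R]_(m, n)) :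
  row_free A -> A *m A^T \in unitmx.
Proof.
move=> fA; rewrite -row_free_unit; apply/row_freeP.
have ker0 : kermx (A *m A^T) = 0.
  apply/row_matrixP => i; rewrite row0.
  set u := row i _.
  have uK : u *m (A *m A^T) = 0 by rewrite -row_mul mulmx_ker row0.
  have n0 : (u *m A) *m (u *m A)^T = 0.
    by rewrite trmx_mul !mulmxA -(mulmxA u) uK mul0mx.
  have uA0 : u *m A = 0.
    have : ((u *m A) *m (u *m A)^T) 0 0 = 0 by rewrite n0 mxE.
    move: (u *m A) => v; rewrite mxE.
    under eq_bigr do rewrite [X in _ * X]mxE -expr2.
    move/eqP; rewrite psumr_eq0; last by move=> k _; exact: sqr_ge0.
    move/allP => v0; apply/rowP => j; rewrite [RHS]mxE.
    by have := v0 j (mem_index_enum _); rewrite sqrf_eq0 => /eqP.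
  by apply: (row_free_inj fA); rewrite mul0mx.
have /row_freeP[B AB] : row_free (A *m A^T) by rewrite -kermx_eq0 ker0.
by exists B.
Qed.

Lemma penrose_exists (R : realType) (m n : nat) (A : 'M[R]_(m, n)) :
  exists G, penrose A G.
Proof.
have [k [B [C [AE uB uC]]]] : exists k (B : 'M[R]_(m, k)) (C : 'M[R]_(k, n)),
    [/\ A = B *m C, B^T *m B \in unitmx & C *m C^T \in unitmx].
  exists (\rank A), (col_base A), (row_base A); split.
  - by rewrite mulmx_base.
  - rewrite -[X in _ *m X]trmxK; apply: gram_unitmx.
    by rewrite /row_free mxrank_tr; exact: col_base_full.
  - by apply: gram_unitmx; exact: row_base_free.
exists (C^T *m invmx (C *m C^T) *m (invmx (B^T *m B) *m B^T)).
set G := _ *m (_ *m _).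
have AG : A *m G = B *m (invmx (B^T *m B) *m B^T).
  by rewrite AE /G !mulmxA -(mulmxA B C) mulmxK.
have GA : G *m A = C^T *m invmx (C *m C^T) *m C.
  by rewrite AE /G !mulmxA -(mulmxA _ B^T B) mulmxKV.
split.
- by rewrite AG AE !mulmxA -(mulmxA _ B^T B) mulmxKV.
- by rewrite GA /G !mulmxA -(mulmxA _ C C^T) mulmxKV.
- by rewrite AG !trmx_mul trmxK trmx_inv trmx_mul trmxK mulmxA.
- by rewrite GA !trmx_mul trmxK trmx_inv trmx_mul trmxK mulmxA.
Qed.

Lemma mppinvmxP (R : realType) (m n : nat) (A : 'M[R]_(m, n)) :
  penrose A (mppinvmx A).
Proof. by have [G AG] := penrose_exists A; exact: (@xgetI _ _ _ G AG). Qed.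

Notation borelmx R m n := (g_sigma_algebraType (@open 'M[R]_(m, n))).

(* [A i] may be the whole space, so the product rule for subfamilies is
   included. *)
Definition mutually_independent (d d' : measure_display)
    (T : measurableType d) (T' : measurableType d') (R : realType)
    (P : probability T R) (I : finType) (X : I -> T -> T') : Prop :=
  forall A : I -> set T', (forall i, measurable (A i)) ->
    P (\bigcap_(i in [set: I]) (X i @^-1` A i)) =
    (\prod_(i : I) P (X i @^-1` A i))%E.

Definition independent (d d1 d2 : measure_display) (T : measurableType d)
    (T1 : measurableType d1) (T2 : measurableType d2) (R : realType)
    (P : probability T R) (X : T -> T1) (Y : T -> T2) : Prop :=
  forall (A : set T1) (B : set T2), measurable A -> measurable B ->
    P (X @^-1` A `&` Y @^-1` B) = (P (X @^-1` A) * P (Y @^-1` B))%E.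

(* X ~ N_p(mu, Sigma): X is the image mu + A Z of a standard Gaussian vector Z,
   where A A^T = Sigma.  Only used for invertible Sigma: then A is invertible
   and Z = A^-1 (X - mu), so asking for Z on the space carrying X constrains
   nothing but the law of X. *)
Definition normal_vector (d : measure_display) (T : measurableType d)
    (R : realType) (P : probability T R) (p : nat) (mu : 'cV[R]_p)
    (Sigma : 'M[R]_p) (X : T -> 'cV[R]_p) : Prop :=
  exists (A : 'M[R]_p) (Z : 'I_p -> {RV P >-> R}),
    [/\ A *m A^T = Sigma,
        forall i (B : set R), measurable B ->
          distribution P (Z i) B = normal_prob 0 1 B,
        mutually_independent P (fun i => Z i : T -> R) &
        forall w, X w = mu + A *m \col_i Z i w].

Section model.
Context (d : measure_display) (T : measurableType d) (R : realType).
Context (n p q : nat).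
Implicit Types (P : probability T R) (theta : 'M[R]_(p, q)) (Sigma : 'M[R]_p).
Implicit Types (X : {mfun T >-> borelmx R p q}).
Implicit Types (Y : {mfun T >-> borelmx R (n * q) p}).

Definition Smx Y (w : T) : 'M[R]_p :=
  (Y w : 'M[R]_(n * q, p))^T *m (Y w : 'M[R]_(n * q, p)).

Definition gaussian_model P X Y theta Sigma : Prop :=
  [/\ mutually_independent P
        (fun (j : 'I_q) w => col j (X w : 'M[R]_(p, q)) : borelmx R p 1),
      forall j : 'I_q, normal_vector P (col j theta) Sigma
        (fun w => col j (X w : 'M[R]_(p, q))),
      mutually_independent P (fun (i : 'I_(n * q)) w =>
        (row i (Y w : 'M[R]_(n * q, p)))^T : borelmx R p 1),
      forall i : 'I_(n * q), normal_vector P 0 (q%:R^-1 *: Sigma)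
        (fun w => (row i (Y w : 'M[R]_(n * q, p)))^T) &
      independent P (X : T -> borelmx R p q)
        (Smx Y : T -> borelmx R p p)].

Definition quadratic_loss Sigma theta (delta : 'M[R]_(p, q)) : R :=
  \tr ((delta - theta)^T *m invmx Sigma *m (delta - theta)).

Definition risk P X Y Sigma theta
    (delta : 'M[R]_(p, q) -> 'M[R]_p -> 'M[R]_(p, q)) : \bar R :=
  'E_P[fun w => quadratic_loss Sigma theta (delta (X w) (Smx Y w))].

(* [P theta Sigma] is the probability governing (X, Y) when the parameters are
   theta and Sigma. *)
Definition dominates (P : 'M[R]_(p, q) -> 'M[R]_p -> probability T R) X Y
    (delta delta0 : 'M[R]_(p, q) -> 'M[R]_p -> 'M[R]_(p, q)) : Prop :=
  forall theta Sigma, posdefmx Sigma ->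
    (risk (P theta Sigma) X Y Sigma theta delta <=
     risk (P theta Sigma) X Y Sigma theta delta0)%E.

End model.

Definition Fstat (R : realType) (p q : nat) (X : 'M[R]_(p, q)) (S : 'M[R]_p) :
    R :=
  \tr (X^T *m mppinvmx S *m X).

Definition delta_r (R : realType) (p q : nat) (r : R -> R) (X : 'M[R]_(p, q))
    (S : 'M[R]_p) : 'M[R]_(p, q) :=
  (1%:M - (r (Fstat X S) / Fstat X S) *: (S *m mppinvmx S)) *m X.

Definition delta_0 (R : realType) (p q : nat) (X : 'M[R]_(p, q))
    (S : 'M[R]_p) : 'M[R]_(p, q) := X.

(* Main.v *)
Require Import Defs.
From mathcomp Require Import all_boot all_order all_algebra.
From mathcomp Require Import all_classical all_reals all_analysis.
From mathcomp Require Import measurable_realfun.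
From mathcomp Require Import ring lra.

Set Implicit Arguments.
Unset Strict Implicit.
Unset Printing Implicit Defensive.

Import Order.TTheory GRing.Theory Num.Theory.
Import numFieldNormedType.Exports.

Local Open Scope classical_set_scope.
Local Open Scope ring_scope.

(* Put [m = n q], [U = Y^T], so that [S = U U^T], [Pi = S S^+], and
   [kappa = q min(m,p) - 2].  The factor [r(F)/F] is first regularized to
   [chi(F) = r(F+eps)/(F+eps)]: then [chi] is bounded, [F chi(F) <= rho] with
   [rho] the bound on [r], and [(F+eps) chi'(F) >= - chi(F)] as [r' >= 0].

   Expanding the loss of [X - chi(F) Pi X] leaves a cross term and a square.
   The Cameron-Martin density of a translated Gaussian matrix gives Stein's
   identity by differentiating along the translation.  Applied to [X] with [S]
   fixed it yields
     E[chi(F) <Pi X, X - theta>] = E[q R chi(F) + 2 F chi'(F)]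
                                >= E[(q R - 2) chi(F)],
   inner products and norms being those of [Sigma^-1].  Applied to [U] with
   [X = x] fixed and the field [chi(F)^2 Pi x x^T S^+ U], it yields
     q E[chi(F)^2 |Pi x|^2] <= E[chi(F)^2 (m + p - 2 R + 3) F];
   there [S^+] is replaced by [(S + delta)^-1] to keep the field smooth, and
   [delta] tends to [0] at the end.  Almost surely [R = min(m,p)]: the top left
   minor of [U + t V], with [V] the partial identity, is a nonzero polynomial
   in [t], and the law of [U + t V] converges to that of [U] in variation.  As
   [F chi(F) <= rho] and [q >= 1], the square is then at most
   [2 kappa E chi(F)], which the cross term compensates.  [X] and [S] being
   independent, Tonelli's theorem combines the two inequalities, and Fatou's
   lemma lets [eps] tend to [0]. *)

(** * Borel sets of matrices *)

(** The obstacle is that neither [r(F)/F] nor [S^+] is regular: the former is uncontrolled at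
    [F = 0], the latter is discontinuous where the rank of [S] changes. [eps] and [delta] cure the
    two defects separately, so that Stein's identity is only needed for bounded functions with
    bounded directional derivatives.

    The factor [q] before the square stems from the covariance [Sigma / q] of the rows of [Y], whose
    inverse is [q Sigma^-1]. The constant [m + p - 2 R + 3] is a sum: the divergence of
    [Pi x x^T S^+ U] is [(m + p - 2 R - 1) F], and differentiating [chi^2] adds
    [- 4 chi chi' tr ((x^T S^+ x)^2)], at most [4 chi^2 F] since [- F chi' <= chi] and the trace is
    at most [F^2]. The [2] in [kappa] comes from [- F chi' <= chi] too. Both inequalities involve
    the random [R], whereas the bound on [r] is a constant in [min(m,p)]; this is why [R] has to be
    identified.

    No finiteness of the risks is used. On the joint space only sums of nonnegative functions are
    compared, to which Tonelli's theorem applies, and the only term cancelled is the bounded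
    [2 kappa chi(F)]. *)

Section borel_matrix.
Context (R : realType) (m n : nat).

Definition mxrect (B : 'I_m -> 'I_n -> set R) : set 'M[R]_(m, n) :=
  [set M | forall i j, B i j (M i j)].

Definition mxrects : set (set 'M[R]_(m, n)) :=
  [set mxrect B | B in [set B | forall i j, measurable (B i j)]].

Lemma setI_closed_mxrects : setI_closed mxrects.
Proof.
move=> _ _ [B mB <-] [C mC <-]; exists (fun i j => B i j `&` C i j).
  by move=> i j; exact: measurableI.
apply/seteqP; split=> [M BC|M [HB HC] i j]; last by split.
by split=> i j; case: (BC i j).
Qed.

Lemma measurable_mx_coord (i : 'I_m) (j : 'I_n) :
  measurable_fun setT (fun M : borelmx R m n => M i j : R).
Proof.
apply: (measurability _ (RGenOpens.measurableE R)).
move=> _ [_ [a [b ->]] <-]; rewrite setTI; apply: sub_sigma_algebra.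
by apply: open_comp => [M _|]; [exact: coord_continuous|exact: interval_open].
Qed.

(* The boxes with rational vertices form a countable base of the topology. *)
Lemma measurable_mxrects :
  @measurable _ (borelmx R m n) = <<s mxrects >>.
Proof.
apply/seteqP; split; last first.
  apply: smallest_sub; first exact: smallest_sigma_algebra.
  move=> _ [B mB <-].
  have -> : mxrect B = \bigcap_(ij in [set: 'I_m * 'I_n])
      [set M : 'M[R]_(m, n) | B ij.1 ij.2 (M ij.1 ij.2)].
    by apply/seteqP; split=> [M BM [i j] _|M BM i j]; [exact: BM|exact: (BM (i, j))].
  apply: (@fin_bigcap_measurable _ (borelmx R m n)); first exact: finite_finset.
  move=> [i j] _ /=; have := @measurable_mx_coord i j measurableT _ (mB i j).
  by rewrite setTI.
apply: smallest_sub; first exact: smallest_sigma_algebra.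
move=> O oO.
pose box (K : 'M[rat * rat]_(m, n)) : set 'M[R]_(m, n) :=
  mxrect (fun i j => `](ratr (K i j).1 : R), (ratr (K i j).2 : R)[%classic).
have -> : O = \bigcup_(K : 'M[rat * rat]_(m, n))
    (if `[< box K `<=` O >] then box K else set0).
  apply/seteqP; split=> [M OM|M [K _]]; last by case: asboolP => // + ?; exact.
  have /nbhs_ballP[e /= e0 eO] : nbhs M O by rewrite nbhsE; exists O.
  have ex i j : exists k : rat * rat, (M i j - e < ratr k.1 < M i j) &&
      (M i j < ratr k.2 < M i j + e).
    have [|a] := @rat_in_itvoo R (M i j - e) (M i j).
      by rewrite gtrBl.
    have [|b] := @rat_in_itvoo R (M i j) (M i j + e).
      by rewrite ltrDl.
    by rewrite !in_itv/= => hb ha; exists (a, b); rewrite ha.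
  exists (\matrix_(i, j) projT1 (cid (ex i j))) => //.
  set K := \matrix_(i, j) _.
  have KP i j : (M i j - e < ratr (K i j).1 < M i j) &&
      (M i j < ratr (K i j).2 < M i j + e).
    by rewrite mxE; exact: projT2 (cid (ex i j)).
  case: asboolP => [_ i j|].
    by rewrite /= in_itv/=; move: (KP i j) => /andP[/andP[_ ->] /andP[-> _]].
  case=> N KN; apply: eO => /=; split=> // i j.
  have := KN i j; rewrite /= in_itv/= => /andP[h1 h2].
  move: (KP i j) => /andP[/andP[h3 h4] /andP[h5 h6]].
  rewrite /ball/= /ball_/= ltr_distlC ltrBlDr.
  rewrite (lt_trans h2 h6) andbT.
  by rewrite -ltrBlDr (lt_trans h3 h1).
apply: (@countable_bigcupT_measurable _ (g_sigma_algebraType mxrects)).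
  exact: countableP.
move=> K; case: asboolP => _; last exact: measurable0.
apply: sub_sigma_algebra; exists (fun i j =>
  `](ratr (K i j).1 : R), (ratr (K i j).2 : R)[%classic) => // i j.
Qed.

Lemma measurable_fun_mx d (T : measurableType d) (f : T -> borelmx R m n) :
  (forall i j, measurable_fun setT (fun t => f t i j : R)) ->
  measurable_fun setT f.
Proof.
move=> mf; apply: (measurability _ measurable_mxrects).
move=> _ [_ [B mB <-] <-]; rewrite setTI.
have -> : f @^-1` mxrect B = \bigcap_(ij in [set: 'I_m * 'I_n])
    [set t | B ij.1 ij.2 (f t ij.1 ij.2)].
  by apply/seteqP; split=> [t Bt [i j] _|t Bt i j]; [exact: Bt|exact: (Bt (i, j))].
apply: fin_bigcap_measurable; first exact: finite_finset.
move=> [i j] _ /=; have := @mf i j measurableT _ (mB i j).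
by rewrite setTI.
Qed.

(** Boxes are stable under intersection, include the whole space and generate the Borel sets. *)
Lemma mx_measure_unique
    (mu nu : {measure set (borelmx R m n) -> \bar R}) :
  (mu setT < +oo)%E ->
  (forall B : 'I_m -> 'I_n -> set R, (forall i j, measurable (B i j)) ->
    mu (mxrect B) = nu (mxrect B)) ->
  forall A, measurable A -> mu A = nu A.
Proof.
have TE : mxrect (fun _ _ => setT) = setT by apply/seteqP; split.
move=> fmu munu; apply: (@measure_unique _ R (borelmx R m n) mxrects (fun=> setT)).
- exact: measurable_mxrects.
- exact: setI_closed_mxrects.
- by move=> _; exists (fun _ _ => setT).
- by rewrite bigcup_const//; exists 0%N.
- by move=> _ [B mB <-]; exact: munu.
- by [].
Qed.

End borel_matrix.

(** * Translations of Gaussian matrices *)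

Section gauss1.
Context (R : realType).
Notation mu := (@lebesgue_measure R).
Local Open Scope ereal_scope.

Lemma lebesgue_measure_shift (h : R) (A : set (measurableTypeR R)) :
  measurable A ->
  pushforward mu (fun x : measurableTypeR R => (x + h)%R : measurableTypeR R) A = mu A.
Proof.
have mh : measurable_fun setT (fun x : measurableTypeR R => (x + h)%R : measurableTypeR R).
  exact: measurable_funD.
move=> mA; apply/esym/lebesgue_measure_unique => //= _ [[a b]] _ <-.
rewrite /pushforward (_ : _ @^-1` _ = `](a - h)%R, (b - h)%R]%classic); last first.
  by apply/seteqP; split=> x /=; rewrite !in_itv/= ltrBlDr lerBrDr.
rewrite /= !lebesgue_measure_itv/= !lte_fin ltrD2r.
by case: ifPn => // _; rewrite -!EFinB opprB addrA subrK.
Qed.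

Lemma ge0_integral_shift (h : R) (f : R -> \bar R) :
  measurable_fun setT f -> (forall x, 0 <= f x) ->
  \int[mu]_x f (x + h)%R = \int[mu]_x f x.
Proof.
move=> mf f0.
have mh : measurable_fun setT (fun x : measurableTypeR R => (x + h)%R : measurableTypeR R).
  exact: measurable_funD.
rewrite -[LHS]/(\int[mu]_(x in
  (fun x : measurableTypeR R => (x + h)%R : measurableTypeR R) @^-1` setT)
  (f \o (fun x : measurableTypeR R => (x + h)%R : measurableTypeR R)) x).
rewrite -ge0_integral_pushforward//.
by apply: eq_measure_integral => //= A mA _; exact: lebesgue_measure_shift.
Qed.

(** The Radon-Nikodym derivative with respect to Lebesgue measure equals the density almost
    everywhere, as both have the same integral over every measurable set. *)
Lemma ge0_integral_normal (f : R -> \bar R) :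
  measurable_fun setT f -> (forall x, 0 <= f x) ->
  \int[normal_prob 0 1]_x f x = \int[mu]_x (f x * (normal_pdf 0 1 x)%:E).
Proof.
move=> mf f0.
have dom := @normal_prob_dominates R 0 1.
rewrite -(Radon_Nikodym_SigmaFinite.change_of_variables dom)//.
apply: ae_eq_integral => //.
- apply: emeasurable_funM => //; apply: (measurable_int mu).
  exact: Radon_Nikodym_SigmaFinite.f_integrable.
- apply: emeasurable_funM => //=; apply/measurableT_comp => //=.
  exact: measurable_normal_pdf.
- apply: ae_eqe_mul2l => /=.
  apply: integral_ae_eq => //=.
  + exact: Radon_Nikodym_SigmaFinite.f_integrable.
  + by apply/measurableT_comp => //; exact: measurable_normal_pdf.
  + by move=> E _ mE; rewrite -Radon_Nikodym_SigmaFinite.f_integral.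
Qed.

(** Cameron-Martin in dimension one: the substitution [y = x + h] moves the density to [y - h], and
    [- (y - h)^2 / 2 = - y^2 / 2 + (h y - h^2 / 2)]. *)
Lemma normal_prob_shift (h : R) (f : R -> \bar R) :
  measurable_fun setT f -> (forall x, 0 <= f x) ->
  \int[normal_prob 0 1]_x f (x + h)%R =
  \int[normal_prob 0 1]_x (f x * (expR (h * x - h ^+ 2 / 2))%:E).
Proof.
move=> mf f0.
rewrite [LHS]ge0_integral_normal//; last first.
  by apply: (measurableT_comp mf); exact: measurable_funD.
rewrite [RHS]ge0_integral_normal//; last 2 first.
- apply: emeasurable_funM => //; apply/measurable_EFinP/measurableT_comp => //.
  by apply: measurable_funB => //; exact: measurable_funM.
- by move=> x; rewrite mule_ge0// lee_fin expR_ge0.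
rewrite -(@ge0_integral_shift (- h)); last 2 first.
- apply: emeasurable_funM.
    by apply: (measurableT_comp mf); exact: measurable_funD.
  by apply/measurable_EFinP; exact: measurable_normal_pdf.
- by move=> x; rewrite mule_ge0// lee_fin normal_pdf_ge0.
apply: eq_integral => x _; rewrite subrK -muleA; congr (_ * _).
rewrite -EFinM !normal_pdfE ?oner_neq0// /normal_fun; congr EFin.
by rewrite mulrCA -expRD; congr (_ * expR _)%R; field.
Qed.

End gauss1.

(** * Measurability of matrix-valued functions *)

Section entrywise_measurable.
Context d (T : measurableType d) (R : realType).

Definition mxmeas m n (F : T -> 'M[R]_(m, n)) :=
  forall i j, measurable_fun setT (fun t => F t i j).

Lemma mxmeasP m n (F : T -> borelmx R m n) : mxmeas F <-> measurable_fun setT F.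
Proof.
split; first exact: measurable_fun_mx.
by move=> mF i j; apply: (measurableT_comp (@measurable_mx_coord _ _ _ i j)).
Qed.

Lemma mxmeas_cst m n (A : 'M[R]_(m, n)) : mxmeas (fun=> A).
Proof. by move=> i j; exact: measurable_cst. Qed.

Lemma mxmeasD m n (F G : T -> 'M[R]_(m, n)) :
  mxmeas F -> mxmeas G -> mxmeas (fun t => F t + G t).
Proof.
move=> mF mG i j; under eq_fun do rewrite mxE; exact: measurable_funD.
Qed.

Lemma mxmeasN m n (F : T -> 'M[R]_(m, n)) :
  mxmeas F -> mxmeas (fun t => - F t).
Proof.
move=> mF i j; under eq_fun do rewrite mxE.
by apply: measurableT_comp => //; exact: mF.
Qed.

Lemma mxmeasB m n (F G : T -> 'M[R]_(m, n)) :
  mxmeas F -> mxmeas G -> mxmeas (fun t => F t - G t).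
Proof. by move=> mF mG; apply: mxmeasD => //; exact: mxmeasN. Qed.

Lemma mxmeasZ m n (a : T -> R) (F : T -> 'M[R]_(m, n)) :
  measurable_fun setT a -> mxmeas F -> mxmeas (fun t => a t *: F t).
Proof.
move=> ma mF i j; under eq_fun do rewrite mxE; exact: measurable_funM.
Qed.

Lemma mxmeasM m n l (F : T -> 'M[R]_(m, n)) (G : T -> 'M[R]_(n, l)) :
  mxmeas F -> mxmeas G -> mxmeas (fun t => F t *m G t).
Proof.
move=> mF mG i j; under eq_fun do rewrite mxE.
by apply: measurable_sum => k; exact: measurable_funM.
Qed.

Lemma mxmeasT m n (F : T -> 'M[R]_(m, n)) :
  mxmeas F -> mxmeas (fun t => (F t)^T).
Proof. by move=> mF i j; under eq_fun do rewrite mxE; exact: mF. Qed.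

Lemma measurable_mxtrace n (F : T -> 'M[R]_n) :
  mxmeas F -> measurable_fun setT (fun t => \tr (F t)).
Proof. by move=> mF; apply: measurable_sum => i; exact: mF. Qed.

Lemma measurable_det n (F : T -> 'M[R]_n) :
  mxmeas F -> measurable_fun setT (fun t => \det (F t)).
Proof.
move=> mF; apply: measurable_sum => s; apply: measurable_funM => //.
by apply: measurable_prod => i _; exact: mF.
Qed.

(** Inversion is discontinuous at [0], where its value is [0]; it is the pointwise limit of the
    continuous functions [x / (x^2 + 1/(k+1))], which all vanish there. *)
Lemma measurable_invr (f : T -> R) :
  measurable_fun setT f -> measurable_fun setT (fun t => (f t)^-1).
Proof.
move=> mf; apply: (measurableT_comp _ mf).
apply: (@measurable_fun_cvg _ (measurableTypeR R) R setT (fun k (x : R) => x / (x ^+ 2 + k.+1%:R^-1))).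
  move=> k; apply: measurable_funM => //; apply: continuous_measurable_fun => x.
  apply: cvgV; last first.
    by apply: cvgD; [exact: exprn_continuous|exact: cvg_cst].
  by rewrite gt_eqF// ltr_wpDl ?sqr_ge0// invr_gt0.
move=> x _; have [->|x0] := eqVneq x 0.
  rewrite invr0; apply: cvg_near_cst; near=> k; by rewrite mul0r.
rewrite [X in _ --> X](_ : _ = x / (x ^+ 2 + 0)); last first.
  by rewrite addr0 expr2 invfM mulrA mulfV// mul1r.
apply: cvgM; first exact: cvg_cst.
apply: cvgV; first by rewrite addr0 sqrf_eq0.
apply: cvgD; first exact: cvg_cst.
exact: cvg_harmonic.
Unshelve. all: by end_near. Qed.

(** Cramer's rule: the entries of the inverse are cofactors over the determinant. *)
Lemma mxmeas_inv n (F : T -> 'M[R]_n) :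
  (forall t, F t \in unitmx) -> mxmeas F -> mxmeas (fun t => invmx (F t)).
Proof.
move=> uF mF i j; rewrite /invmx.
under eq_fun do rewrite uF mxE.
apply: measurable_funM; first exact/measurable_invr/measurable_det.
under eq_fun do rewrite mxE.
rewrite /cofactor; apply: measurable_funM => //; apply: measurable_det.
by move=> a b; under eq_fun do rewrite !mxE; exact: mF.
Qed.

End entrywise_measurable.

(** * Translations of matrices with independent standard normal entries *)

Section standard_normal_matrix.
Context d (T : measurableType d) (R : realType) (P : probability T R).
Context (p k : nat) (Z : T -> 'M[R]_(p, k)).
Hypothesis mZ : mxmeas Z.
Hypothesis Z_iid : forall B : 'I_p -> 'I_k -> set R,
  (forall i j, measurable (B i j)) ->
  P [set w | mxrect B (Z w)] =
  (\prod_(ij : 'I_p * 'I_k) normal_prob 0 1 (B ij.1 ij.2))%E.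
Local Open Scope ereal_scope.

Definition mxset m n (i : 'I_m) (j : 'I_n) (M : 'M[R]_(m, n)) (t : R) : 'M[R]_(m, n) :=
  \matrix_(a, b) (if (a, b) == (i, j) then t else M a b).

Lemma measurable_mxset (i : 'I_p) (j : 'I_k) :
  mxmeas (fun x : T * measurableTypeR R => mxset i j (Z x.1) x.2).
Proof.
move=> a b; under eq_fun do rewrite mxE.
case: eqP => _; first exact: measurable_snd.
exact: (measurableT_comp (@mZ a b) measurable_fst).
Qed.

(** Refreshing one entry by an independent standard normal variable changes the probability of no
    box, hence not the law of [Z]. The inner integral runs over that entry alone, so the
    one-dimensional formula applies to it. *)
Lemma resample_coord (i : 'I_p) (j : 'I_k) (f : borelmx R p k -> \bar R) :
  measurable_fun setT f -> (forall x, 0 <= f x) ->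
  \int[P]_w f (Z w) = \int[P]_w \int[normal_prob 0 1]_t f (mxset i j (Z w) t).
Proof.
move=> mf f0.
have mZ' : measurable_fun setT (Z : T -> borelmx R p k) by exact/mxmeasP.
have ms : measurable_fun setT (fun x : T * measurableTypeR R => mxset i j (Z x.1) x.2 : borelmx R p k).
  by apply/mxmeasP; exact: measurable_mxset.
pose h (x : T * measurableTypeR R) : borelmx R p k := mxset i j (Z x.1) x.2.
pose g := f \o h.
have mg : measurable_fun setT g by exact: measurableT_comp mf ms.
rewrite -(@fubini_tonelli1 _ _ T (measurableTypeR R) R P (normal_prob 0 1) g)//; last first.
  by move=> x; exact: f0.
transitivity (\int[pushforward P (Z : T -> borelmx R p k)]_x f x).
  by rewrite ge0_integral_pushforward.
transitivity (\int[pushforward (P \x normal_prob 0 1) h]_x f x); last first.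
  by rewrite ge0_integral_pushforward.
apply: eq_measure_integral => A mA _.
apply: mx_measure_unique => //.
  by rewrite /= /pushforward preimage_setT probability_setT ltry.
move=> B mB.
rewrite /= /pushforward.
have -> : (fun x : T * measurableTypeR R => mxset i j (Z x.1) x.2) @^-1` mxrect B =
  [set w | mxrect (fun a b => if (a, b) == (i, j) then setT else B a b) (Z w)] `*` B i j.
  apply/seteqP; split=> [[w t] /= hB|[w t] [/= h1 h2] a b].
    split=> [a b|]; last by have := hB i j; rewrite mxE eqxx.
    by case: eqP => // ab; have := hB a b; rewrite mxE; case: eqP.
  by have := h1 a b; rewrite /= mxE; case: eqP => // -[-> ->].
have mB' a b : measurable (if (a, b) == (i, j) then [set: R] else B a b).
  by case: ifP.
have mrect : measurable [set w | mxrect (fun a b => if (a, b) == (i, j) then [set: R] else B a b) (Z w)].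
  have := mZ' measurableT (mxrect (fun a b => if (a, b) == (i, j) then [set: R] else B a b)).
  rewrite setTI; apply.
  by rewrite measurable_mxrects; apply: sub_sigma_algebra; eexists; first exact: mB'.
rewrite product_measure1E//; last exact: mB.
apply: (etrans (Z_iid mB)).
transitivity ((\prod_(ij : 'I_p * 'I_k) normal_prob 0 1
    (if (ij.1, ij.2) == (i, j) then [set: R] else B ij.1 ij.2)) *
  normal_prob 0 1 (B i j)); last first.
  by congr (_ * _); apply/esym; exact: (Z_iid mB').
rewrite (bigD1 (i, j))//= [X in _ = X * _](bigD1 (i, j))//=.
rewrite eqxx probability_setT mul1e muleC; congr (_ * _).
by apply: eq_bigr => -[a b] /= /negbTE ->.
Qed.

Lemma normal_mx_shift_coord (i : 'I_p) (j : 'I_k) (h : R) (f : borelmx R p k -> \bar R) :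
  measurable_fun setT f -> (forall x, 0 <= f x) ->
  \int[P]_w f (Z w + h *: delta_mx i j)%R =
  \int[P]_w (f (Z w) * (expR (h * Z w i j - h ^+ 2 / 2))%:E).
Proof.
move=> mf f0.
have mid : mxmeas (fun M : borelmx R p k => M : 'M[R]_(p, k)) by exact/mxmeasP.
have m1 : measurable_fun setT (fun M : borelmx R p k => f (M + h *: delta_mx i j)%R).
  apply: (measurableT_comp mf); apply/mxmeasP; exact: mxmeasD.
rewrite (resample_coord i j m1)//.
have m2 : measurable_fun setT (fun M : borelmx R p k =>
    f M * (expR (h * M i j - h ^+ 2 / 2))%:E).
  apply: emeasurable_funM => //; apply/measurable_EFinP/measurableT_comp => //.
  by apply: measurable_funB => //; apply: measurable_funM => //; exact: mid.
rewrite (resample_coord i j m2); last first.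
  by move=> M; rewrite mule_ge0// lee_fin expR_ge0.
apply: eq_integral => w _.
have ms : measurable_fun setT (fun t => f (mxset i j (Z w) t)).
  apply: (measurableT_comp mf); apply/mxmeasP => a b.
  under eq_fun do rewrite mxE; case: eqP => _.
    exact: measurable_id.
  exact: measurable_cst.
rewrite -[RHS]/(\int[normal_prob 0 1]_t (f (mxset i j (Z w) t) *
  (expR (h * (mxset i j (Z w) t) i j - h ^+ 2 / 2))%:E)).
under [RHS]eq_integral do rewrite [mxset _ _ _ _ _ _]mxE eqxx.
rewrite -(normal_prob_shift _ ms)//.
apply: eq_integral => t _; congr f; apply/matrixP => a b.
rewrite !mxE; case: (eqVneq (a, b) (i, j)) => [[-> ->]|ab].
  by rewrite !eqxx mulr1.
by move: ab; rewrite xpair_eqE => /negbTE ->; rewrite mulr0 addr0.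
Qed.

(** The entries are translated one after the other and the densities multiply. As the list [s] has
    no repetition, [Ws s] vanishes at the entry [(i, j)] being treated, whose density is thus
    unaffected by the other translations. *)
Lemma normal_mx_shift (W : 'M[R]_(p, k)) (f : borelmx R p k -> \bar R) :
  measurable_fun setT f -> (forall x, 0 <= f x) ->
  \int[P]_w f (Z w + W)%R =
  \int[P]_w (f (Z w) * (expR (\tr (W^T *m Z w) - \tr (W^T *m W) / 2))%:E).
Proof.
move=> mf f0.
have mid : mxmeas (fun M : borelmx R p k => M : 'M[R]_(p, k)) by exact/mxmeasP.
pose Ws (s : seq ('I_p * 'I_k)) :=
  (\sum_(ij <- s) W ij.1 ij.2 *: delta_mx ij.1 ij.2)%R.
suff H s : uniq s -> forall f : borelmx R p k -> \bar R,
    measurable_fun setT f -> (forall x, 0 <= f x) ->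
    \int[P]_w f (Z w + Ws s)%R =
    \int[P]_w (f (Z w) * (expR (\sum_(ij <- s)
      (W ij.1 ij.2 * Z w ij.1 ij.2 - W ij.1 ij.2 ^+ 2 / 2)))%:E).
  have -> : W = Ws (index_enum _).
    rewrite /Ws {1}[W]matrix_sum_delta pair_big/=.
    by apply: eq_bigr => -[].
  rewrite H ?index_enum_uniq//.
  apply: eq_integral => w _; congr (_ * (expR _)%:E).
  have -> : Ws (index_enum _) = W.
    by rewrite /Ws {2}[W]matrix_sum_delta pair_big/=; apply: eq_bigr => -[].
  have trE (M : 'M[R]_(p, k)) :
      \tr (W^T *m M) = (\sum_(ij : 'I_p * 'I_k) W ij.1 ij.2 * M ij.1 ij.2)%R.
    rewrite /mxtrace; under eq_bigr do rewrite mxE.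
    rewrite exchange_big/= pair_big/=.
    by apply: eq_bigr => -[a b] _; rewrite mxE.
  by rewrite sumrB !trE mulr_suml.
elim: s => [|[i j] s IH] /=.
  move=> _ g mg g0; apply: eq_integral => w _.
  by rewrite /Ws !big_nil addr0 expR0 mule1.
move=> /andP[ijs us] g mg g0.
have mgs : measurable_fun setT (fun M : borelmx R p k => g (M + Ws s)%R).
  apply: (measurableT_comp mg); apply/mxmeasP; exact: mxmeasD.
have Wsij : Ws s i j = 0%R.
  rewrite /Ws summxE big1_seq// => -[a b] /andP[_ abs] /=; rewrite !mxE.
  case: eqP => [ia|_]; last by rewrite mulr0.
  by case: eqP => [jb|_]; [move: ijs; rewrite ia jb abs|rewrite mulr0].
transitivity (\int[P]_w (g (Z w + Ws s)%R *
    (expR (W i j * (Z w + Ws s)%R i j - W i j ^+ 2 / 2))%:E)).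
  transitivity (\int[P]_w g (Z w + W i j *: delta_mx i j + Ws s)%R).
    by apply: eq_integral => w _; rewrite /Ws big_cons addrA.
  rewrite (normal_mx_shift_coord i j (W i j) mgs)//.
  by apply: eq_integral => w _; rewrite [in RHS]mxE Wsij addr0.
rewrite (IH us (fun M => g M * (expR (W i j * M i j - W i j ^+ 2 / 2))%:E)); last 2 first.
- apply: emeasurable_funM => //; apply/measurable_EFinP/measurableT_comp => //.
  by apply: measurable_funB => //; apply: measurable_funM => //; exact: mid.
- by move=> M; rewrite mule_ge0// lee_fin expR_ge0.
by apply: eq_integral => w _; rewrite big_cons/= -muleA -EFinM -expRD.
Qed.

End standard_normal_matrix.

Section gaussian_columns.
Context d (T : measurableType d) (R : realType) (P : probability T R).
Context (p k : nat).

(* Cameron-Martin: translating a Gaussian matrix with independent columns of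
   precision [L] and mean [theta] changes its law by an explicit density. *)
Definition gaussian_shift (U : T -> 'M[R]_(p, k)) (theta : 'M[R]_(p, k)) (L : 'M[R]_p) :=
  forall (V : 'M[R]_(p, k)) (f : borelmx R p k -> \bar R),
  measurable_fun setT f -> (forall x, 0 <= f x)%E ->
  (\int[P]_w f (U w + V)%R = \int[P]_w (f (U w) *
    (expR (\tr (V^T *m L *m (U w - theta)) - \tr (V^T *m L *m V) / 2))%:E))%E.

Lemma mxtrace_trmx_mul_col (M N : 'M[R]_(p, k)) :
  \tr (M^T *m N) = \sum_j ((col j M)^T *m col j N) 0 0.
Proof.
apply: eq_bigr => j _; rewrite !mxE; apply: eq_bigr => i _; by rewrite !mxE.
Qed.

(** Column [j] is [theta_j + A_j Z_j], where [A_j] may depend on [j] and only [A_j A_j^T = Sigma] is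
    common. Translating it by [V_j] amounts to translating [Z_j] by [A_j^-1 V_j]; since
    [Sigma^-1 = A_j^-T A_j^-1], the exponent no longer involves [A_j]. *)
Lemma gaussian_shift_columns (U : T -> 'M[R]_(p, k)) theta Sigma :
  mxmeas U -> Sigma \in unitmx ->
  mutually_independent P (fun j w => col j (U w) : borelmx R p 1) ->
  (forall j, normal_vector P (col j theta) Sigma (fun w => col j (U w))) ->
  gaussian_shift U theta (invmx Sigma).
Proof.
move=> mU uS indU nU V f mf f0.
pose A j := projT1 (cid (nU j)).
pose ZZ j := projT1 (cid (projT2 (cid (nU j)))).
have AS j : A j *m (A j)^T = Sigma by case: (projT2 (cid (projT2 (cid (nU j))))).
have ZN j i (B : set R) : measurable B -> distribution P (ZZ j i) B = normal_prob 0 1 B.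
  by case: (projT2 (cid (projT2 (cid (nU j))))) => _ + _ _; exact.
have Zind j : mutually_independent P (fun i => ZZ j i : T -> R).
  by case: (projT2 (cid (projT2 (cid (nU j))))).
have UE j w : col j (U w) = col j theta + A j *m \col_i ZZ j i w.
  by case: (projT2 (cid (projT2 (cid (nU j))))).
have uA j : A j \in unitmx by move: uS; rewrite -(AS j) unitmx_mul => /andP[].
have LE j : invmx Sigma = (invmx (A j))^T *m invmx (A j).
  by rewrite -(AS j) -[RHS]mulmx1 -(mulmxV uS) -{1}(AS j) !mulmxA
    -(mulmxA _ _ (A j)) mulVmx ?uA// mulmx1 -trmx_mul mulmxV ?uA// trmx1 mul1mx AS.
pose Z w : 'M[R]_(p, k) := \matrix_(i, j) ZZ j i w.
have colZ j w : col j (Z w) = \col_i ZZ j i w.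
  by apply/colP => i; rewrite !mxE.
have mZ : mxmeas Z by move=> i j; under eq_fun do rewrite mxE; exact: measurable_funPT.
have Zcol j w : col j (Z w) = invmx (A j) *m (col j (U w) - col j theta).
  by rewrite UE addrC addKr mulKmx ?uA// colZ.
have Z_iid (B : 'I_p -> 'I_k -> set R) : (forall i j, measurable (B i j)) ->
    P [set w | mxrect B (Z w)] = (\prod_(ij : 'I_p * 'I_k) normal_prob 0 1 (B ij.1 ij.2))%E.
  move=> mB.
  (* Independence across columns is known for [U] only, so the constraint on column [j] of [Z] is
     read as an event on column [j] of [U]. *)
  pose C j : set (borelmx R p 1) :=
    [set c : 'M[R]_(p, 1) | forall i, B i j ((invmx (A j) *m (c - col j theta)) i 0)].
  have mC j : measurable (C j).
    have mid : mxmeas (fun M : borelmx R p 1 => M : 'M[R]_(p, 1)) by exact/mxmeasP.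
    have -> : C j = \bigcap_(i in [set: 'I_p])
        ((fun c : borelmx R p 1 => (invmx (A j) *m (c - col j theta)) i 0) @^-1` (B i j)).
      by apply/seteqP; split=> [c Cc i _|c Cc i]; [exact: Cc|exact: (Cc i)].
    apply: fin_bigcap_measurable; first exact: finite_finset.
    move=> i _; rewrite -[X in measurable X]setTI.
    suff mc : mxmeas (fun c : borelmx R p 1 => invmx (A j) *m (c - col j theta)).
      exact: (mc i 0).
    by apply: mxmeasM; [exact: mxmeas_cst|apply: mxmeasB => //; exact: mxmeas_cst].
  have -> : [set w | mxrect B (Z w)] =
      \bigcap_(j in [set: 'I_k]) ((fun w => col j (U w) : borelmx R p 1) @^-1` C j).
    apply/seteqP; split=> [w Bw j _ i|w Bw i j].
      by rewrite -Zcol mxE; exact: Bw.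
    by have := Bw j Logic.I i; rewrite -Zcol mxE.
  rewrite (indU C mC).
  rewrite -(pair_bigA _ (fun i j => normal_prob 0 1 (B i j)))/= exchange_big/=.
  apply: eq_bigr => j _.
  rewrite (_ : _ @^-1` C j = \bigcap_(i in [set: 'I_p]) (ZZ j i @^-1` B i j)).
    rewrite (Zind j) //; apply: eq_bigr => i _; exact: ZN.
  apply/seteqP; split=> [w Cw i _|w Cw i].
    by have := Cw i; rewrite -Zcol !mxE.
  by rewrite -Zcol !mxE; exact: Cw.
pose W : 'M[R]_(p, k) := \matrix_(i, j) (invmx (A j) *m col j V) i 0.
have colW j : col j W = invmx (A j) *m col j V.
  by apply/colP => i; rewrite !mxE.
pose aff (M : 'M[R]_(p, k)) : 'M[R]_(p, k) :=
  theta + \matrix_(i, j) (A j *m col j M) i 0.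
have affZ w : aff (Z w) = U w.
  apply/matrixP => i j; have /colP/(_ i) := UE j w.
  by rewrite -colZ !mxE => ->; congr (_ + _); apply: eq_bigr => l _; rewrite !mxE.
have affZW w : aff (Z w + W) = U w + V.
  rewrite -affZ /aff -addrA; congr (_ + _); apply/matrixP => i j.
  rewrite [LHS]mxE [RHS]mxE [X in _ = X + _]mxE linearD/= mulmxDr [LHS]mxE.
  by rewrite colW mulKVmx ?uA// [col j V _ _]mxE.
have maff : measurable_fun setT (aff : borelmx R p k -> borelmx R p k).
  have mid : mxmeas (fun M : borelmx R p k => M : 'M[R]_(p, k)) by exact/mxmeasP.
  apply/mxmeasP; apply: mxmeasD; first exact: mxmeas_cst.
  move=> i j; under eq_fun do rewrite mxE; apply: mxmeasM; first exact: mxmeas_cst.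
  by move=> a b; under eq_fun do rewrite mxE; exact: mid.
have mfa : measurable_fun setT (f \o aff : borelmx R p k -> \bar R).
  exact: measurableT_comp mf maff.
transitivity (\int[P]_w (f \o aff) (Z w + W)%R)%E.
  by apply: eq_integral => w _; rewrite /= affZW.
have fa0 x : (0 <= (f \o aff) x)%E by exact: f0.
apply: (etrans (normal_mx_shift mZ Z_iid W mfa fa0)).
apply: eq_integral => w _; rewrite /= affZ; congr (_ * (expR _)%:E)%E.
have colM (A' : 'M[R]_p) (B : 'M[R]_(p, k)) j : col j (A' *m B) = A' *m col j B.
  by rewrite !colE mulmxA.
rewrite -!mulmxA !mxtrace_trmx_mul_col.
congr (_ - _ / 2); apply: eq_bigr => j _.
  rewrite Zcol colW trmx_mul colM; congr (fun_of_matrix _ 0 0).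
  have -> : col j (U w - theta) = col j (U w) - col j theta by rewrite linearB.
  by rewrite (LE j) !mulmxA.
rewrite colW trmx_mul colM; congr (fun_of_matrix _ 0 0).
by rewrite (LE j) !mulmxA.
Qed.

End gaussian_columns.

(** * Stein's identity *)

Section difference_quotient.
Context (R : realType).

(** All derivatives needed are directional, taken along [M + t V] at [t = 0]. *)
Definition der0 (g : R -> R) (dg : R) : Prop :=
  (g h - g 0) / h @[h --> 0^'] --> dg.

Lemma der0_is_derive (g : R -> R) (t dg : R) :
  der0 (fun s => g (t + s)) dg -> is_derive t 1 g dg.
Proof.
move=> gd.
have H : h^-1 *: ((g \o shift t) (h *: (1 : R^o)) - g t) @[h --> 0^'] --> dg.
  apply: cvg_trans gd; apply: near_eq_cvg; near=> h.
  by rewrite /= /GRing.scale/= mulr1 addr0 mulrC [h + t]addrC.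
by split; [apply/cvg_ex; exists dg|exact/cvg_lim].
Unshelve. all: by end_near. Qed.

Lemma is_derive_der0 (g : R -> R) (t dg : R) :
  is_derive t 1 g dg -> der0 (fun s => g (t + s)) dg.
Proof.
move=> [dg1 dg2].
have H : h^-1 *: ((g \o shift t) (h *: (1 : R^o)) - g t) @[h --> 0^'] --> dg.
  by rewrite -dg2; exact: dg1.
apply: cvg_trans H; apply: near_eq_cvg; near=> h.
by rewrite /= /GRing.scale/= mulr1 addr0 mulrC [h + t]addrC.
Unshelve. all: by end_near. Qed.

Lemma cvg_difference_quotient (g : R -> R) (dg : R) : der0 g dg ->
  (g k.+1%:R^-1 - g 0) / k.+1%:R^-1 @[k --> \oo] --> dg.
Proof.
move=> gd; have /cvgr_dnbhsP/(_ (fun k => k.+1%:R^-1)) := gd; apply.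
by split=> [k|]; [rewrite invr_neq0|exact: cvg_harmonic].
Qed.

(** The mean value theorem. Being uniform in [h], the bound serves as domination when
    differentiating under the integral. *)
Lemma le_difference_quotient (g dg : R -> R) (C h : R) :
  (forall t, der0 (fun s => g (t + s)) (dg t)) ->
  (forall t, 0 <= t <= 1 -> `|dg t| <= C) ->
  0 < h <= 1 -> `|(g h - g 0) / h| <= C.
Proof.
move=> gd dgC /andP[h0 h1].
have [||c] := @MVT _ g dg 0 h h0.
- by move=> x _; exact/der0_is_derive/gd.
- apply: continuous_subspaceT => x.
  apply/differentiable_continuous/derivable1_diffP.
  by have [] := der0_is_derive (gd x).
rewrite in_itv/= => /andP[c0 ch] ->.
by rewrite subr0 mulfK ?gt_eqF// dgC// (ltW c0)/= (le_trans (ltW ch)).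
Qed.

End difference_quotient.

Section real_integrals.
Context d (T : measurableType d) (R : realType) (P : probability T R).

Lemma integrable_bounded (f : T -> R) (K : R) :
  measurable_fun setT f -> (forall w, `|f w| <= K) ->
  P.-integrable setT (EFin \o f).
Proof.
move=> mf fK; apply: (@le_integrable _ _ _ P _ measurableT _ (cst K%:E)) => //.
- exact/measurable_EFinP.
- move=> w _ /=; rewrite lee_fin; exact: le_trans (fK w) (ler_norm _).
- exact: finite_measure_integrable_cst.
Qed.

Lemma dominated_cvg_real (f_ : nat -> T -> R) (f g : T -> R) :
  (forall n, measurable_fun setT (f_ n)) ->
  (forall w, f_ n w @[n --> \oo] --> f w) ->
  P.-integrable setT (EFin \o g) ->
  (forall n w, `|f_ n w| <= g w) ->
  P.-integrable setT (EFin \o f) /\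
  (\int[P]_w (f_ n w)%:E @[n --> \oo] --> \int[P]_w (f w)%:E)%E.
Proof.
move=> mf_ f_f ig f_g.
have mf : measurable_fun setT f.
  by apply: (measurable_fun_cvg mf_) => w _; exact: f_f.
have [] := @dominated_convergence _ T R P setT measurableT
  (fun n => EFin \o f_ n) (EFin \o f) (EFin \o g) => //.
- by move=> n; exact/measurable_EFinP.
- exact/measurable_EFinP.
- apply: aeW => w _; apply: cvg_EFin; last exact: f_f.
  by near=> n.
- by apply: aeW => w n _ /=; rewrite lee_fin.
Unshelve. all: by end_near. Qed.

End real_integrals.

Section stein.
Context d (T : measurableType d) (R : realType) (P : probability T R).
Context (p k : nat) (U : T -> 'M[R]_(p, k)).
Context (theta : 'M[R]_(p, k)) (L : 'M[R]_p).
Hypothesis mU : mxmeas U.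
Hypothesis gsU : gaussian_shift P U theta L.

(** Translation by [V] has density [exp (score V - energy V / 2)]: [score V] is the derivative at
    [t = 0] of the log-density of the translation by [t V], and [energy V] the squared
    Cameron-Martin norm of [V]. *)
Definition score (V : 'M[R]_(p, k)) (w : T) : R := \tr (V^T *m L *m (U w - theta)).

Definition energy (V : 'M[R]_(p, k)) : R := \tr (V^T *m L *m V).

Lemma scoreZ a V w : score (a *: V) w = a * score V w.
Proof. by rewrite /score linearZ/= -!scalemxAl mxtraceZ. Qed.

Lemma energyZ a V : energy (a *: V) = a ^+ 2 * energy V.
Proof.
by rewrite /energy [(a *: V)^T]linearZ/= -!scalemxAl -scalemxAr !mxtraceZ mulrA expr2.
Qed.

Lemma measurable_score V : measurable_fun setT (score V).
Proof.
apply: measurable_mxtrace; apply: mxmeasM; first exact: mxmeas_cst.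
by apply: mxmeasB => //; exact: mxmeas_cst.
Qed.

(** The translation formula for the constant [1] reads [E exp (score V - energy V / 2) = 1]. *)
Lemma integrable_exp_score V :
  P.-integrable setT (fun w => (expR (score V w))%:E).
Proof.
apply/integrableP; split.
  by apply/measurable_EFinP/measurableT_comp => //; exact: measurable_score.
have := gsU V (@measurable_cst _ _ (borelmx R p k) (\bar R) setT 1%E) (fun=> lee01).
rewrite integral_cst//= probability_setT mule1 => E1.
have -> : (\int[P]_w `|(expR (score V w))%:E| = (expR (energy V / 2))%:E *
    \int[P]_w (expR (score V w - energy V / 2))%:E)%E.
  rewrite -ge0_integralZl ?lee_fin ?expR_ge0//; last first.
    apply/measurable_EFinP/measurableT_comp => //.
    by apply: measurable_funB => //; exact: measurable_score.
  apply: eq_integral => w _.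
  by rewrite -EFinM -expRD addrC subrK /= ger0_norm ?expR_ge0.
rewrite [X in (_ * X)%E](_ : _ = 1%E) ?mule1 ?ltry//.
rewrite E1; apply: eq_integral => w _; by rewrite mul1e.
Qed.

(** [exp |s| <= exp s + exp (- s)], and [- score V] is the score of [- V]. *)
Lemma integrable_exp_abs_score V :
  P.-integrable setT (fun w => (expR `|score V w|)%:E).
Proof.
apply: (@le_integrable _ _ _ P _ measurableT _
  (fun w => (expR (score V w))%:E + (expR (score ((-1) *: V) w))%:E)%E).
- apply/measurable_EFinP/measurableT_comp => //.
  by apply: measurableT_comp => //; exact: measurable_score.
- move=> w _; rewrite -EFinD /= lee_fin (ger0_norm (expR_ge0 _)).
  rewrite (ger0_norm (addr_ge0 (expR_ge0 _) (expR_ge0 _))) scoreZ mulN1r.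
  have [s0|s0] := lerP 0 (score V w); first by rewrite ger0_norm// lerDl expR_ge0.
  by rewrite ltr0_norm// lerDr expR_ge0.
- by apply: integrableD => //; exact: integrable_exp_score.
Qed.

(** The formula holds for nonnegative functions: it is applied to [f + K] and to [K], and the
    results are subtracted. *)
Lemma gaussian_shift_bounded V (f : 'M[R]_(p, k) -> R) (K : R) :
  measurable_fun setT (f : borelmx R p k -> R) -> (forall x, `|f x| <= K) ->
  (\int[P]_w (f (U w + V))%:E =
   \int[P]_w (f (U w) * expR (score V w - energy V / 2))%:E)%E.
Proof.
move=> mf fK.
have mfU : measurable_fun setT (f \o U) by apply: measurableT_comp mf _; exact/mxmeasP.
have mfUV : measurable_fun setT (fun w => f (U w + V)).
  apply: (measurableT_comp mf); apply/mxmeasP; apply: mxmeasD => //.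
have mE : measurable_fun setT (fun w => expR (score V w - energy V / 2)).
  by apply: measurableT_comp => //; apply: measurable_funB => //; exact: measurable_score.
have iE : P.-integrable setT (fun w => (expR (score V w - energy V / 2))%:E).
  apply: eq_integrable (integrableZl measurableT (expR (- (energy V / 2)))
    (integrable_exp_score V)) => //.
  by move=> w _; rewrite /= -EFinM expRD mulrC.
have ifE : P.-integrable setT (fun w => (f (U w) * expR (score V w - energy V / 2))%:E).
  apply: (@le_integrable _ _ _ P _ measurableT _
    (fun w => K%:E * (expR (score V w - energy V / 2))%:E)%E).
  - by apply/measurable_EFinP/measurable_funM.
  - move=> w _; rewrite -EFinM /= lee_fin !normrM; apply: ler_wpM2r => //.
    exact: le_trans (fK _) (ler_norm _).
  - exact: integrableZl.
have f0 x : (0 <= (f x + K)%:E)%E.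
  by rewrite lee_fin -lerBlDr sub0r; have := fK x; rewrite ler_norml => /andP[].
have mfK : measurable_fun setT (fun x : borelmx R p k => (f x + K)%:E).
  by apply/measurable_EFinP; exact: measurable_funD.
have K0 : (0 <= K%:E)%E.
  by rewrite lee_fin; exact: le_trans (normr_ge0 _) (fK 0).
have := gsU V mfK f0.
have := gsU V (@measurable_cst _ _ (borelmx R p k) (\bar R) setT K%:E) (fun=> K0).
rewrite -/(energy V).
under [in X in _ -> X -> _]eq_integral do rewrite EFinD.
rewrite integralD//; last 2 first.
- by apply: integrable_bounded mfUV _ => w; exact: fK.
- exact: finite_measure_integrable_cst.
under [in X in _ -> _ = X -> _]eq_integral do rewrite EFinD -/(score V _) muleDl// -EFinM.
rewrite integralD//; last exact: integrableZl.
move=> ->; rewrite -/(score V _).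
move/(congr1 (fun x => x - \int[P]_x (K%:E * (expR (score V x - energy V / 2))%:E))%E).
rewrite !addeK// integrable_fin_num//; exact: integrableZl.
Qed.

Lemma der0_expR_quadratic (l Q t : R) :
  der0 (fun s => expR (l * (t + s) - Q * (t + s) ^+ 2))
    (expR (l * t - Q * t ^+ 2) * (l - 2 * t * Q)).
Proof.
apply: (@is_derive_der0 _ (fun t => expR (l * t - Q * t ^+ 2))).
have h : is_derive t 1 (fun t : R => l * t - Q * t ^+ 2) (l - 2 * t * Q).
  apply: (is_derive_eq (is_deriveB (is_deriveZ l (is_derive_id t 1))
    (is_deriveZ Q (is_deriveX 2 (is_derive_id t 1))))).
  by rewrite /GRing.scale/= expr1; ring.
exact: (is_derive1_comp (is_derive_expR _) h).
Qed.

(** The identity [E f(U + h V) = E [f(U) exp (h score V - h^2 energy V / 2)]] is differentiated at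
    [h = 0] along [h = 1/(n+1)]: the left side gives [E D(U)], the right side [E [f(U) score V]].
    Domination comes from the bound on [D] and from the exponential moments of the score. *)
Lemma stein V (f D : 'M[R]_(p, k) -> R) (K : R) :
  measurable_fun setT (f : borelmx R p k -> R) ->
  (forall x, `|f x| <= K) -> (forall x, `|D x| <= K) ->
  (forall M, der0 (fun t => f (M + t *: V)) (D M)) ->
  [/\ P.-integrable setT (fun w => (score V w * f (U w))%:E),
      P.-integrable setT (fun w => (D (U w))%:E) &
      (\int[P]_w (score V w * f (U w))%:E = \int[P]_w (D (U w))%:E)%E].
Proof.
move=> mf fK DK fD.
pose h n : R := n.+1%:R^-1.
have h01 n : 0 < h n <= 1 by rewrite invr_gt0 ltr0n/= invf_le1// ler1n.
have K0 : 0 <= K := le_trans (normr_ge0 _) (fK 0).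
have mfU : measurable_fun setT (f \o U) by apply: measurableT_comp mf _; exact/mxmeasP.
have mfUV n : measurable_fun setT (fun w => f (U w + h n *: V)).
  by apply: (measurableT_comp mf); apply/mxmeasP; exact: mxmeasD.
pose E n w := expR (score V w * h n - energy V / 2 * h n ^+ 2).
have mE n : measurable_fun setT (E n).
  apply: measurableT_comp => //; apply: measurable_funB => //.
  by apply: measurable_funM => //; exact: measurable_score.
have [| | | |iA cA] := @dominated_cvg_real _ T R P
  (fun n w => (f (U w + h n *: V) - f (U w)) / h n) (fun w => D (U w)) (cst K).
- by move=> n; apply: measurable_funM => //; exact: measurable_funB.
- move=> w; have := cvg_difference_quotient (fD (U w)).
  by rewrite scale0r addr0.
- exact: finite_measure_integrable_cst.
- move=> n w; have := @le_difference_quotient _ (fun t => f (U w + t *: V))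
    (fun t => D (U w + t *: V)) K (h n) _ _ (h01 n).
  rewrite scale0r addr0; apply => [t|t _]; last exact: DK.
  under [X in der0 X]eq_fun do rewrite scalerDl addrA.
  exact: fD.
pose c := `|energy V|.
(* With [s = score V w] and [0 <= t <= 1], both factors of the derivative [exp (s t - energy V t^2 /
   2) (s - t energy V)] are at most [exp (|s| + c)] in absolute value. Their product is at most
   [exp (2 c) exp (2 |s|)], and [2 |s|] is the absolute score of [2 V]. *)
pose G w := K * (expR (2 * c) * expR `|score (2 *: V) w|).
have [| | | |iB cB] := @dominated_cvg_real _ T R P
  (fun n w => f (U w) * ((E n w - 1) / h n)) (fun w => f (U w) * score V w) G.
- by move=> n; apply: measurable_funM => //; apply: measurable_funM => //; exact: measurable_funB.
- move=> w; apply: cvgM; first exact: cvg_cst.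
  have := cvg_difference_quotient (@der0_expR_quadratic (score V w) (energy V / 2) 0).
  rewrite !addr0 !mulr0 expr0n/= mulr0 subr0 expR0 mul1r mul0r subr0.
  by under eq_fun do rewrite !add0r.
- apply: eq_integrable (integrableZl measurableT (K * expR (2 * c))
    (integrable_exp_abs_score (2 *: V))) => //.
  by move=> w _; rewrite /G /= -EFinM mulrA.
- move=> n w; rewrite /G normrM; apply: ler_pM => //.
  have := @le_difference_quotient _ (fun t => expR (score V w * t - energy V / 2 * t ^+ 2))
    (fun t => expR (score V w * t - energy V / 2 * t ^+ 2) * (score V w - 2 * t * (energy V / 2)))
    (expR (2 * c) * expR `|score (2 *: V) w|) (h n) _ _ (h01 n).
  rewrite mulr0 expr0n/= mulr0 subr0 expR0; apply=> [t|t /andP[t0 t1]].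
    exact: der0_expR_quadratic.
  set s := score V w.
  have -> : `|score (2 *: V) w| = 2 * `|s| by rewrite scoreZ normrM ger0_norm.
  rewrite normrM (ger0_norm (expR_ge0 _)).
  have tc : energy V / 2 * t ^+ 2 <= c /\ - c <= energy V / 2 * t ^+ 2.
    apply/andP; rewrite andbC -ler_norml !normrM /c -mulrA ler_piMr//.
    rewrite [X in X * _]ger0_norm ?invr_ge0// ger0_norm ?sqr_ge0//.
    have : t ^+ 2 <= 1 by rewrite expr_le1.
    by have := sqr_ge0 t; lra.
  have ts : s * t <= `|s|.
    by rewrite (le_trans (ler_norm _))// normrM (ger0_norm t0) ler_piMr.
  have e1 : expR (s * t - energy V / 2 * t ^+ 2) <= expR (`|s| + c).
    by rewrite ler_expR lerD// lerNl; case: tc.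
  have e2 : `|s - 2 * t * (energy V / 2)| <= expR (`|s| + c).
    apply: (@le_trans _ _ (`|s| + c)).
      apply: le_trans (ler_normB _ _) _; rewrite lerD2l.
      rewrite (_ : 2 * t * (energy V / 2) = t * energy V); last by field.
      by rewrite normrM (ger0_norm t0) ler_piMl.
    by apply: le_trans (expR_ge1Dx _); rewrite lerDr.
  apply: le_trans (ler_pM (expR_ge0 _) (normr_ge0 _) e1 e2) _.
  by rewrite -!expRD ler_expR; lra.
split.
- by apply: eq_integrable iB => // w _; rewrite /= mulrC.
- exact: iA.
have intZV n (g : T -> R) : measurable_fun setT g -> P.-integrable setT (EFin \o g) ->
    (\int[P]_w (g w / h n)%:E = (h n)^-1%:E * \int[P]_w (g w)%:E)%E.
  move=> mg ig; rewrite -integralZl//; apply: eq_integral => w _.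
  by rewrite mulrC EFinM.
have ifU : P.-integrable setT (fun w => (f (U w))%:E).
  by apply: (@integrable_bounded _ _ _ P (fun w => f (U w)) K mfU) => w; exact: fK.
have ifUV n : P.-integrable setT (fun w => (f (U w + h n *: V))%:E).
  by apply: (@integrable_bounded _ _ _ P (fun w => f (U w + h n *: V)) K (mfUV n)) => w; exact: fK.
have AB n : (\int[P]_w ((f (U w + h n *: V) - f (U w)) / h n)%:E =
    \int[P]_w (f (U w) * ((E n w - 1) / h n))%:E)%E.
  have EE w : E n w = expR (score (h n *: V) w - energy (h n *: V) / 2).
    by rewrite scoreZ energyZ /E; congr expR; ring.
  have ifE : P.-integrable setT (fun w => (f (U w) * E n w)%:E).
    apply: (@le_integrable _ _ _ P _ measurableT _
      (fun w => (K * expR (- (energy (h n *: V) / 2)))%:E * (expR (score (h n *: V) w))%:E)%E).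
    - by apply/measurable_EFinP/measurable_funM.
    - move=> w _; rewrite -EFinM /= lee_fin EE expRD [expR (score _ _) * _]mulrC.
      rewrite -mulrA normrM [leRHS]normrM ler_wpM2r//; exact: le_trans (fK _) (ler_norm _).
    - apply: integrableZl => //; exact: integrable_exp_score.
  rewrite intZV; last 2 first.
  - exact: measurable_funB.
  - by apply: eq_integrable (integrableB measurableT (ifUV n) ifU).
  under eq_integral do rewrite EFinB.
  rewrite integralB// (gaussian_shift_bounded _ mf fK).
  under [X in (_ * (X - _))%E]eq_integral do rewrite -EE.
  rewrite -integralB// -integralZl//; last exact: integrableB.
  by apply: eq_integral => w _; rewrite -EFinB -EFinM; congr EFin; ring.
under eq_integral do rewrite mulrC.
apply: (cvg_unique _ cB) => //.
suff -> : (fun n => \int[P]_w (f (U w) * ((E n w - 1) / h n))%:E)%E = fun n =>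
  (\int[P]_w ((f (U w + h n *: V) - f (U w)) / h n)%:E)%E by exact: cA.
by apply/funext => n; rewrite -AB.
Qed.

End stein.

(** * Rank of a Gaussian matrix *)

(** Once the largest power of the indeterminate is factored out, the cofactor does not vanish at
    [0], hence not near [0]. *)
Lemma poly_near0_neq0 (R : realType) (f : {poly R}) :
  f != 0 -> \forall n \near \oo, f.[n.+1%:R^-1] != 0.
Proof.
move=> f0; have [m [q]] := multiplicity_XsubC f 0.
rewrite f0/= => q0 ->.
have q0' : q.[0] != 0 by move: q0; rewrite rootE.
have cq : q.[n.+1%:R^-1] @[n --> \oo] --> q.[0].
  by apply: continuous_cvg; [exact: continuous_horner|exact: cvg_harmonic].
near=> n.
rewrite hornerM horner_exp !hornerE/= mulf_neq0//.
by near: n; exact: (cvgr_neq0 _ cq q0').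
Unshelve. all: by end_near. Qed.

Section full_rank.
Context d (T : measurableType d) (R : realType) (P : probability T R).
Context (p k : nat) (U : T -> 'M[R]_(p, k)).
Context (theta : 'M[R]_(p, k)) (L : 'M[R]_p).
Hypothesis mU : mxmeas U.
Hypothesis gsU : gaussian_shift P U theta L.

Let r := minn p k.
Let sub (M : 'M[R]_(p, k)) : 'M[R]_r :=
  (pid_mx r : 'M[R]_(r, p)) *m M *m (pid_mx r : 'M[R]_(k, r)).

Lemma gaussian_full_rank : {ae P, forall w, (minn p k <= \rank (U w))%N}.
Proof.
pose V : 'M[R]_(p, k) := pid_mx r.
have subV : sub V = 1%:M.
  by rewrite /sub /V !pid_mx_id ?geq_minl ?geq_minr// pid_mx_1.
pose f (M : 'M[R]_(p, k)) : R := ((\det (sub M)) == 0)%:R.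
have f01 M : 0 <= f M <= 1 by rewrite /f; case: eqP; rewrite ?lexx ?ler01.
have mf : measurable_fun setT (f : borelmx R p k -> R).
  have md : measurable_fun setT (fun M : borelmx R p k => \det (sub M)).
    apply: measurable_det; apply: mxmeasM; last exact: mxmeas_cst.
    by apply: mxmeasM; [exact: mxmeas_cst|exact/mxmeasP].
  (* As [0 / 0 = 0], the expression [1 - x / x] is the indicator of [x = 0]. *)
  have -> : f = fun M => 1 - \det (sub M) / \det (sub M).
    apply/funext => M; rewrite /f; have [->|d0] := eqVneq (\det (sub M)) 0.
      by rewrite mul0r subr0.
    by rewrite divff// subrr.
  apply: measurable_funB => //; apply: measurable_funM => //.
  exact: measurable_invr.
pose t n : R := n.+1%:R^-1.
have t01 n : 0 < t n <= 1 by rewrite invr_gt0 ltr0n/= invf_le1// ler1n.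
have mfU : measurable_fun setT (fun w => f (U w)).
  by apply: (measurableT_comp mf); exact/mxmeasP.
have mfUV n : measurable_fun setT (fun w => f (U w + t n *: V)).
  by apply: (measurableT_comp mf); apply/mxmeasP; exact: mxmeasD.
have [| | | |_ c1] := @dominated_cvg_real _ T R P
  (fun n w => f (U w + t n *: V)) (cst 0) (cst 1).
- exact: mfUV.
- move=> w.
  apply: cvg_near_cst.
  (* The determinant of [sub (U w) + t 1] is the characteristic polynomial of [- sub (U w)] at [t],
     so [f (U w + t n V)] is eventually [0] for every [w]. *)
  have : char_poly (- sub (U w)) != 0 by rewrite monic_neq0// char_poly_monic.
  move/poly_near0_neq0; apply: filterS => n.
  rewrite /f => detn; case: eqP => // sub0; move/negP: detn; case.
  rewrite -sub0 /char_poly -[_.[_]]/(horner_eval _ _) -det_map_mx; apply/eqP; congr (\det _).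
  apply/matrixP => i j; rewrite /sub mulmxDr mulmxDl -scalemxAr -scalemxAl.
  rewrite -/(sub V) -/(sub (U w)) subV; move: (sub (U w)) => S.
  rewrite !mxE /= /horner_eval !hornerE hornerMn hornerX opprK addrC.
  by rewrite mulr_natr.
- exact: finite_measure_integrable_cst.
- by move=> n w; rewrite ger0_norm; case/andP: (f01 (U w + t n *: V)).
pose E n w := expR (score U theta L (t n *: V) w - energy L (t n *: V) / 2).
have mE n : measurable_fun setT (E n).
  apply: measurableT_comp => //; apply: measurable_funB => //.
  exact: measurable_score.
have [| | | |_ c2] := @dominated_cvg_real _ T R P
  (fun n w => f (U w) * E n w) (fun w => f (U w))
  (fun w => expR (`|energy L V| / 2) * expR (`|score U theta L V w|)).
- by move=> n; exact: measurable_funM.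
- move=> w.
  have t0 : t n @[n --> \oo] --> (0 : R) by exact: cvg_harmonic.
  set s := score U theta L V w; set Q := energy L V.
  have c0 : t n * s - t n * t n * Q / 2 @[n --> \oo] --> 0 * s - 0 * 0 * Q / 2.
    apply: cvgB; first by apply: cvgM => //; exact: cvg_cst.
    apply: cvgM; last exact: cvg_cst.
    by apply: cvgM; [exact: cvgM|exact: cvg_cst].
  have c1' : f (U w) * expR (t n * s - t n * t n * Q / 2) @[n --> \oo] -->
      f (U w) * expR (0 * s - 0 * 0 * Q / 2).
    apply: cvgM; first exact: cvg_cst.
    by apply: continuous_cvg => //; exact: continuous_expR.
  move: c1'; rewrite !mul0r subrr expR0 mulr1.
  apply: cvg_trans; apply: near_eq_cvg; near=> n.
  by rewrite /E scoreZ energyZ.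
- apply: eq_integrable (integrableZl measurableT (expR (`|energy L V| / 2))
    (integrable_exp_abs_score mU gsU V)) => //.
- move=> n w; rewrite ger0_norm; last by rewrite mulr_ge0 ?expR_ge0//; case/andP: (f01 (U w)).
  rewrite -[leRHS]mul1r; apply: ler_pM; rewrite ?expR_ge0//; try by case/andP: (f01 (U w)).
  rewrite -expRD ler_expR scoreZ energyZ addrC; case/andP: (t01 n) => t0 t1.
  apply: lerD.
    rewrite (le_trans (ler_norm _))// normrN -mulrA normrM (ger0_norm (sqr_ge0 _)).
    rewrite normrM [X in _ * (_ * X)]ger0_norm//.
    by rewrite ler_piMl ?mulr_ge0// expr_le1// ltW.
  by rewrite (le_trans (ler_norm _))// normrM (ger0_norm (ltW t0)) ler_piMl.
(* One sequence has two limits: [E f(U + t n V)] tends to [0] by pointwise convergence and to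
   [E f(U)] by the translation formula. *)
have f0 : (\int[P]_w (f (U w))%:E = 0)%E.
  apply: (cvg_unique _ c2) => //.
  suff -> : (fun n => \int[P]_w (f (U w) * E n w)%:E)%E =
    (fun n => \int[P]_w (f (U w + t n *: V))%:E)%E.
    by move: c1; rewrite [X in _ --> X -> _]integral0_eq.
  apply/funext => n; rewrite (@gaussian_shift_bounded _ _ _ _ _ _ _ _ _ mU gsU _ _ 1 mf)// => x.
  by rewrite ger0_norm; case/andP: (f01 x).
have : (\int[P]_w `|(f (U w))%:E| = 0)%E.
  rewrite -[RHS]f0; apply: eq_integral => w _.
  by rewrite gee0_abs// lee_fin; case/andP: (f01 (U w)).
move/(ae_eq_integral_abs P measurableT _).1 => H.
have {}H : ae_eq P setT (fun w => (f (U w))%:E) (cst 0%E).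
  by apply: H; exact/measurable_EFinP.
apply: filterS H => w /(_ Logic.I) [].
rewrite /f; case: eqP => [_ /eqP|/eqP du _]; first by rewrite oner_eq0.
have : row_full (sub (U w)).
  by rewrite row_full_unit unitmxE unitfE.
rewrite /row_full => /eqP rs.
rewrite -/r -{1}rs /sub; apply: leq_trans (mxrankM_maxl _ _) _.
exact: mxrankM_maxr.
Unshelve. all: by end_near. Qed.

End full_rank.

(** * Entrywise limits, bounds and derivatives *)

Section entrywise_limits.
Context (R : realType) (I : Type) (F : set_system I) {FF : Filter F}.

Definition mxcvg m n (M : I -> 'M[R]_(m, n)) (l : 'M[R]_(m, n)) :=
  forall i j, M t i j @[t --> F] --> l i j.

Lemma mxcvg_cst m n (A : 'M[R]_(m, n)) : mxcvg (fun=> A) A.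
Proof. by move=> i j; exact: cvg_cst. Qed.

Lemma mxcvgD m n (M N : I -> 'M[R]_(m, n)) l k :
  mxcvg M l -> mxcvg N k -> mxcvg (fun t => M t + N t) (l + k).
Proof. by move=> hM hN i j; rewrite mxE; under eq_fun do rewrite mxE; exact: cvgD. Qed.

Lemma mxcvgN m n (M : I -> 'M[R]_(m, n)) l :
  mxcvg M l -> mxcvg (fun t => - M t) (- l).
Proof. by move=> hM i j; rewrite mxE; under eq_fun do rewrite mxE; exact: cvgN. Qed.

Lemma mxcvgB m n (M N : I -> 'M[R]_(m, n)) l k :
  mxcvg M l -> mxcvg N k -> mxcvg (fun t => M t - N t) (l - k).
Proof. by move=> hM hN; apply: mxcvgD => //; exact: mxcvgN. Qed.

Lemma mxcvgZ m n (a : I -> R) (M : I -> 'M[R]_(m, n)) (b : R) l :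
  a t @[t --> F] --> b -> mxcvg M l -> mxcvg (fun t => a t *: M t) (b *: l).
Proof. by move=> ha hM i j; rewrite mxE; under eq_fun do rewrite mxE; exact: cvgM. Qed.

Lemma mxcvgT m n (M : I -> 'M[R]_(m, n)) l :
  mxcvg M l -> mxcvg (fun t => (M t)^T) l^T.
Proof. by move=> hM i j; rewrite mxE; under eq_fun do rewrite mxE; exact: hM. Qed.

Lemma cvg_sum_finType (J : finType) (f : J -> I -> R) (l : J -> R) :
  (forall j, f j t @[t --> F] --> l j) ->
  \sum_j f j t @[t --> F] --> \sum_j l j.
Proof.
move=> fl; elim: (index_enum J) => [|j s IH].
  by rewrite big_nil; under eq_fun do rewrite big_nil; exact: cvg_cst.
by rewrite big_cons; under eq_fun do rewrite big_cons; exact: cvgD.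
Qed.

Lemma mxcvgM m n k (M : I -> 'M[R]_(m, n)) (N : I -> 'M[R]_(n, k)) l l' :
  mxcvg M l -> mxcvg N l' -> mxcvg (fun t => M t *m N t) (l *m l').
Proof.
move=> hM hN i j; rewrite mxE; under eq_fun do rewrite mxE.
by apply: cvg_sum_finType => a; exact: cvgM.
Qed.

Lemma cvg_mxtrace n (M : I -> 'M[R]_n) l :
  mxcvg M l -> \tr (M t) @[t --> F] --> \tr l.
Proof. by move=> hM; exact: cvg_sum_finType. Qed.

Lemma mxcvg_eq m n (M N : I -> 'M[R]_(m, n)) l k :
  mxcvg M l -> M =1 N -> l = k -> mxcvg N k.
Proof. by move=> hM /funext <- <-. Qed.

Lemma mxcvg_near m n (M N : I -> 'M[R]_(m, n)) l k :
  mxcvg M l -> (\forall t \near F, M t = N t) -> l = k -> mxcvg N k.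
Proof.
move=> hM MN <- i j; apply: cvg_trans (hM i j); apply: near_eq_cvg.
by apply: filterS MN => t ->.
Qed.

End entrywise_limits.

Section entrywise_bounds.
Context (R : realType) (I : Type).

Definition rbounded (f : I -> R) := exists K, forall x, `|f x| <= K.

Definition mxbounded m n (M : I -> 'M[R]_(m, n)) :=
  exists K, forall x i j, `|M x i j| <= K.

Lemma rbounded_cst c : rbounded (fun=> c). Proof. by exists `|c|. Qed.

Lemma rboundedD f g : rbounded f -> rbounded g -> rbounded (fun x => f x + g x).
Proof.
move=> [K fK] [L gL]; exists (K + L) => x.
by rewrite (le_trans (ler_normD _ _))// lerD.
Qed.

Lemma rboundedM f g : rbounded f -> rbounded g -> rbounded (fun x => f x * g x).
Proof.
move=> [K fK] [L gL]; exists (K * L) => x.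
by rewrite normrM ler_pM.
Qed.

Lemma rboundedN f : rbounded f -> rbounded (fun x => - f x).
Proof. by move=> [K fK]; exists K => x; rewrite normrN. Qed.

Lemma rbounded_sum (J : finType) (f : J -> I -> R) :
  (forall j, rbounded (f j)) -> rbounded (fun x => \sum_j f j x).
Proof.
move=> bf; elim: (index_enum J) => [|j s IH].
  by exists 0 => x; rewrite big_nil normr0.
by under eq_fun do rewrite big_cons; exact: rboundedD.
Qed.

Lemma mxboundedP m n (M : I -> 'M[R]_(m, n)) :
  mxbounded M <-> forall i j, rbounded (fun x => M x i j).
Proof.
split=> [[K MK] i j|bM]; first by exists K.
pose K i j := projT1 (cid (bM i j)).
have KP i j x : `|M x i j| <= K i j := projT2 (cid (bM i j)) x.
exists (\sum_i \sum_j `|K i j|) => x i j.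
rewrite (le_trans (KP i j x))// (le_trans (ler_norm _))//.
rewrite (bigD1 i)//= (bigD1 j)//= -addrA lerDl addr_ge0// sumr_ge0// => *.
by rewrite sumr_ge0.
Qed.

Lemma mxbounded_cst m n (A : 'M[R]_(m, n)) : mxbounded (fun=> A).
Proof. by apply/mxboundedP => i j; exact: rbounded_cst. Qed.

Lemma mxboundedD m n (M N : I -> 'M[R]_(m, n)) :
  mxbounded M -> mxbounded N -> mxbounded (fun x => M x + N x).
Proof.
move=> /mxboundedP hM /mxboundedP hN; apply/mxboundedP => i j.
by under eq_fun do rewrite mxE; exact: rboundedD.
Qed.

Lemma mxboundedN m n (M : I -> 'M[R]_(m, n)) :
  mxbounded M -> mxbounded (fun x => - M x).
Proof.
move=> /mxboundedP hM; apply/mxboundedP => i j.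
by under eq_fun do rewrite mxE; exact: rboundedN.
Qed.

Lemma mxboundedB m n (M N : I -> 'M[R]_(m, n)) :
  mxbounded M -> mxbounded N -> mxbounded (fun x => M x - N x).
Proof. by move=> hM hN; apply: mxboundedD => //; exact: mxboundedN. Qed.

Lemma mxboundedZ m n a (M : I -> 'M[R]_(m, n)) :
  rbounded a -> mxbounded M -> mxbounded (fun x => a x *: M x).
Proof.
move=> ha /mxboundedP hM; apply/mxboundedP => i j.
by under eq_fun do rewrite mxE; exact: rboundedM.
Qed.

Lemma mxboundedT m n (M : I -> 'M[R]_(m, n)) :
  mxbounded M -> mxbounded (fun x => (M x)^T).
Proof. by move=> [K MK]; exists K => x i j; rewrite mxE. Qed.

Lemma mxboundedM m n k (M : I -> 'M[R]_(m, n)) (N : I -> 'M[R]_(n, k)) :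
  mxbounded M -> mxbounded N -> mxbounded (fun x => M x *m N x).
Proof.
move=> /mxboundedP hM /mxboundedP hN; apply/mxboundedP => i j.
by under eq_fun do rewrite mxE; apply: rbounded_sum => l; exact: rboundedM.
Qed.

Lemma rbounded_mxtrace n (M : I -> 'M[R]_n) :
  mxbounded M -> rbounded (fun x => \tr (M x)).
Proof. by move=> /mxboundedP hM; exact: rbounded_sum. Qed.

End entrywise_bounds.

Section matrix_derivative.
Context (R : realType).

Definition mxder0 m n (M : R -> 'M[R]_(m, n)) (dM : 'M[R]_(m, n)) :=
  mxcvg (0 : R)^' (fun t => t^-1 *: (M t - M 0)) dM.

Lemma mxder0_entry m n (M : R -> 'M[R]_(m, n)) dM i j :
  mxder0 M dM -> der0 (fun t => M t i j) (dM i j).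
Proof.
move=> /(_ i j); rewrite /der0.
by under eq_fun do rewrite !mxE mulrC.
Qed.

Lemma mxder0_cvg m n (M : R -> 'M[R]_(m, n)) dM :
  mxder0 M dM -> mxcvg (0 : R)^' M (M 0).
Proof.
move=> hM.
have t0 : (t : R) @[t --> (0:R)^'] --> 0 by apply: cvg_within.
apply: mxcvg_near (mxcvgD (mxcvgZ t0 hM) (@mxcvg_cst _ _ _ _ _ _ (M 0))) _ _.
  near=> t; rewrite scalerA mulfV ?scale1r ?subrK//.
  by near: t; exact: nbhs_dnbhs_neq.
by rewrite scale0r add0r.
Unshelve. all: by end_near. Qed.

Lemma mxder0_cst m n (A : 'M[R]_(m, n)) : mxder0 (fun=> A) 0.
Proof.
move=> i j; under eq_fun do rewrite subrr scaler0; exact: cvg_cst.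
Qed.

Lemma mxder0_line m n (A V : 'M[R]_(m, n)) : mxder0 (fun t => A + t *: V) V.
Proof.
move=> i j; apply: cvg_near_cst; near=> t.
rewrite scale0r addr0 addrC addKr scalerA mulVf ?scale1r//.
by near: t; exact: nbhs_dnbhs_neq.
Unshelve. all: by end_near. Qed.

Lemma mxder0D m n (M N : R -> 'M[R]_(m, n)) dM dN :
  mxder0 M dM -> mxder0 N dN -> mxder0 (fun t => M t + N t) (dM + dN).
Proof.
move=> hM hN; apply: mxcvg_eq (mxcvgD hM hN) _ erefl => t /=.
by rewrite -scalerDr addrACA opprD.
Qed.

Lemma mxder0T m n (M : R -> 'M[R]_(m, n)) dM :
  mxder0 M dM -> mxder0 (fun t => (M t)^T) dM^T.
Proof.
move=> hM; apply: mxcvg_eq (mxcvgT hM) _ erefl => t /=.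
by apply/matrixP => i j; rewrite !mxE.
Qed.

Lemma mxder0M m n k (M : R -> 'M[R]_(m, n)) (N : R -> 'M[R]_(n, k)) dM dN :
  mxder0 M dM -> mxder0 N dN ->
  mxder0 (fun t => M t *m N t) (dM *m N 0 + M 0 *m dN).
Proof.
move=> hM hN.
apply: mxcvg_eq (mxcvgD (mxcvgM hM (mxder0_cvg hN))
  (mxcvgM (@mxcvg_cst _ _ _ _ _ _ (M 0)) hN)) _ erefl => t /=.
by rewrite -scalemxAl -scalemxAr -scalerDr mulmxBl mulmxBr addrA subrK.
Qed.

Lemma mxder0Zl m n c (M : R -> 'M[R]_(m, n)) dM :
  mxder0 M dM -> mxder0 (fun t => c *: M t) (c *: dM).
Proof.
move=> hM; apply: mxcvg_eq (mxcvgZ (cvg_cst c) hM) _ erefl => t /=.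
by rewrite -scalerBr !scalerA mulrC.
Qed.

Lemma mxder0N m n (M : R -> 'M[R]_(m, n)) dM :
  mxder0 M dM -> mxder0 (fun t => - M t) (- dM).
Proof.
move=> hM; apply: mxcvg_eq (mxcvgN hM) _ erefl => t /=.
by rewrite -scalerN opprD.
Qed.

Lemma der0_mxtrace n (M : R -> 'M[R]_n) dM :
  mxder0 M dM -> der0 (fun t => \tr (M t)) (\tr dM).
Proof.
move=> hM.
have H : \tr (t^-1 *: (M t - M 0)) @[t --> (0 : R)^'] --> \tr dM by exact: cvg_mxtrace.
rewrite /der0.
suff -> : (fun t => (\tr (M t) - \tr (M 0)) / t) = fun t => \tr (t^-1 *: (M t - M 0)) by [].
by apply/funext => t; rewrite mxtraceZ raddfB/= mulrC.
Qed.

Lemma der0_cvg (g : R -> R) dg : der0 g dg -> g t @[t --> (0:R)^'] --> g 0.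
Proof.
move=> hg.
have t0 : (t : R) @[t --> (0:R)^'] --> 0 by apply: cvg_within.
have H : t * ((g t - g 0) / t) + g 0 @[t --> (0:R)^'] --> 0 * dg + g 0.
  by apply: cvgD; [exact: cvgM|exact: cvg_cst].
move: H; rewrite mul0r add0r; apply: cvg_trans; apply: near_eq_cvg; near=> t.
rewrite /= mulrC divfK ?subrK//.
by near: t; exact: nbhs_dnbhs_neq.
Unshelve. all: by end_near. Qed.

Lemma cvg_bounded_mul0 (I : Type) (F : set_system I) {FF : Filter F} (f g : I -> R) K :
  (forall t, `|f t| <= K) -> g t @[t --> F] --> 0 -> f t * g t @[t --> F] --> 0.
Proof.
move=> fK g0; apply: norm_cvg0.
apply: (@squeeze_cvgr _ _ _ _ (fun=> 0) (fun t => K * `|g t|)).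
- by near=> t; rewrite normr_ge0/= normrM ler_wpM2r.
- exact: cvg_cst.
- have H : K * `|g t| @[t --> F] --> K * `|0 : R|.
    by apply: cvgM; [exact: cvg_cst|exact: cvg_norm].
  by move: H; rewrite normr0 mulr0.
Unshelve. all: by end_near. Qed.

(** The resolvent identity [M_t^-1 - M_0^-1 = - M_t^-1 (M_t - M_0) M_0^-1]. With the uniform bound
    on the inverses it first yields their continuity at [0], and then the derivative. *)
Lemma mxder0_inv n (M : R -> 'M[R]_n) dM :
  (forall t, M t \in unitmx) -> mxbounded (fun t => invmx (M t)) ->
  mxder0 M dM ->
  mxder0 (fun t => invmx (M t)) (- (invmx (M 0) *m dM *m invmx (M 0))).
Proof.
move=> uM [K bG] hM.
have GE t : invmx (M t) - invmx (M 0) = - (invmx (M t) *m (M t - M 0) *m invmx (M 0)).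
  by rewrite mulmxBr mulVmx// mulmxBl mul1mx -mulmxA mulmxV// mulmx1 opprB.
have cG : mxcvg (0 : R)^' (fun t => invmx (M t)) (invmx (M 0)).
  have cM : mxcvg (0 : R)^' (fun t => M t - M 0) 0.
    by apply: mxcvg_eq (mxcvgB (mxder0_cvg hM) (@mxcvg_cst _ _ _ _ _ _ (M 0))) _ (subrr _).
  have c0 : mxcvg (0 : R)^' (fun t => invmx (M t) *m (M t - M 0)) 0.
    move=> i j; rewrite mxE; under eq_fun do rewrite mxE.
    rewrite [X in nbhs X](_ : _ = \sum_(k < n) (0 : R)); last by rewrite big1.
    apply: cvg_sum_finType => k; apply: (cvg_bounded_mul0 (K := K)) => //.
    by have := cM k j; rewrite mxE.
  apply: mxcvg_eq (mxcvgB (@mxcvg_cst _ _ _ _ _ _ (invmx (M 0)))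
    (mxcvgM c0 (@mxcvg_cst _ _ _ _ _ _ (invmx (M 0))))) _ _.
    by move=> t /=; rewrite -[in RHS](subrK (invmx (M 0)) (invmx (M t))) GE addrC.
  by rewrite mul0mx subr0.
apply: mxcvg_eq (mxcvgN (mxcvgM (mxcvgM cG hM) (@mxcvg_cst _ _ _ _ _ _ (invmx (M 0))))) _ erefl => t /=.
by rewrite GE scalerN scalemxAl scalemxAr.
Qed.

End matrix_derivative.

(** * Ridge regularization of the Moore-Penrose inverse *)

Section delta_sums.
Context (R : realType).

(** This is the trace of the linear map [E -> A E C] on matrices; the next lemma treats
    [E -> A E^T C]. Together they evaluate divergences. *)
Lemma sum_delta_mx p k (A : 'M[R]_p) (C : 'M[R]_k) :
  \sum_(ij : 'I_p * 'I_k) (A *m delta_mx ij.1 ij.2 *m C) ij.1 ij.2 = \tr A * \tr C.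
Proof.
rewrite /mxtrace mulr_suml; under [RHS]eq_bigr do rewrite mulr_sumr.
rewrite pair_big/=; apply: eq_bigr => -[i j] _ /=.
rewrite mxE (bigD1 j)//= big1 ?addr0 => [|l lj].
  rewrite mxE (bigD1 i)//= big1 ?addr0 => [|l li]; rewrite mxE ?eqxx ?mulr1//.
  by rewrite (negbTE li) mulr0.
rewrite mxE big1 ?mul0r// => a _; rewrite mxE (negbTE lj) andbF mulr0//.
Qed.

Lemma sum_delta_mx_tr p k (A C : 'M[R]_(p, k)) :
  \sum_(ij : 'I_p * 'I_k) (A *m (delta_mx ij.1 ij.2)^T *m C) ij.1 ij.2 = \tr (A^T *m C).
Proof.
rewrite /mxtrace; under [RHS]eq_bigr do rewrite mxE.
rewrite exchange_big pair_big/=; apply: eq_bigr => -[i j] _ /=.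
rewrite mxE (bigD1 i)//= big1 ?addr0 => [|l lj].
  rewrite !mxE (bigD1 j)//= big1 ?addr0 => [|l li]; rewrite !mxE ?eqxx ?mulr1//.
  by rewrite (negbTE li) andbF mulr0.
rewrite mxE big1 ?mul0r// => a _; rewrite !mxE (negbTE lj) mulr0//.
Qed.

Lemma mxtrace_delta_mx p k (N : 'M[R]_(k, p)) i j :
  \tr (N *m delta_mx i j) = N j i.
Proof.
rewrite /mxtrace (bigD1 j)//= big1 ?addr0 => [|l lj].
  rewrite mxE (bigD1 i)//= big1 ?addr0 => [|l li]; rewrite mxE ?eqxx ?mulr1//.
  by rewrite (negbTE li) mulr0.
by rewrite mxE big1// => a _; rewrite mxE (negbTE lj) andbF mulr0.
Qed.

Lemma mxtrace_mul_sum p k (M : 'M[R]_(p, k)) (N : 'M[R]_(k, p)) :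
  \tr (M *m N) = \sum_(ij : 'I_p * 'I_k) M ij.1 ij.2 * N ij.2 ij.1.
Proof.
rewrite /mxtrace; under eq_bigr do rewrite mxE.
by rewrite pair_big.
Qed.

Lemma mxtrace_gram_ge0 p k (M : 'M[R]_(p, k)) : 0 <= \tr (M^T *m M).
Proof.
rewrite mxtrace_mul_sum sumr_ge0// => -[i j] _ /=.
by rewrite mxE -expr2 sqr_ge0.
Qed.

Lemma sqr_entry_le_gram p k (M : 'M[R]_(p, k)) i j : M i j ^+ 2 <= (M^T *m M) j j.
Proof.
rewrite mxE (bigD1 i)//= mxE -expr2 lerDl sumr_ge0// => l _.
by rewrite mxE -expr2 sqr_ge0.
Qed.

Lemma gram_entry_ge0 p k (M : 'M[R]_(p, k)) j : 0 <= (M^T *m M) j j.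
Proof. by rewrite mxE sumr_ge0// => l _; rewrite mxE -expr2 sqr_ge0. Qed.

Lemma sqr_entry_le_mxtrace p k (M : 'M[R]_(p, k)) i j : M i j ^+ 2 <= \tr (M^T *m M).
Proof.
apply: le_trans (sqr_entry_le_gram M i j) _.
by rewrite /mxtrace (bigD1 j)//= lerDl sumr_ge0// => l _; exact: gram_entry_ge0.
Qed.

Lemma mxtrace_gram_eq0 p k (M : 'M[R]_(p, k)) : \tr (M^T *m M) = 0 -> M = 0.
Proof.
move=> h; apply/matrixP => i j; rewrite mxE; apply/eqP.
rewrite -sqrf_eq0 eq_le sqr_ge0 andbT -h; exact: sqr_entry_le_mxtrace.
Qed.

(** As [(M^2)_jj] is the sum of the [M_lj^2], the hypothesis gives [M_lj^2 <= M_jj]; for [l = j]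
    this forces [M_jj <= 1], and all entries follow. It stands in for a spectral bound, uniform in
    [delta] and [U] for [rP] and [rQ]. *)
Lemma contraction_entry n (M : 'M[R]_n) i j : M^T = M ->
  (forall l, 0 <= (M - M *m M) l l) -> `|M i j| <= 1.
Proof.
move=> Ms Md.
have h l m : M l m ^+ 2 <= M m m.
  have := Md m; rewrite !mxE subr_ge0; apply: le_trans.
  have := sqr_entry_le_gram M l m; by rewrite Ms mxE.
have Mj1 : M j j <= 1.
  rewrite leNgt; apply/negP => M1; have := h j j.
  by rewrite expr2 leNgt ltr_pMr ?M1// (lt_trans ltr01).
rewrite -(ler_pXn2r (n := 2))// ?nnegrE// expr1n -normrX.
by rewrite ger0_norm ?sqr_ge0//; exact: le_trans (h i j) Mj1.
Qed.

End delta_sums.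

(** Pure algebra: the derivative of the ridge field is sorted into terms [A E C] and [A E^T C],
    whose traces are known. *)
Lemma rdH_expand (R : realType) p k q (G P : 'M[R]_p) (A E : 'M[R]_(p, k)) (Q : 'M[R]_k)
  (a : 'M[R]_(k, q)) (X : 'M[R]_(p, q)) (delta : R) : G^T = G -> Q^T = Q ->
  delta *: (G *m E *m A^T + A *m E^T *m G) *m X *m a^T +
  P *m X *m (E^T *m G *m X - A^T *m E *m a - Q *m (E^T *m G *m X))^T =
  delta *: G *m E *m (A^T *m X *m a^T) + A *m E^T *m (delta *: (G *m X *m a^T)) +
  P *m X *m X^T *m G *m E *m 1%:M - P *m X *m a^T *m E^T *m A -
  P *m X *m X^T *m G *m E *m Q.
Proof.
move=> Gs Qs.
have -> : (E^T *m G *m X - A^T *m E *m a - Q *m (E^T *m G *m X))^T =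
    X^T *m G *m E - a^T *m E^T *m A - X^T *m G *m E *m Q.
  by rewrite linearB /= linearB /= !trmx_mul !trmxK Gs Qs !mulmxA.
rewrite !mulmxBr mulmx1 !addrA.
congr (_ - _ - _); rewrite ?mulmxA//.
congr (_ + _).
by rewrite scalerDr !mulmxDl -!scalemxAl -!scalemxAr !mulmxA.
Qed.

Section ridge.
Context (R : realType) (p k q : nat) (X : 'M[R]_(p, q)) (delta : R).
Hypothesis delta0 : 0 < delta.
Implicit Types U E : 'M[R]_(p, k).

(* With [S := U *m U^T], as [delta] tends to [0]: [rG U] restricted to the range
   of [S] tends to [S^+], [rA U] to [S^+ *m U], [rP U] to [S *m S^+], [rF U] and
   [rF2 U] to [Fstat X S]. *)
Definition ridge U := U *m U^T + delta%:M.
Definition rG U := invmx (ridge U).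
Definition rA U := rG U *m U.
Definition rP U := 1%:M - delta *: rG U.
Definition rQ U := U^T *m rA U.
Definition ra U := (rA U)^T *m X.
Definition rF U := \tr ((ra U)^T *m ra U).
(** Tends to [Pi X X^T S^+ U], the field to which Stein's identity is applied. *)
Definition rH U := rP U *m X *m (ra U)^T.
Definition rF2 U := \tr ((ra U)^T *m rQ U *m ra U).
(** [rT1] and [rT2] both tend to [tr ((X^T S^+ X)^2)]; they arise when [rF] is differentiated along
    [rH]. *)
Definition rT1 U := \tr ((ra U)^T *m ra U *m ((ra U)^T *m ra U)).
Definition rT2 U := \tr ((ra U)^T *m ra U *m ((ra U)^T *m rQ U *m ra U)).

(** The ridge matrix is the Gram matrix of the block row [[U, sqrt delta 1]], whose second block
    alone gives full row rank. *)
Lemma ridge_unit U : ridge U \in unitmx.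
Proof.
have -> : ridge U = row_mx U (Num.sqrt delta)%:M *m (row_mx U (Num.sqrt delta)%:M)^T.
  rewrite tr_row_mx mul_row_col tr_scalar_mx mul_scalar_mx scale_scalar_mx.
  by rewrite -expr2 sqr_sqrtr// ltW.
apply: gram_unitmx; apply/row_freeP; exists (col_mx 0 (Num.sqrt delta)^-1%:M).
rewrite mul_row_col mulmx0 add0r mul_scalar_mx scale_scalar_mx mulfV//.
by rewrite gt_eqF// sqrtr_gt0.
Qed.

Lemma rG_sym U : (rG U)^T = rG U.
Proof.
by rewrite /rG trmx_inv /ridge linearD/= trmx_mul trmxK tr_scalar_mx.
Qed.

Lemma mul_gram_rG U : U *m U^T *m rG U = rP U.
Proof.
apply/eqP; rewrite /rP eq_sym subr_eq -mul_scalar_mx -mulmxDl.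
by rewrite mulmxV// ridge_unit.
Qed.

Lemma rP_sym U : (rP U)^T = rP U.
Proof. by rewrite /rP linearB/= linearZ/= rG_sym trmx1. Qed.

Lemma mul_rG_gram U : rG U *m (U *m U^T) = rP U.
Proof.
by rewrite -rP_sym -mul_gram_rG !trmx_mul trmxK rG_sym.
Qed.

Lemma rA_tr U : (rA U)^T = U^T *m rG U.
Proof. by rewrite /rA trmx_mul rG_sym. Qed.

Lemma mul_U_rAT U : U *m (rA U)^T = rP U.
Proof. by rewrite rA_tr mulmxA mul_gram_rG. Qed.

Lemma mul_rA_UT U : rA U *m U^T = rP U.
Proof. by rewrite /rA -mulmxA mul_rG_gram. Qed.

Lemma rQ_sym U : (rQ U)^T = rQ U.
Proof. by rewrite /rQ trmx_mul trmxK rA_tr mulmxA. Qed.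

Lemma rGP U : rG U *m rP U = rA U *m (rA U)^T.
Proof. by rewrite -mul_U_rAT mulmxA. Qed.

Lemma rPG U : rP U *m rG U = rA U *m (rA U)^T.
Proof. by rewrite -mul_rA_UT -mulmxA -rA_tr. Qed.

Lemma rATU U : (rA U)^T *m U = rQ U.
Proof. by rewrite -[RHS]rQ_sym /rQ [RHS]trmx_mul trmxK. Qed.

Lemma rATP U : (rA U)^T *m rP U = rQ U *m (rA U)^T.
Proof. by rewrite -mul_U_rAT mulmxA rATU. Qed.

Lemma scale_rG U : delta *: rG U = 1%:M - rP U.
Proof. by rewrite /rP opprB addrC subrK. Qed.

(** Follows from [delta G = 1 - P]. It makes the diagonal of [Q - Q^2] nonnegative, which bounds
    [rQ]; read backwards, it then bounds [rA]. *)
Lemma delta_rAA U : delta *: ((rA U)^T *m rA U) = rQ U - rQ U *m rQ U.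
Proof.
have -> : delta *: ((rA U)^T *m rA U) = (rA U)^T *m (U - rP U *m U).
  by rewrite scalemxAr {2}/rA scalemxAl scale_rG mulmxBl mul1mx.
by rewrite mulmxBr mulmxA rATP -mulmxA rATU.
Qed.

Lemma mxtrace_rQ U : \tr (rQ U) = \tr (rP U).
Proof. by rewrite /rQ mxtrace_mulC mul_rA_UT. Qed.

Lemma delta_mxtrace_rG U : delta * \tr (rG U) = p%:R - \tr (rQ U).
Proof. by rewrite -mxtraceZ scale_rG linearB/= mxtrace1 mxtrace_rQ. Qed.

Lemma rQ_entry U i j : `|rQ U i j| <= 1.
Proof.
apply: contraction_entry; first exact: rQ_sym.
by move=> l; rewrite -delta_rAA mxE mulr_ge0 ?gram_entry_ge0// ltW.
Qed.

Lemma rP_entry U i j : `|rP U i j| <= 1.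
Proof.
apply: contraction_entry; first exact: rP_sym.
move=> l.
have -> : rP U - rP U *m rP U = delta *: ((rA U)^T^T *m (rA U)^T).
  by rewrite trmxK -rPG scalemxAr scale_rG [RHS]mulmxBr mulmx1.
by rewrite mxE mulr_ge0 ?gram_entry_ge0// ltW.
Qed.

(** [rdP], [rda], [rdH] and [rdF] are derivatives at [U] in the direction [E], as [der_rP] to
    [der_rF] establish; the divergences need only the formulas. *)
Definition rdP U E := delta *: (rG U *m E *m (rA U)^T + rA U *m E^T *m rG U).
Definition rda U E :=
  E^T *m rG U *m X - (rA U)^T *m E *m ra U - rQ U *m (E^T *m rG U *m X).
Definition rdH U E := rdP U E *m X *m (ra U)^T + rP U *m X *m (rda U E)^T.
Definition rdF U E := 2 * \tr ((ra U)^T *m rda U E).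

Lemma raT U : (ra U)^T = X^T *m rA U.
Proof. by rewrite /ra trmx_mul trmxK. Qed.

Lemma rGX_P_X U : X^T *m rG U *m (rP U *m X) = (ra U)^T *m ra U.
Proof. by rewrite raT /ra !mulmxA -(mulmxA X^T) rGP !mulmxA. Qed.

Lemma rATPX U : (rA U)^T *m (rP U *m X) = rQ U *m ra U.
Proof. by rewrite mulmxA rATP -mulmxA. Qed.

Lemma rATGX U : (rA U)^T *m (delta *: (rG U *m X)) = ra U - rQ U *m ra U.
Proof. by rewrite scalemxAl scale_rG mulmxBl mul1mx mulmxBr rATPX. Qed.

Lemma PXT_rA U : (rP U *m X)^T *m rA U = (ra U)^T *m rQ U.
Proof.
apply: trmx_inj; rewrite [LHS]trmx_mul [RHS]trmx_mul !trmxK rQ_sym; exact: rATPX.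
Qed.

Let entry5 (M1 M2 M3 M4 M5 : 'M[R]_(p, k)) i j :
  (M1 + M2 + M3 - M4 - M5) i j = M1 i j + M2 i j + M3 i j - M4 i j - M5 i j.
Proof. by rewrite !mxE. Qed.

(** The five terms of [rdH_expand] contribute, in order, [(p - tr Q) F], [F - F2], [k F], [- F2] and
    [- tr Q F]. *)
Lemma divergence_rH U :
  \sum_(ij : 'I_p * 'I_k) rdH U (delta_mx ij.1 ij.2) ij.1 ij.2 =
  (p%:R + k%:R - 2 * \tr (rQ U) + 1) * rF U - 2 * rF2 U.
Proof.
have E1 ij : rdH U (delta_mx ij.1 ij.2) ij.1 ij.2 =
  (delta *: rG U *m delta_mx ij.1 ij.2 *m (ra U *m (ra U)^T)) ij.1 ij.2 +
  (rA U *m (delta_mx ij.1 ij.2)^T *m (delta *: (rG U *m X *m (ra U)^T))) ij.1 ij.2 +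
  (rP U *m X *m X^T *m rG U *m delta_mx ij.1 ij.2 *m 1%:M) ij.1 ij.2 -
  (rP U *m X *m (ra U)^T *m (delta_mx ij.1 ij.2)^T *m rA U) ij.1 ij.2 -
  (rP U *m X *m X^T *m rG U *m delta_mx ij.1 ij.2 *m rQ U) ij.1 ij.2.
  rewrite /rdH /rdP /rda (rdH_expand _ _ _ _ _ _ (rG_sym U) (rQ_sym U)).
  exact: entry5.
under eq_bigr do rewrite E1.
rewrite !sumrB !big_split/= !sum_delta_mx !sum_delta_mx_tr.
have -> : \tr (rP U *m X *m X^T *m rG U) = rF U.
  by rewrite -[rP U *m X *m X^T *m rG U]mulmxA mxtrace_mulC rGX_P_X.
have -> : \tr (ra U *m (ra U)^T) = rF U by rewrite mxtrace_mulC.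
rewrite mxtrace1 mxtraceZ delta_mxtrace_rG.
have -> : \tr ((rA U)^T *m (delta *: (rG U *m X *m (ra U)^T))) = rF U - rF2 U.
  rewrite scalemxAl mulmxA rATGX mulmxBl linearB/= mxtrace_mulC; congr (_ - _).
  by rewrite mxtrace_mulC mulmxA.
have -> : \tr ((rP U *m X *m (ra U)^T)^T *m rA U) = rF2 U.
  rewrite [(_ *m (ra U)^T)^T]trmx_mul trmxK -mulmxA PXT_rA mxtrace_mulC //.
ring.
Qed.

(** The sum is the derivative of [rF] in the direction of the field [rH] itself. The gradient of
    [rF] is [2 (N1 - N2^T)]; paired with [rH], [N1] gives [T1 - T2] and [N2^T] gives [T2]. *)
Lemma divergence_rF U :
  \sum_(ij : 'I_p * 'I_k) rdF U (delta_mx ij.1 ij.2) * rH U ij.1 ij.2 =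
  2 * (rT1 U - 2 * rT2 U).
Proof.
pose N1 := rG U *m X *m ((ra U)^T *m (1%:M - rQ U)).
pose N2 := ra U *m (ra U)^T *m (rA U)^T.
have E1 ij : rdF U (delta_mx ij.1 ij.2) = 2 * (N1 ij.1 ij.2 - N2 ij.2 ij.1).
  rewrite /rdF /rda; congr (2 * _); move: (ij.1) (ij.2) => i j.
  have -> : (ra U)^T *m ((delta_mx i j)^T *m rG U *m X - (rA U)^T *m delta_mx i j *m ra U -
      rQ U *m ((delta_mx i j)^T *m rG U *m X)) =
    ((ra U)^T *m (1%:M - rQ U)) *m ((delta_mx i j)^T *m (rG U *m X)) -
    ((ra U)^T *m (rA U)^T *m delta_mx i j) *m ra U.
    rewrite !mulmxBr !mulmxBl mulmx1 !mulmxA addrAC //.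
  rewrite linearB/=; congr (_ - _).
    rewrite mxtrace_mulC -mulmxA mxtrace_mulC trmx_delta mxtrace_delta_mx//.
  by rewrite mxtrace_mulC !mulmxA mxtrace_delta_mx.
under eq_bigr do rewrite E1 -mulrA mulrBl [N1 _ _ * _]mulrC [N2 _ _ * _]mulrC.
rewrite -mulr_sumr sumrB.
have -> : \sum_(ij : 'I_p * 'I_k) rH U ij.1 ij.2 * N2 ij.2 ij.1 = rT2 U.
  rewrite -mxtrace_mul_sum /rH /N2.
  transitivity (\tr ((rA U)^T *m (rP U *m X) *m ((ra U)^T *m (ra U *m (ra U)^T)))).
    by rewrite -[in RHS]mulmxA [RHS]mxtrace_mulC !mulmxA.
  by rewrite rATPX mxtrace_mulC /rT2 !mulmxA.
have -> : \sum_(ij : 'I_p * 'I_k) rH U ij.1 ij.2 * N1 ij.1 ij.2 = rT1 U - rT2 U.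
  transitivity (\tr (rH U *m N1^T)).
    by rewrite (mxtrace_mul_sum (rH U)); apply: eq_bigr => ij _; rewrite [N1^T _ _]mxE.
  have -> : N1^T = (1%:M - rQ U) *m ra U *m (X^T *m rG U).
    rewrite /N1 trmx_mul [((ra U)^T *m _)^T]trmx_mul [(rG U *m X)^T]trmx_mul.
    by rewrite trmxK rG_sym linearB/= trmx1 rQ_sym.
  transitivity (\tr (X^T *m rG U *m (rP U *m X) *m ((ra U)^T *m ((1%:M - rQ U) *m ra U)))).
    by rewrite -[in RHS]mulmxA [RHS]mxtrace_mulC !mulmxA.
  by rewrite rGX_P_X mulmxBl mul1mx mulmxBr mulmxBr linearB/= /rT1 /rT2 !mulmxA.
congr (_ * _); ring.
Qed.

End ridge.

Section chain.
Context (R : realType).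

Lemma der0_comp (chi : R -> R) (dchi : R) (g : R -> R) dg :
  is_derive (g 0) 1 chi dchi -> der0 g dg -> der0 (fun t => chi (g t)) (dchi * dg).
Proof.
move=> hc hg.
have hg' : is_derive (0 : R) (1 : R) g dg.
  by apply: der0_is_derive; under eq_fun do rewrite add0r.
have := is_derive_der0 (is_derive1_comp hc hg').
by rewrite /comp; under eq_fun do rewrite add0r.
Qed.

End chain.

Section ridge_calculus.
Context (R : realType) (p k q : nat) (X : 'M[R]_(p, q)) (delta : R).
Hypothesis delta0 : 0 < delta.
Implicit Types U E : 'M[R]_(p, k).

Lemma rbounded_sqr (I : Type) (f g : I -> R) :
  (forall x, f x ^+ 2 <= g x) -> rbounded g -> rbounded f.
Proof.
move=> fg [K gK]; exists (1 + K) => x.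
have h1 := le_trans (fg x) (le_trans (ler_norm _) (gK x)).
have := normr_ge0 (f x); have := sqr_ge0 (`|f x| - 1).
have : `|f x| ^+ 2 = f x ^+ 2 by rewrite -normrX ger0_norm ?sqr_ge0.
by move: (`|f x|) (f x ^+ 2) h1 => a b h1 h2 h3 h4; nra.
Qed.

Lemma bounded_rP : mxbounded (fun U => rP delta U).
Proof. by exists 1 => U i j; exact: rP_entry. Qed.

Lemma bounded_rQ : mxbounded (fun U => rQ delta U).
Proof. by exists 1 => U i j; exact: rQ_entry. Qed.

Lemma bounded_rG : mxbounded (fun U => rG delta U).
Proof.
have -> : (fun U => rG delta U) = fun U => delta^-1 *: (1%:M - rP delta U).
  by apply/funext => U; rewrite -scale_rG scalerA mulVf ?gt_eqF// scale1r.
apply: mxboundedZ; first exact: rbounded_cst.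
by apply: mxboundedB; [exact: mxbounded_cst|exact: bounded_rP].
Qed.

Lemma bounded_rA : mxbounded (fun U => rA delta U).
Proof.
apply/mxboundedP => i j.
apply: (@rbounded_sqr _ _ (fun U => ((rA delta U)^T *m rA delta U) j j)).
  by move=> U; exact: sqr_entry_le_gram.
move: j; suff : mxbounded (fun U => (rA delta U)^T *m rA delta U).
  by move/mxboundedP => H j; exact: H.
have -> : (fun U => (rA delta U)^T *m rA delta U) =
    fun U => delta^-1 *: (rQ delta U - rQ delta U *m rQ delta U).
  by apply/funext => U; rewrite -delta_rAA// scalerA mulVf ?gt_eqF// scale1r.
apply: mxboundedZ; first exact: rbounded_cst.
by apply: mxboundedB; [exact: bounded_rQ|apply: mxboundedM; exact: bounded_rQ].
Qed.

Lemma bounded_ra : mxbounded (fun U => ra X delta U).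
Proof.
apply: mxboundedM; last exact: mxbounded_cst.
by apply: mxboundedT; exact: bounded_rA.
Qed.

Lemma bounded_rH : mxbounded (fun U => rH X delta U).
Proof.
apply: mxboundedM; last by apply: mxboundedT; exact: bounded_ra.
by apply: mxboundedM; [exact: bounded_rP|exact: mxbounded_cst].
Qed.

Lemma bounded_rda E : mxbounded (fun U => rda X delta U E).
Proof.
have bGX : mxbounded (fun U => E^T *m rG delta U *m X).
  apply: mxboundedM; last exact: mxbounded_cst.
  by apply: mxboundedM; [exact: mxbounded_cst|exact: bounded_rG].
apply: mxboundedB; last by apply: mxboundedM => //; exact: bounded_rQ.
apply: mxboundedB => //; apply: mxboundedM; last exact: bounded_ra.
apply: mxboundedM; last exact: mxbounded_cst.
by apply: mxboundedT; exact: bounded_rA.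
Qed.

Lemma bounded_rdH E : mxbounded (fun U => rdH X delta U E).
Proof.
apply: mxboundedD.
  apply: mxboundedM; last by apply: mxboundedT; exact: bounded_ra.
  apply: mxboundedM; last exact: mxbounded_cst.
  apply: mxboundedZ; first exact: rbounded_cst.
  apply: mxboundedD.
    apply: mxboundedM; last by apply: mxboundedT; exact: bounded_rA.
    by apply: mxboundedM; [exact: bounded_rG|exact: mxbounded_cst].
  apply: mxboundedM; last exact: bounded_rG.
  by apply: mxboundedM; [exact: bounded_rA|exact: mxbounded_cst].
apply: mxboundedM; last by apply: mxboundedT; exact: bounded_rda.
by apply: mxboundedM; [exact: bounded_rP|exact: mxbounded_cst].
Qed.

Lemma bounded_rdF E : rbounded (fun U => rdF X delta U E).
Proof.
apply: rboundedM; first exact: rbounded_cst.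
apply: rbounded_mxtrace; apply: mxboundedM; last exact: bounded_rda.
by apply: mxboundedT; exact: bounded_ra.
Qed.

Lemma der_rG U E : mxder0 (fun t => rG delta (U + t *: E))
  (- (rG delta U *m E *m (rA delta U)^T + rA delta U *m E^T *m rG delta U)).
Proof.
have dU := @mxder0_line _ _ _ U E.
have bG : mxbounded (fun t => invmx (ridge delta (U + t *: E))).
  have [K GK] := bounded_rG; exists K => t i j; exact: GK.
have dS : mxder0 (fun t => ridge delta (U + t *: E))
    (E *m (U + 0 *: E)^T + (U + 0 *: E) *m E^T + 0).
  by apply: mxder0D; [apply: mxder0M => //; exact: mxder0T|exact: mxder0_cst].
have := mxder0_inv (fun t => ridge_unit delta0 (U + t *: E)) bG dS.
rewrite scale0r !addr0 -/(rG delta U); congr (mxder0 _ (- _)).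
by rewrite mulmxDr mulmxDl rA_tr !mulmxA.
Qed.

Lemma der_rP U E : mxder0 (fun t => rP delta (U + t *: E)) (rdP delta U E).
Proof.
have := mxder0D (mxder0_cst 1%:M) (mxder0N (mxder0Zl (c := delta) (@der_rG U E))).
by rewrite add0r scalerN opprK.
Qed.

Lemma der_ra U E : mxder0 (fun t => ra X delta (U + t *: E)) (rda X delta U E).
Proof.
have := mxder0M (mxder0T (mxder0M (@der_rG U E) (@mxder0_line _ _ _ U E))) (mxder0_cst X).
rewrite scale0r !addr0 mulmx0 addr0.
congr mxder0.
have AG : (rA delta U)^T = U^T *m rG delta U by rewrite rA_tr.
have Gs := rG_sym delta U.
rewrite /rda /rQ /ra; move: (rG delta U) (rA delta U) Gs AG => G A Gs AG.
rewrite mulNmx [(- _ + _)^T]linearD/= linearN/= [((_ + _) *m _)^T]trmx_mul.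
rewrite [(_ + _)^T]linearD/= !trmx_mul trmxK Gs !mulmxDr !mulmxA.
rewrite AG -!mulmxA.
by rewrite trmxK mulmxDl mulNmx mulmxDl -!mulmxA addrC opprD addrA addrAC.
Qed.

Lemma der_rH U E : mxder0 (fun t => rH X delta (U + t *: E)) (rdH X delta U E).
Proof.
have := mxder0M (mxder0M (@der_rP U E) (mxder0_cst X)) (mxder0T (@der_ra U E)).
by rewrite scale0r !addr0 mulmx0 addr0.
Qed.

Lemma der_rF U E : der0 (fun t => rF X delta (U + t *: E)) (rdF X delta U E).
Proof.
have := der0_mxtrace (mxder0M (mxder0T (@der_ra U E)) (@der_ra U E)).
rewrite scale0r !addr0 /rdF; congr der0.
rewrite linearD/= mulr2n mulrDl !mul1r; congr (_ + _).
by rewrite -mxtrace_tr trmx_mul trmxK.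
Qed.

Lemma rF_ge0 U : 0 <= rF X delta U.
Proof. exact: mxtrace_gram_ge0. Qed.

End ridge_calculus.

(** * Cauchy-Schwarz bounds for Gram matrices *)

Section gram_inequalities.
Context (R : realType).

(** Lagrange's identity: the double sum of [(x_i y_l - x_l y_i)^2] is twice the difference of the
    two sides. *)
Lemma cauchy_schwarz_sum (I : finType) (x y : I -> R) :
  (\sum_i x i * y i) ^+ 2 <= (\sum_i x i ^+ 2) * (\sum_i y i ^+ 2).
Proof.
have h : 0 <= \sum_i \sum_l (x i * y l - x l * y i) ^+ 2.
  by apply: sumr_ge0 => i _; apply: sumr_ge0 => l _; exact: sqr_ge0.
have e : \sum_i \sum_l (x i * y l - x l * y i) ^+ 2 =
    2 * ((\sum_i x i ^+ 2) * (\sum_i y i ^+ 2)) - 2 * (\sum_i x i * y i) ^+ 2.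
  have e1 : \sum_i \sum_l x i ^+ 2 * y l ^+ 2 = (\sum_i x i ^+ 2) * (\sum_i y i ^+ 2).
    by rewrite mulr_suml; apply: eq_bigr => i _; rewrite mulr_sumr.
  have e2 : \sum_i \sum_l (x i * y i) * (x l * y l) = (\sum_i x i * y i) ^+ 2.
    by rewrite expr2 mulr_suml; apply: eq_bigr => i _; rewrite mulr_sumr.
  have e3 : \sum_i \sum_l x l ^+ 2 * y i ^+ 2 = (\sum_i x i ^+ 2) * (\sum_i y i ^+ 2).
    by rewrite exchange_big.
  transitivity (\sum_i \sum_l x i ^+ 2 * y l ^+ 2 + \sum_i \sum_l x l ^+ 2 * y i ^+ 2 -
      2 * \sum_i \sum_l (x i * y i) * (x l * y l)).
    rewrite mulr_sumr -big_split/= -sumrB; apply: eq_bigr => i _.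
    rewrite mulr_sumr -big_split/= -sumrB; apply: eq_bigr => l _; ring.
  rewrite e1 e2 e3; ring.
by move: h; rewrite e; lra.
Qed.

(** Cauchy-Schwarz gives [G_ij^2 <= G_ii G_jj] for a Gram matrix; sum over [i] and [j]. For [ra]
    this is [T1 <= F^2]. *)
Lemma mxtrace_gram_sqr m n (a : 'M[R]_(m, n)) :
  0 <= \tr (a^T *m a *m (a^T *m a)) <= (\tr (a^T *m a)) ^+ 2.
Proof.
set G := a^T *m a.
have Gs : G^T = G by rewrite /G trmx_mul trmxK.
have -> : \tr (G *m G) = \sum_(ij : 'I_n * 'I_n) G ij.1 ij.2 ^+ 2.
  rewrite mxtrace_mul_sum; apply: eq_bigr => -[i j] _ /=.
  by rewrite expr2; congr (_ * _); rewrite -[in LHS]Gs mxE.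
rewrite sumr_ge0 => [|? _]; last exact: sqr_ge0.
rewrite expr2 /mxtrace mulr_suml; under [leRHS]eq_bigr do rewrite mulr_sumr.
rewrite pair_big/=; apply: ler_sum => -[i j] _ /=.
have GE u v : G u v = \sum_l a l u * a l v.
  by rewrite /G mxE; apply: eq_bigr => l _; rewrite mxE.
rewrite !GE; apply: le_trans (cauchy_schwarz_sum _ _) _.
by rewrite le_eqVlt; apply/orP; left; apply/eqP; congr (_ * _); apply: eq_bigr => l _; rewrite expr2.
Qed.

Lemma mulmx_entry_le m n l (M : 'M[R]_(m, n)) (N : 'M[R]_(n, l)) (x y : R) :
  (forall i j, `|M i j| <= x) -> (forall i j, `|N i j| <= y) ->
  forall i j, `|(M *m N) i j| <= n%:R * (x * y).
Proof.
move=> Mx Ny i j; rewrite mxE (le_trans (ler_norm_sum _ _ _))//.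
apply: (@le_trans _ _ (\sum_(a < n) x * y)).
  by apply: ler_sum => a _; rewrite normrM ler_pM.
by rewrite sumr_const card_ord mulr_natl.
Qed.

Lemma mxtrace_le n (M : 'M[R]_n) x : (forall i j, `|M i j| <= x) -> `|\tr M| <= n%:R * x.
Proof.
move=> Mx; rewrite (le_trans (ler_norm_sum _ _ _))//.
apply: (@le_trans _ _ (\sum_(a < n) x)); first exact: ler_sum.
by rewrite sumr_const card_ord mulr_natl.
Qed.

Lemma entry_le_sqrt m n (a : 'M[R]_(m, n)) i j : `|a i j| <= Num.sqrt (\tr (a^T *m a)).
Proof. by rewrite -sqrtr_sqr ler_wsqrtr// sqr_entry_le_mxtrace. Qed.

End gram_inequalities.

(** * Symmetry and trace identities for the Moore-Penrose inverse *)

Section pseudo_inverse.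
Context (R : realType).

Lemma mppinvmx_sym n (S : 'M[R]_n) : S^T = S -> (mppinvmx S)^T = mppinvmx S.
Proof.
move=> Ss; apply: (@penrose_unique _ _ _ S); last exact: mppinvmxP.
have [h1 h2 h3 h4] := mppinvmxP S.
split.
- by apply: trmx_inj; rewrite !trmx_mul trmxK Ss mulmxA.
- by apply: trmx_inj; rewrite !trmx_mul !trmxK Ss mulmxA.
- have e : S *m (mppinvmx S)^T = mppinvmx S *m S by rewrite -h4 trmx_mul Ss.
  by rewrite e h4.
- have e : (mppinvmx S)^T *m S = S *m mppinvmx S by rewrite -h3 trmx_mul Ss.
  by rewrite e h3.
Qed.

(** In a rank factorization [E = c r], the equation [c r c r = c r] forces [r c = 1], of size the
    rank. *)
Lemma mxtrace_idempotent n (E : 'M[R]_n) : E *m E = E -> \tr E = (\rank E)%:R.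
Proof.
move=> EE.
have h : row_base E *m col_base E = 1%:M.
  have /row_freeP[B RB] := row_base_free E.
  have /row_fullP[C CB] := col_base_full E.
  move: (row_base E) (col_base E) (mulmx_base E) RB CB => r c crE RB CB.
  have : C *m (c *m r *m (c *m r)) *m B = C *m (c *m r) *m B by rewrite !crE EE.
  by rewrite !mulmxA CB !mul1mx -!mulmxA RB mulmx1.
by transitivity (\tr (col_base E *m row_base E)); [rewrite mulmx_base|rewrite mxtrace_mulC h mxtrace1].
Qed.

Lemma mxtrace_mul_mppinvmx n (S : 'M[R]_n) : \tr (S *m mppinvmx S) = (\rank S)%:R.
Proof.
have [h1 h2 h3 h4] := mppinvmxP S.
rewrite mxtrace_idempotent; last by rewrite mulmxA h1.
congr (_%:R); apply/eqP; rewrite eqn_leq mxrankM_maxl/=.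
by rewrite -{1}h1 mxrankM_maxl.
Qed.

End pseudo_inverse.

(** * The ridge quantities as [delta] tends to [0] *)

Section ridge_limit.
Context (R : realType) (p k q : nat) (X : 'M[R]_(p, q)) (U : 'M[R]_(p, k)).

Definition gram := U *m U^T.
Definition gpinv := mppinvmx gram.

Let dl n : R := n.+1%:R^-1.
Let dl0 n : 0 < dl n. Proof. by rewrite invr_gt0. Qed.

Lemma gram_sym : gram^T = gram.
Proof. by rewrite /gram trmx_mul trmxK. Qed.

Lemma gpinv_sym : gpinv^T = gpinv.
Proof. by rewrite mppinvmx_sym// gram_sym. Qed.

Lemma gram_gpinv_sym : (gram *m gpinv)^T = gram *m gpinv.
Proof. by have [_ _ + _] := mppinvmxP gram. Qed.

Lemma gpinv_comm : gpinv *m gram = gram *m gpinv.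
Proof. by rewrite -[RHS]gram_gpinv_sym trmx_mul gpinv_sym gram_sym. Qed.

(** Expanding shows that [(S S^+ U - U) (S S^+ U - U)^T = 0], and a matrix with zero Gram matrix is
    zero. *)
Lemma gram_gpinv_U : gram *m gpinv *m U = U.
Proof.
have [h1 h2 h3 h4] := mppinvmxP gram.
apply/eqP; rewrite -subr_eq0; apply/eqP; apply: trmx_inj; rewrite trmx0.
apply: mxtrace_gram_eq0; rewrite trmxK [(_ - _)^T]linearB/= trmx_mul gram_gpinv_sym.
have SP : gram *m (gram *m gpinv) = gram by rewrite -gpinv_comm mulmxA h1.
set M0 := gram *m gpinv in SP h1 *.
have -> : (M0 *m U - U) *m (U^T *m M0 - U^T) =
    M0 *m (U *m U^T) *m M0 - M0 *m (U *m U^T) - (U *m U^T *m M0 - U *m U^T).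
  by rewrite mulmxBl !mulmxBr !mulmxA.
by rewrite -/gram h1 SP !subrr mxtrace0.
Qed.

(** As [S^+] commutes with [S], one has [G S S^+ = S^+ - delta (G S S^+) S^+]. Here [G S = P] has
    entries bounded by [1] whatever [delta], so [G S S^+] tends to [S^+] without any
    diagonalization; then [U = S S^+ U] is used. *)
Lemma cvg_rA : mxcvg \oo (fun n => rA (dl n) U) (gpinv *m U).
Proof.
have [h1 h2 h3 h4] := mppinvmxP gram; rewrite -/gpinv in h1 h2 h3 h4.
set S := gram in h1 h2 h3 h4 *; set M := gpinv in h1 h2 h3 h4 *.
have GPE n : rG (dl n) U *m (S *m M) = M - dl n *: ((M - (1%:M - rP (dl n) U) *m M) *m M).
  have e1 : rG (dl n) U *m (S *m M) = M - (1%:M - rP (dl n) U) *m M.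
    by rewrite mulmxA mul_rG_gram// [in RHS]mulmxBl mul1mx subKr.
  rewrite e1; congr (_ - _).
  rewrite -e1 -scale_rG -scalemxAl; congr (_ *: _).
  by rewrite -[in RHS]mulmxA -gpinv_comm h2.
have c0 : mxcvg \oo (fun n => dl n *: ((M - (1%:M - rP (dl n) U) *m M) *m M)) 0.
  have [K HK] : mxbounded (fun n => (M - (1%:M - rP (dl n) U) *m M) *m M).
    apply: mxboundedM; last exact: mxbounded_cst.
    apply: mxboundedB; first exact: mxbounded_cst.
    apply: mxboundedM; last exact: mxbounded_cst.
    apply: mxboundedB; first exact: mxbounded_cst.
    by exists 1 => n i j; exact: rP_entry.
  move=> i j; rewrite mxE; under eq_fun do rewrite mxE mulrC.
  apply: (cvg_bounded_mul0 (K := K)); last exact: cvg_harmonic.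
  by move=> n; exact: HK.
have cGP : mxcvg \oo (fun n => rG (dl n) U *m (S *m M)) M.
  apply: mxcvg_eq (mxcvgB (@mxcvg_cst _ _ _ _ _ _ M) c0) _ (subr0 _).
  by move=> n; rewrite GPE.
apply: mxcvg_eq (mxcvgM cGP (@mxcvg_cst _ _ _ _ _ _ U)) _ erefl => n.
by rewrite -mulmxA gram_gpinv_U.
Qed.

Lemma cvg_rP : mxcvg \oo (fun n => rP (dl n) U) (gram *m gpinv).
Proof.
apply: mxcvg_eq (mxcvgM cvg_rA (@mxcvg_cst _ _ _ _ _ _ U^T)) _ _.
  by move=> n; rewrite mul_rA_UT.
by rewrite -mulmxA gpinv_comm.
Qed.

Lemma cvg_rQ : mxcvg \oo (fun n => rQ (dl n) U) (U^T *m (gpinv *m U)).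
Proof. exact: (mxcvgM (@mxcvg_cst _ _ _ _ _ _ U^T) cvg_rA). Qed.

(** The limit of [ra]; the entries of [X^T S^+ X] are the inner products of its columns. *)
Definition sa := U^T *m gpinv *m X.

Lemma cvg_ra : mxcvg \oo (fun n => ra X (dl n) U) sa.
Proof.
apply: mxcvg_eq (mxcvgM (mxcvgT cvg_rA) (@mxcvg_cst _ _ _ _ _ _ X)) _ _ => //.
by rewrite trmx_mul gpinv_sym.
Qed.

Lemma sa_gram : sa^T *m sa = X^T *m gpinv *m X.
Proof.
have [_ + _ _] := mppinvmxP gram; rewrite -/gpinv => h2.
rewrite /sa !trmx_mul gpinv_sym trmxK !mulmxA.
rewrite -(mulmxA _ U U^T) -/gram.
have -> : X^T *m gpinv *m gram *m gpinv = X^T *m (gpinv *m gram *m gpinv) by rewrite !mulmxA.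
by rewrite h2.
Qed.

(** An instance of [S^+ S S^+ = S^+]. Because of it [rF2] has the same limit as [rF], and [rT2] the
    same as [rT1]. *)
Lemma sQ_sa : U^T *m (gpinv *m U) *m sa = sa.
Proof.
have [_ + _ _] := mppinvmxP gram; rewrite -/gpinv => h2.
rewrite /sa !mulmxA -(mulmxA _ U U^T) -/gram.
have -> : U^T *m gpinv *m gram *m gpinv = U^T *m (gpinv *m gram *m gpinv) by rewrite !mulmxA.
by rewrite h2.
Qed.

Lemma cvg_rF : rF X (dl n) U @[n --> \oo] --> Fstat X gram.
Proof.
have -> : Fstat X gram = \tr (sa^T *m sa) by rewrite sa_gram.
by apply: cvg_mxtrace; apply: mxcvgM cvg_ra; exact: mxcvgT cvg_ra.
Qed.

Lemma cvg_rF2 : rF2 X (dl n) U @[n --> \oo] --> Fstat X gram.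
Proof.
have -> : Fstat X gram = \tr (sa^T *m (U^T *m (gpinv *m U)) *m sa).
  by rewrite -mulmxA sQ_sa sa_gram.
apply: cvg_mxtrace; apply: mxcvgM cvg_ra.
by apply: mxcvgM cvg_rQ; exact: mxcvgT cvg_ra.
Qed.

Lemma cvg_rT12 : (rT1 X (dl n) U - rT2 X (dl n) U) @[n --> \oo] --> (0 : R).
Proof.
have c1 : rT1 X (dl n) U @[n --> \oo] --> \tr (sa^T *m sa *m (sa^T *m sa)).
  by apply: cvg_mxtrace; apply: mxcvgM; apply: mxcvgM cvg_ra; exact: mxcvgT cvg_ra.
have c2 : rT2 X (dl n) U @[n --> \oo] -->
    \tr (sa^T *m sa *m (sa^T *m (U^T *m (gpinv *m U)) *m sa)).
  apply: cvg_mxtrace; apply: mxcvgM; first by apply: mxcvgM cvg_ra; exact: mxcvgT cvg_ra.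
  by apply: mxcvgM cvg_ra; apply: mxcvgM cvg_rQ; exact: mxcvgT cvg_ra.
rewrite -[sa^T *m (U^T *m _) *m sa]mulmxA sQ_sa in c2.
rewrite -(subrr (\tr (sa^T *m sa *m (sa^T *m sa)))); exact: cvgB.
Qed.

Lemma cvg_mxtrace_rQ : \tr (rQ (dl n) U) @[n --> \oo] --> ((\rank gram)%:R : R).
Proof.
rewrite -mxtrace_mul_mppinvmx -/gpinv -gpinv_comm.
have -> : \tr (gpinv *m gram) = \tr (U^T *m (gpinv *m U)).
  by rewrite [RHS]mxtrace_mulC -mulmxA.
exact: cvg_mxtrace cvg_rQ.
Qed.

Lemma Fstat_ge0 : 0 <= Fstat X gram.
Proof.
have -> : Fstat X gram = \tr (sa^T *m sa) by rewrite sa_gram.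
exact: mxtrace_gram_ge0.
Qed.

End ridge_limit.

(** * Shrinkage functions *)

Section shrinkage_function.
Context (R : realType).

(* The regularized shrinkage factor [r (y + eps) / (y + eps)] satisfies these
   bounds, with [rho] bounding [r]. *)
Record shrinkage (eps rho C : R) (chi dchi : R -> R) : Prop := Shrinkage {
  shrink_eps : 0 < eps;
  shrink_ge0 : forall y, 0 <= y -> 0 <= chi y;
  shrink_le : forall y, 0 <= y -> chi y * (y + eps) <= rho;
  shrink_dle : forall y, 0 <= y -> `|dchi y| * (y + eps) <= C;
  shrink_dge : forall y, 0 <= y -> - chi y <= (y + eps) * dchi y;
  shrink_der : forall y : R, 0 <= y -> is_derive y 1 chi (dchi y) }.

Context (eps rho C : R) (chi dchi : R -> R).
Hypothesis sh : shrinkage eps rho C chi dchi.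

Lemma shrinkage_measurable d (T : measurableType d) (F : T -> R) :
  measurable_fun setT F -> (forall w, 0 <= F w) ->
  measurable_fun setT (fun w => chi (F w)).
Proof.
move=> mF F0; apply: (@measurable_comp _ _ _ T (measurableTypeR R) (measurableTypeR R)
  `[0, +oo[%classic chi setT F) => //.
  by move=> _ [w _ <-]; rewrite /= in_itv/= F0.
apply: subspace_continuous_measurable_fun => //.
apply: continuous_in_subspaceT => y; rewrite inE/= in_itv/= andbT => y0.
apply/differentiable_continuous/derivable1_diffP.
by have [] := shrink_der sh y0.
Qed.

Lemma shrinkage_cvg (u : nat -> R) (l : R) : (forall n, 0 <= u n) -> 0 <= l ->
  u n @[n --> \oo] --> l -> chi (u n) @[n --> \oo] --> chi l.
Proof.
move=> u0 l0 ul; apply: continuous_cvg => //.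
apply/differentiable_continuous/derivable1_diffP.
by have [] := shrink_der sh l0.
Qed.

Lemma shrink_ub y : 0 <= y -> chi y <= rho / eps.
Proof.
move=> y0; rewrite ler_pdivlMr ?(shrink_eps sh)//.
apply: le_trans (shrink_le sh y0); rewrite ler_wpM2l ?(shrink_ge0 sh)//.
by rewrite lerDr.
Qed.

Lemma shrink_dub y : 0 <= y -> `|dchi y| <= C / eps.
Proof.
move=> y0; rewrite ler_pdivlMr ?(shrink_eps sh)//.
apply: le_trans (shrink_dle sh y0); rewrite ler_wpM2l//.
by rewrite lerDr.
Qed.

Lemma shrink_mul_le y : 0 <= y -> chi y * y <= rho.
Proof.
move=> y0; apply: le_trans (shrink_le sh y0).
by rewrite ler_wpM2l ?(shrink_ge0 sh)// lerDl ltW// (shrink_eps sh).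
Qed.

End shrinkage_function.

Section ridge_measurable.
Context d (T : measurableType d) (R : realType) (p k q : nat).
Context (X : 'M[R]_(p, q)) (delta : R) (delta0 : 0 < delta).
Context (U : T -> 'M[R]_(p, k)).
Hypothesis mU : mxmeas U.

Lemma measurable_rG : mxmeas (fun w => rG delta (U w)).
Proof.
apply: mxmeas_inv => [w|]; first exact: ridge_unit.
apply: mxmeasD; last exact: mxmeas_cst.
by apply: mxmeasM => //; exact: mxmeasT.
Qed.

Lemma measurable_rA : mxmeas (fun w => rA delta (U w)).
Proof. by apply: mxmeasM => //; exact: measurable_rG. Qed.

Lemma measurable_rP : mxmeas (fun w => rP delta (U w)).
Proof.
apply: mxmeasB; first exact: mxmeas_cst.
by apply: mxmeasZ; [exact: measurable_cst|exact: measurable_rG].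
Qed.

Lemma measurable_rQ : mxmeas (fun w => rQ delta (U w)).
Proof. by apply: mxmeasM; [exact: mxmeasT|exact: measurable_rA]. Qed.

Lemma measurable_ra : mxmeas (fun w => ra X delta (U w)).
Proof. by apply: mxmeasM; [apply: mxmeasT; exact: measurable_rA|exact: mxmeas_cst]. Qed.

Lemma measurable_raT : mxmeas (fun w => (ra X delta (U w))^T).
Proof. by apply: mxmeasT; exact: measurable_ra. Qed.

Lemma measurable_raa : mxmeas (fun w => (ra X delta (U w))^T *m ra X delta (U w)).
Proof. by apply: mxmeasM; [exact: measurable_raT|exact: measurable_ra]. Qed.

Lemma measurable_raQa :
  mxmeas (fun w => (ra X delta (U w))^T *m rQ delta (U w) *m ra X delta (U w)).
Proof.
apply: mxmeasM; last exact: measurable_ra.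
by apply: mxmeasM; [exact: measurable_raT|exact: measurable_rQ].
Qed.

Lemma measurable_rF : measurable_fun setT (fun w => rF X delta (U w)).
Proof. exact: measurable_mxtrace measurable_raa. Qed.

Lemma measurable_rF2 : measurable_fun setT (fun w => rF2 X delta (U w)).
Proof. exact: measurable_mxtrace measurable_raQa. Qed.

Lemma measurable_rT1 : measurable_fun setT (fun w => rT1 X delta (U w)).
Proof. by apply: measurable_mxtrace; apply: mxmeasM; exact: measurable_raa. Qed.

Lemma measurable_rT2 : measurable_fun setT (fun w => rT2 X delta (U w)).
Proof.
by apply: measurable_mxtrace; apply: mxmeasM; [exact: measurable_raa|exact: measurable_raQa].
Qed.

Lemma measurable_rH : mxmeas (fun w => rH X delta (U w)).
Proof.
apply: mxmeasM; last exact: measurable_raT.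
by apply: mxmeasM; [exact: measurable_rP|exact: mxmeas_cst].
Qed.

End ridge_measurable.

(** * Stein identities for the two samples *)

Section stein_divergence.
Context d (T : measurableType d) (R : realType) (P : probability T R).
Context (p k : nat) (U : T -> 'M[R]_(p, k)).
Context (theta : 'M[R]_(p, k)) (L : 'M[R]_p).
Hypothesis mU : mxmeas U.
Hypothesis gsU : gaussian_shift P U theta L.

Lemma score_delta i j w : score U theta L (delta_mx i j) w = (L *m (U w - theta)) i j.
Proof.
by rewrite /score trmx_delta -mulmxA mxtrace_mulC mxtrace_delta_mx.
Qed.

(** Stein's identity along each elementary matrix, summed: the score in the direction [(i, j)] is
    the entry [(i, j)] of [L (U - theta)]. *)
Lemma stein_divergence (H : 'M[R]_(p, k) -> 'M[R]_(p, k))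
    (D : 'I_p * 'I_k -> 'M[R]_(p, k) -> R) :
  mxmeas (H : borelmx R p k -> 'M[R]_(p, k)) -> mxbounded H ->
  (forall ij, rbounded (D ij)) ->
  (forall ij M, der0 (fun t => H (M + t *: delta_mx ij.1 ij.2) ij.1 ij.2) (D ij M)) ->
  [/\ P.-integrable setT (fun w => (\tr ((H (U w))^T *m (L *m (U w - theta))))%:E),
    P.-integrable setT (fun w => (\sum_ij D ij (U w))%:E) &
    (\int[P]_w (\tr ((H (U w))^T *m (L *m (U w - theta))))%:E =
     \int[P]_w (\sum_ij D ij (U w))%:E)%E].
Proof.
move=> mH bH bD HD.
have st ij : [/\ P.-integrable setT
      (fun w => (score U theta L (delta_mx ij.1 ij.2) w * H (U w) ij.1 ij.2)%:E),
    P.-integrable setT (fun w => (D ij (U w))%:E) &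
    (\int[P]_w (score U theta L (delta_mx ij.1 ij.2) w * H (U w) ij.1 ij.2)%:E =
     \int[P]_w (D ij (U w))%:E)%E].
  have [K1 HK1] := bH; have [K2 DK2] := bD ij.
  apply: (@stein _ _ _ _ _ _ _ _ _ mU gsU (delta_mx ij.1 ij.2)
    (fun M => H M ij.1 ij.2) (D ij) (Num.max K1 K2)).
  - exact: mH.
  - by move=> x; rewrite le_max HK1.
  - by move=> x; rewrite le_max DK2 orbT.
  - exact: HD.
have trE w : (\tr ((H (U w))^T *m (L *m (U w - theta))))%:E =
    (\sum_ij (score U theta L (delta_mx ij.1 ij.2) w * H (U w) ij.1 ij.2)%:E)%E.
  rewrite sumEFin; congr EFin; rewrite mxtrace_mulC mxtrace_mul_sum.
  by apply: eq_bigr => ij _; rewrite score_delta [(H _)^T _ _]mxE.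
have DE w : (\sum_ij D ij (U w))%:E = (\sum_ij (D ij (U w))%:E)%E by rewrite sumEFin.
split.
- under eq_fun do rewrite trE.
  by apply: integrable_sum => // ij _; case: (st ij).
- under eq_fun do rewrite DE.
  by apply: integrable_sum => // ij _; case: (st ij).
- under eq_integral do rewrite trE.
  under [RHS]eq_integral do rewrite DE.
  rewrite !integral_sum//; last 2 first.
  + by move=> ij; case: (st ij).
  + by move=> ij; case: (st ij).
  by apply: eq_bigr => ij _; case: (st ij).
Qed.

End stein_divergence.

Lemma der0M (R : realType) (f g : R -> R) df dg : der0 f df -> der0 g dg ->
  der0 (fun t => f t * g t) (df * g 0 + f 0 * dg).
Proof.
move=> hf hg.
have H : (f h - f 0) / h * g h + f 0 * ((g h - g 0) / h) @[h --> (0 : R)^'] -->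
    df * g 0 + f 0 * dg.
  by apply: cvgD; apply: cvgM => //; [exact: der0_cvg hg|exact: cvg_cst].
apply: cvg_trans H; apply: near_eq_cvg; near=> h => /=; ring.
Unshelve. all: by end_near. Qed.

(** * The inequality for [U], with [X] fixed *)

Section wishart.
Context d (T : measurableType d) (R : realType) (P : probability T R).
Context (p k q : nat) (X : 'M[R]_(p, q)) (U : T -> 'M[R]_(p, k)) (L : 'M[R]_p).
Hypothesis mU : mxmeas U.
Hypothesis gsU : gaussian_shift P U 0 L.
Context (eps rho C : R) (chi dchi : R -> R).
Hypothesis sh : shrinkage eps rho C chi dchi.

(** The field is [chi(F)^2 rH]. On the left, [U (rA U)^T = rP U] turns the pairing of [rH] with
    [L U] into a quadratic form in [rP U X]. On the right stand the divergence of [rH] and the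
    derivative of [F] along [rH], the latter weighted by [2 chi chi']. *)
Lemma stein_ridge (delta : R) (delta0 : 0 < delta) :
  let F w := rF X delta (U w) in
  let lhs w := chi (F w) ^+ 2 * \tr ((rP delta (U w) *m X)^T *m (L *m (rP delta (U w) *m X))) in
  let rhs w := chi (F w) ^+ 2 * ((p%:R + k%:R - 2 * \tr (rQ delta (U w)) + 1) * F w -
    2 * rF2 X delta (U w))
    + 2 * chi (F w) * dchi (F w) * (2 * (rT1 X delta (U w) - 2 * rT2 X delta (U w))) in
  [/\ P.-integrable setT (EFin \o lhs), P.-integrable setT (EFin \o rhs) &
    (\int[P]_w (lhs w)%:E = \int[P]_w (rhs w)%:E)%E].
Proof.
move=> F lhs rhs.
have Fr (M : 'M[R]_(p, k)) : 0 <= rF X delta M by exact: rF_ge0.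
pose H (M : 'M[R]_(p, k)) := chi (rF X delta M) ^+ 2 *: rH X delta M.
pose D (ij : 'I_p * 'I_k) M := chi (rF X delta M) ^+ 2 * rdH X delta M (delta_mx ij.1 ij.2) ij.1 ij.2 +
  2 * chi (rF X delta M) * dchi (rF X delta M) *
  (rdF X delta M (delta_mx ij.1 ij.2) * rH X delta M ij.1 ij.2).
have mid : mxmeas (fun M : borelmx R p k => M : 'M[R]_(p, k)) by exact/mxmeasP.
have bchi : rbounded (fun M : 'M[R]_(p, k) => chi (rF X delta M)).
  exists (rho / eps) => M; rewrite ger0_norm; last exact: (shrink_ge0 sh (Fr M)).
  exact: (shrink_ub sh (Fr M)).
have bdchi : rbounded (fun M : 'M[R]_(p, k) => dchi (rF X delta M)).
  by exists (C / eps) => M; exact: (shrink_dub sh (Fr M)).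
have [|||| i1 i2 e] := @stein_divergence _ _ _ _ _ _ _ _ _ mU gsU H D.
- apply: mxmeasZ; last exact: measurable_rH.
  apply: measurable_funX; apply: (shrinkage_measurable sh) => //.
  exact: measurable_rF.
- apply: mxboundedZ; last exact: bounded_rH.
  by under eq_fun do rewrite expr2; exact: rboundedM.
- move=> ij; apply: rboundedD.
    apply: rboundedM; first by under eq_fun do rewrite expr2; exact: rboundedM.
    by have /mxboundedP := @bounded_rdH _ _ _ _ X _ delta0 (delta_mx ij.1 ij.2); exact.
  apply: rboundedM.
    by apply: rboundedM => //; apply: rboundedM => //; exact: rbounded_cst.
  apply: rboundedM; first exact: bounded_rdF.
  by have /mxboundedP := @bounded_rH _ _ k _ X _ delta0; exact.
- move=> ij M; set E := delta_mx _ _.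
  have dF := @der_rF _ _ _ _ X _ delta0 M E.
  have dchi0 : is_derive (rF X delta (M + 0 *: E)) (1 : R) chi (dchi (rF X delta M)).
    by rewrite scale0r addr0; exact: (shrink_der sh (Fr M)).
  have dc := der0_comp dchi0 dF.
  have dH := mxder0_entry (i := ij.1) (j := ij.2) (@der_rH _ _ _ _ X _ delta0 M E).
  have := der0M (der0M dc dc) dH.
  rewrite scale0r addr0 /D -/E -expr2; congr der0.
    by apply/funext => t; rewrite /H [RHS]mxE expr2.
  rewrite /= ; ring.
have lhsE w : \tr ((H (U w))^T *m (L *m (U w - 0))) = lhs w.
  rewrite subr0 /H /lhs linearZ/= -scalemxAl mxtraceZ; congr (_ * _).
  rewrite /rH [(_ *m (ra _ _ _)^T)^T]trmx_mul trmxK -mulmxA mxtrace_mulC.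
  congr (\tr _); rewrite -!mulmxA; congr (_ *m (_ *m _)).
  by rewrite /ra mulmxA mul_U_rAT.
have rhsE w : \sum_ij D ij (U w) = rhs w.
  by rewrite big_split/= -!mulr_sumr divergence_rH// divergence_rF.
split.
- by apply: eq_integrable i1 => // w _; rewrite /= lhsE.
- by apply: eq_integrable i2 => // w _; rewrite /= rhsE.
- rewrite -(eq_integral _ _ (fun w _ => congr1 EFin (lhsE w))) e.
  by apply: eq_integral => w _; rewrite rhsE.
Qed.

Let dl n : R := n.+1%:R^-1.
Let dl0 n : 0 < dl n. Proof. by rewrite invr_gt0. Qed.

Let F n w := rF X (dl n) (U w).
Let F0 n w : 0 <= F n w. Proof. exact: rF_ge0. Qed.
Let Fe0 n w : 0 < F n w + eps.
Proof. by rewrite ltr_wpDl// (shrink_eps sh). Qed.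

(** Crude entrywise constants; what matters is that they depend neither on [n] nor on [w]. *)
Let c1 : R := q%:R * (k%:R * (k%:R * 1)).
Let c2 : R := q%:R * (q%:R * (k%:R * 1 * (k%:R * (k%:R * 1)))).

Let raE n w i j : `|ra X (dl n) (U w) i j| <= Num.sqrt (F n w).
Proof. exact: entry_le_sqrt. Qed.

Let raTE n w i j : `|(ra X (dl n) (U w))^T i j| <= Num.sqrt (F n w).
Proof. by rewrite mxE; exact: entry_le_sqrt. Qed.

Let sqF n w : Num.sqrt (F n w) * Num.sqrt (F n w) = F n w.
Proof. by rewrite -expr2 sqr_sqrtr. Qed.

Let raQaE n w i j :
  `|((ra X (dl n) (U w))^T *m rQ (dl n) (U w) *m ra X (dl n) (U w)) i j| <=
  k%:R * (k%:R * 1) * F n w.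
Proof.
have h1 := mulmx_entry_le (@raTE n w) (rQ_entry (dl0 n) (U w)).
apply: le_trans (mulmx_entry_le h1 (@raE n w) i j) _.
have := sqF n w; set s := Num.sqrt _ => <-.
by rewrite le_eqVlt; apply/orP; left; apply/eqP; ring.
Qed.

Lemma rF2_le n w : `|rF2 X (dl n) (U w)| <= c1 * F n w.
Proof.
apply: le_trans (mxtrace_le (@raQaE n w)) _.
by rewrite /c1 le_eqVlt; apply/orP; left; apply/eqP; ring.
Qed.

Lemma rT2_le n w : `|rT2 X (dl n) (U w)| <= c2 * F n w ^+ 2.
Proof.
have h1 i j : `|((ra X (dl n) (U w))^T *m ra X (dl n) (U w)) i j| <= k%:R * 1 * F n w.
  apply: le_trans (mulmx_entry_le (@raTE n w) (@raE n w) i j) _.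
  by rewrite sqF mulr1.
apply: le_trans (mxtrace_le (mulmx_entry_le h1 (@raQaE n w))) _.
by rewrite /c2 le_eqVlt; apply/orP; left; apply/eqP; ring.
Qed.

Let T12 n w := rT1 X (dl n) (U w) - rT2 X (dl n) (U w).

Lemma rT12_le n w : `|T12 n w| <= (1 + c2) * F n w ^+ 2.
Proof.
apply: le_trans (ler_normB _ _) _; rewrite mulrDl mul1r lerD ?rT2_le//.
have /andP[h1 h2] := mxtrace_gram_sqr (ra X (dl n) (U w)).
by rewrite ger0_norm.
Qed.

(** The last term of [rhs] is [4 chi chi' (T1 - 2 T2) = - 4 chi chi' T1 + 8 chi chi' (T1 - T2)]. The
    first part is at most [4 chi^2 F], which turns the [1] of the divergence into [5]; the second is
    kept as an error that vanishes with [delta]. *)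
Let ub n w := chi (F n w) ^+ 2 *
    ((p%:R + k%:R - 2 * \tr (rQ (dl n) (U w)) + 5) * F n w - 2 * rF2 X (dl n) (U w)) +
  8 * (rho * C) * (`|T12 n w| / (F n w + eps) ^+ 2).

Let lhs n w := chi (F n w) ^+ 2 *
  \tr ((rP (dl n) (U w) *m X)^T *m (L *m (rP (dl n) (U w) *m X))).

Let rhs n w := chi (F n w) ^+ 2 *
    ((p%:R + k%:R - 2 * \tr (rQ (dl n) (U w)) + 1) * F n w - 2 * rF2 X (dl n) (U w)) +
  2 * chi (F n w) * dchi (F n w) * (2 * (rT1 X (dl n) (U w) - 2 * rT2 X (dl n) (U w))).

Lemma rhs_le_ub n w : rhs n w <= ub n w.
Proof.
have /andP[T1ge T1le] := mxtrace_gram_sqr (ra X (dl n) (U w)).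
rewrite -/(rT1 _ _ _) -/(rF _ _ _) -/(F n w) in T1ge T1le.
have f0 := F0 n w; have fe := Fe0 n w.
have x0 := shrink_ge0 sh f0; have xl := shrink_le sh f0.
have dl' := shrink_dle sh f0; have dg := shrink_dge sh f0.
have e0 := shrink_eps sh.
rewrite /rhs /ub /T12.
move: (rT1 X (dl n) (U w)) (rT2 X (dl n) (U w)) T1ge T1le => t1 t2 t10 t1l.
set f := F n w in f0 fe x0 xl dl' dg t1l *.
set x := chi f in x0 xl dg *; set x' := dchi f in dl' dg *.
(* From [- chi' (F + eps) <= chi] and [T1 <= F^2 <= F (F + eps)]. *)
have A : - x' * t1 <= x * f.
  rewrite -(ler_pM2r fe).
  have h1 : - x' * (f + eps) * t1 <= x * t1 by rewrite ler_wpM2r//; lra.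
  have h2 : x * t1 <= x * f ^+ 2 by rewrite ler_wpM2l.
  have h3 : x * f ^+ 2 <= x * f * (f + eps).
    by rewrite mulrDr -mulrA -expr2 lerDl mulr_ge0 ?mulr_ge0// ltW.
  by apply: le_trans h3; apply: le_trans h2; rewrite mulrAC.
have B : x * x' * (t1 - t2) <= rho * C * (`|t1 - t2| / (f + eps) ^+ 2).
  apply: le_trans (ler_norm _) _; rewrite normrM.
  have -> : rho * C * (`|t1 - t2| / (f + eps) ^+ 2) = rho * C / (f + eps) ^+ 2 * `|t1 - t2|.
    by ring.
  rewrite ler_wpM2r// ler_pdivlMr ?exprn_gt0// normrM (ger0_norm x0).
  have -> : x * `|x'| * (f + eps) ^+ 2 = (x * (f + eps)) * (`|x'| * (f + eps)) by ring.
  by apply: ler_pM => //; rewrite mulr_ge0// ltW.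
have A' := ler_wpM2l x0 A.
by nra.
Qed.

(** Since [U] is unbounded, [F] may be large, but it always occurs compensated: [chi^2 F] is at most
    [rho^2 / eps], and [T1 - T2] is of order [F^2], divided by [(F + eps)^2]. *)
Lemma bounded_ub_lhs : exists K, forall n w, `|ub n w - lhs n w| <= K.
Proof.
pose Fn (x : nat * T) := F x.1 x.2.
have bchi : rbounded (fun x => chi (Fn x)).
  exists (rho / eps) => x; rewrite ger0_norm; last exact: (shrink_ge0 sh (F0 _ _)).
  exact: (shrink_ub sh (F0 _ _)).
have bchi2F : rbounded (fun x => chi (Fn x) ^+ 2 * Fn x).
  exists (rho / eps * rho) => x.
  rewrite ger0_norm; last exact: (mulr_ge0 (sqr_ge0 _) (F0 _ _)).
  rewrite expr2 -mulrA; apply: ler_pM.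
  - exact: (shrink_ge0 sh (F0 _ _)).
  - exact: (mulr_ge0 (shrink_ge0 sh (F0 _ _)) (F0 _ _)).
  - exact: (shrink_ub sh (F0 _ _)).
  - exact: (shrink_mul_le sh (F0 _ _)).
have btr : rbounded (fun x : nat * T => \tr (rQ (dl x.1) (U x.2))).
  by apply: rbounded_mxtrace; exists 1 => x i j; exact: rQ_entry.
have bF2 : rbounded (fun x : nat * T => chi (Fn x) ^+ 2 * rF2 X (dl x.1) (U x.2)).
  have [K HK] := bchi2F; exists (c1 * K) => x; rewrite normrM.
  rewrite (ger0_norm (sqr_ge0 _)).
  apply: (@le_trans _ _ (c1 * (chi (Fn x) ^+ 2 * Fn x))).
    by rewrite mulrCA ler_wpM2l ?sqr_ge0// rF2_le.
  rewrite ler_wpM2l//; first by rewrite /c1 !mulr_ge0.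
  exact: le_trans (ler_norm _) (HK x).
have bT : rbounded (fun x : nat * T => `|T12 x.1 x.2| / (Fn x + eps) ^+ 2).
  exists (1 + c2) => x; rewrite ger0_norm; last by rewrite divr_ge0// sqr_ge0.
  rewrite ler_pdivrMr ?exprn_gt0 ?Fe0//; apply: le_trans (rT12_le _ _) _.
  rewrite ler_wpM2l//; first by rewrite addr_ge0// /c2 !mulr_ge0.
  rewrite ler_pXn2r// ?nnegrE ?F0 ?(ltW (Fe0 _ _))//.
  by rewrite lerDl ltW// (shrink_eps sh).
have bP : mxbounded (fun x : nat * T => rP (dl x.1) (U x.2) *m X).
  apply: mxboundedM; last exact: mxbounded_cst.
  by exists 1 => x i j; exact: rP_entry.
suff [K HK] : rbounded (fun x => ub x.1 x.2 - lhs x.1 x.2).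
  by exists K => n w; exact: (HK (n, w)).
have bchi2 : rbounded (fun x => chi (Fn x) ^+ 2).
  by under eq_fun do rewrite expr2; exact: rboundedM.
apply: rboundedD; last first.
  apply: rboundedN; apply: rboundedM => //; apply: rbounded_mxtrace.
  apply: mxboundedM; first exact: mxboundedT.
  by apply: mxboundedM => //; exact: mxbounded_cst.
apply: rboundedD; last by apply: rboundedM => //; exact: rbounded_cst.
have -> : (fun x : nat * T => chi (F x.1 x.2) ^+ 2 *
    ((p%:R + k%:R - 2 * \tr (rQ (dl x.1) (U x.2)) + 5) * F x.1 x.2 - 2 * rF2 X (dl x.1) (U x.2))) =
  (fun x => (p%:R + k%:R + - (2 * \tr (rQ (dl x.1) (U x.2))) + 5) * (chi (Fn x) ^+ 2 * Fn x) +
     - (2 * (chi (Fn x) ^+ 2 * rF2 X (dl x.1) (U x.2)))).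
  by apply/funext => x; rewrite /Fn; ring.
apply: rboundedD; last first.
  by apply: rboundedN; apply: rboundedM => //; exact: rbounded_cst.
apply: rboundedM => //; apply: rboundedD; last exact: rbounded_cst.
apply: rboundedD; first exact: rbounded_cst.
by apply: rboundedN; apply: rboundedM => //; exact: rbounded_cst.
Qed.

(** The limit of [ub n w - lhs n w]. The matrix [L] is the precision of the columns of [U], hence
    carries the factor [q] in the application. *)
Definition wishart_gap w :=
  let S := gram (U w) in let PX := S *m mppinvmx S *m X in
  chi (Fstat X S) ^+ 2 *
  ((p%:R + k%:R - 2 * (\rank S)%:R + 3) * Fstat X S - \tr (PX^T *m (L *m PX))).

(** For each [n], the integral of [ub n - lhs n] is at least that of [rhs n - lhs n], which is [0]
    by Stein's identity; bounded convergence passes to the limit. *)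
Lemma wishart_inequality :
  P.-integrable setT (EFin \o wishart_gap) /\ (0 <= \int[P]_w (wishart_gap w)%:E)%E.
Proof.
have [K HK] := bounded_ub_lhs.
have mF n : measurable_fun setT (F n) by exact: measurable_rF.
have mchi n : measurable_fun setT (fun w => chi (F n w)).
  exact: (shrinkage_measurable sh).
have mtrQ n : measurable_fun setT (fun w => \tr (rQ (dl n) (U w))).
  by apply: measurable_mxtrace; exact: measurable_rQ.
have mT n : measurable_fun setT (T12 n).
  by apply: measurable_funB; [exact: measurable_rT1|exact: measurable_rT2].
have mPX n : mxmeas (fun w => rP (dl n) (U w) *m X).
  by apply: mxmeasM; [exact: measurable_rP|exact: mxmeas_cst].
have mlhs n : measurable_fun setT (lhs n).
  apply: measurable_funM; first exact: measurable_funX.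
  apply: measurable_mxtrace; apply: mxmeasM; first exact: mxmeasT.
  by apply: mxmeasM => //; exact: mxmeas_cst.
have mub n : measurable_fun setT (ub n).
  apply: measurable_funD.
    apply: measurable_funM; first exact: measurable_funX.
    apply: measurable_funB.
      apply: measurable_funM => //; apply: measurable_funD => //.
      apply: measurable_funB => //; exact: measurable_funM.
    by apply: measurable_funM => //; exact: measurable_rF2.
  apply: measurable_funM => //; apply: measurable_funM.
    by apply: measurableT_comp => //; exact: mT.
  by apply: measurable_invr; apply: measurable_funX; exact: measurable_funD.
have cF w : F n w @[n --> \oo] --> Fstat X (gram (U w)) by exact: cvg_rF.
have Fs0 w : 0 <= Fstat X (gram (U w)) by exact: Fstat_ge0.
have cchi w : chi (F n w) @[n --> \oo] --> chi (Fstat X (gram (U w))).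
  exact: (shrinkage_cvg sh).
have cchi2 w : chi (F n w) ^+ 2 @[n --> \oo] --> chi (Fstat X (gram (U w))) ^+ 2.
  by rewrite expr2; under eq_fun do rewrite expr2; exact: cvgM.
have cPX w : mxcvg \oo (fun n => rP (dl n) (U w) *m X) (gram (U w) *m gpinv (U w) *m X).
  by apply: mxcvgM; [exact: cvg_rP|exact: mxcvg_cst].
have [| | | |ig cg] := @dominated_cvg_real _ T R P
  (fun n w => ub n w - lhs n w) wishart_gap (cst K).
- by move=> n; exact: measurable_funB.
- move=> w.
  (* The gap is rewritten as the limit of [ub n - lhs n] term by term: [rF2] tends to [F], whence
     [5 - 2 = 3], and the error tends to [0]. *)
  have -> : wishart_gap w = chi (Fstat X (gram (U w))) ^+ 2 *
    ((p%:R + k%:R - 2 * (\rank (gram (U w)))%:R + 5) * Fstat X (gram (U w)) - 2 * Fstat X (gram (U w))) +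
    8 * (rho * C) * (`|0 : R| * (Fstat X (gram (U w)) + eps) ^- 2) -
    chi (Fstat X (gram (U w))) ^+ 2 * \tr ((gram (U w) *m gpinv (U w) *m X)^T *m
      (L *m (gram (U w) *m gpinv (U w) *m X))).
    by rewrite /wishart_gap normr0; ring.
  apply: cvgB.
    apply: cvgD.
      apply: cvgM => //; apply: cvgB.
        apply: cvgM => //; apply: cvgD; last exact: cvg_cst.
        apply: cvgB; first exact: cvg_cst.
        by apply: cvgM; [exact: cvg_cst|exact: cvg_mxtrace_rQ].
      by apply: cvgM; [exact: cvg_cst|exact: cvg_rF2].
    apply: cvgM; first exact: cvg_cst.
    apply: cvgM; first by apply: cvg_norm; exact: cvg_rT12.
    apply: cvgV; first by rewrite gt_eqF// exprn_gt0// ltr_wpDl// (shrink_eps sh).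
    rewrite expr2; under eq_fun do rewrite expr2.
    by apply: cvgM; apply: cvgD => //; exact: cvg_cst.
  apply: cvgM => //; apply: cvg_mxtrace; apply: mxcvgM; first exact: mxcvgT.
  by apply: mxcvgM => //; exact: mxcvg_cst.
- exact: finite_measure_integrable_cst.
- by move=> n w; exact: HK.
split; first exact: ig.
apply: (cvge_ge _ cg); near=> n.
have [il ir e] := stein_ridge (dl0 n).
have iub : P.-integrable setT (fun w => (ub n w - lhs n w)%:E).
  by apply: (@integrable_bounded _ _ _ P (fun w => ub n w - lhs n w) K) => //; exact: measurable_funB.
have : (\int[P]_w (rhs n w - lhs n w)%:E <= \int[P]_w (ub n w - lhs n w)%:E)%E.
  apply: le_integral => //; first by apply: eq_integrable (integrableB measurableT ir il).
  by move=> w _; rewrite lee_fin lerB// rhs_le_ub.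
apply: le_trans.
have -> : (\int[P]_w (rhs n w - lhs n w)%:E = \int[P]_w (rhs n w)%:E - \int[P]_w (lhs n w)%:E)%E.
  by rewrite -integralB//; apply: eq_integral => w _; rewrite EFinB.
have <- : (\int[P]_w (lhs n w)%:E = \int[P]_w (rhs n w)%:E)%E by exact: e.
rewrite subee//; exact: integrable_fin_num.
Unshelve. all: by end_near. Qed.

End wishart.

(** * The identity for [X], with [S] fixed *)

Section shrinkage_stein.
Context d (T : measurableType d) (R : realType) (P : probability T R).
Context (p q m : nat) (X : T -> 'M[R]_(p, q)) (theta : 'M[R]_(p, q)) (L : 'M[R]_p).
Hypothesis mX : mxmeas X.
Hypothesis gsX : gaussian_shift P X theta L.
Context (u : 'M[R]_(p, m)).
Context (eps rho C : R) (chi dchi : R -> R).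
Hypothesis sh : shrinkage eps rho C chi dchi.

Let S := gram u.
Let M := gpinv u.
Let F (x : 'M[R]_(p, q)) := Fstat x S.
Let Pi := S *m M.
Let b (x : 'M[R]_(p, q)) := sa x u.

Let F0 x : 0 <= F x. Proof. exact: Fstat_ge0. Qed.

Let FE x : F x = \tr ((b x)^T *m b x).
Proof. by rewrite /b sa_gram. Qed.

Let PiE x : Pi *m x = u *m b x.
Proof. by rewrite /Pi /b /sa /S /gram !mulmxA. Qed.

Let ME x : M *m x = M *m u *m b x.
Proof.
have [_ + _ _] := mppinvmxP (gram u); rewrite -/(gpinv u) => h2.
rewrite /b /sa -{1}[M]h2 -/M /gram !mulmxA //.
Qed.

(** Both [Pi x] and [S^+ x] depend on [x] only through [b x], whose norm is [sqrt (F x)]. So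
    [chi(F) Pi x] and its derivatives are bounded, although [x] is not. *)
Let entry_sqrt n (A : 'M[R]_(n, m)) :
  exists2 c, 0 <= c & forall x i j, `|(A *m b x) i j| <= c * Num.sqrt (F x).
Proof.
have [K HK] : exists K, forall i j, `|A i j| <= K.
  by have [K HK] := mxbounded_cst unit A; exists K => i j; exact: (HK tt).
exists (m%:R * `|K|); first by rewrite mulr_ge0.
move=> x i j; rewrite -mulrA; apply: mulmx_entry_le.
  by move=> a l; apply: le_trans (HK a l) (ler_norm _).
by move=> a l; rewrite FE; exact: entry_le_sqrt.
Qed.

Let sqF x : Num.sqrt (F x) * Num.sqrt (F x) = F x.
Proof. by rewrite -expr2 sqr_sqrtr. Qed.

Let dF x E : der0 (fun t => F (x + t *: E)) (2 * \tr ((M *m x)^T *m E)).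
Proof.
have dx := @mxder0_line _ _ _ x E.
have := der0_mxtrace (mxder0M (mxder0M (mxder0T dx) (mxder0_cst M)) dx).
rewrite scale0r !addr0 mulmx0 addr0; congr der0.
have Ms : M^T = M by exact: gpinv_sym.
rewrite linearD/= trmx_mul Ms mulr2n mulrDl !mul1r; congr (_ + _).
by rewrite -mxtrace_tr !trmx_mul trmxK Ms mulmxA.
Qed.

(** The divergence of [chi(F) Pi x]: the linear map [x -> Pi x] has trace [q tr Pi = q R], and the
    derivative of [F] in the direction [Pi x] is [2 F]. *)
Lemma shrinkage_stein :
  let tr1 w := chi (F (X w)) * \tr ((Pi *m X w)^T *m (L *m (X w - theta))) in
  let tr2 w := q%:R * (\rank S)%:R * chi (F (X w)) + 2 * dchi (F (X w)) * F (X w) in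
  [/\ P.-integrable setT (EFin \o tr1), P.-integrable setT (EFin \o tr2) &
    (\int[P]_w (tr1 w)%:E = \int[P]_w (tr2 w)%:E)%E].
Proof.
move=> tr1 tr2.
pose H (x : 'M[R]_(p, q)) := chi (F x) *: (Pi *m x).
pose D (ij : 'I_p * 'I_q) (x : 'M[R]_(p, q)) := chi (F x) * Pi ij.1 ij.1 +
  2 * dchi (F x) * ((M *m x) ij.1 ij.2 * (Pi *m x) ij.1 ij.2).
have mid : mxmeas (fun x : borelmx R p q => x : 'M[R]_(p, q)) by exact/mxmeasP.
have mF : measurable_fun setT (F : borelmx R p q -> R).
  apply: measurable_mxtrace; apply: mxmeasM => //.
  by apply: mxmeasM; [exact: mxmeasT|exact: mxmeas_cst].
have [c1 c10 HPi] := entry_sqrt u.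
have [c2 c20 HM] := entry_sqrt (M *m u).
have [|||| i1 i2 e] := @stein_divergence _ _ _ _ _ _ _ _ _ mX gsX H D.
- apply: mxmeasZ; first exact: (shrinkage_measurable sh).
  by apply: mxmeasM => //; exact: mxmeas_cst.
- apply/mxboundedP => i j.
  apply: (@rbounded_sqr _ _ _ (fun x => c1 ^+ 2 * (rho / eps * rho))); last exact: rbounded_cst.
  move=> x; rewrite mxE PiE exprMn mulrC.
  have h1 : (u *m b x) i j ^+ 2 <= c1 ^+ 2 * F x.
    rewrite -(sqF x) -expr2 -exprMn -[leLHS]ger0_norm ?sqr_ge0// normrX.
    rewrite ler_pXn2r// ?nnegrE ?mulr_ge0 ?sqrtr_ge0//; exact: HPi.
  have h2 : chi (F x) ^+ 2 * F x <= rho / eps * rho.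
    rewrite expr2 -mulrA; apply: ler_pM.
    - exact: (shrink_ge0 sh (F0 _)).
    - exact: (mulr_ge0 (shrink_ge0 sh (F0 _)) (F0 _)).
    - exact: (shrink_ub sh (F0 _)).
    - exact: (shrink_mul_le sh (F0 _)).
  apply: (@le_trans _ _ (c1 ^+ 2 * F x * chi (F x) ^+ 2)); first by rewrite ler_wpM2r ?sqr_ge0.
  by rewrite -mulrA [F x * _]mulrC ler_wpM2l ?sqr_ge0.
- move=> ij; apply: rboundedD.
    apply: rboundedM; last exact: rbounded_cst.
    exists (rho / eps) => x; rewrite ger0_norm; last exact: (shrink_ge0 sh (F0 _)).
    exact: (shrink_ub sh (F0 _)).
  under eq_fun do rewrite -mulrA.
  apply: rboundedM; first exact: rbounded_cst.
  exists (c2 * c1 * C) => x; rewrite !normrM ME PiE.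
  apply: (@le_trans _ _ (`|dchi (F x)| * (c2 * c1 * F x))).
    rewrite ler_wpM2l//.
    have -> : c2 * c1 * F x = (c2 * Num.sqrt (F x)) * (c1 * Num.sqrt (F x)).
      by rewrite -[in LHS](sqF x); ring.
    by apply: ler_pM.
  rewrite mulrCA ler_wpM2l ?mulr_ge0//.
  apply: le_trans (shrink_dle sh (F0 x)); rewrite ler_wpM2l//.
  by rewrite lerDl ltW// (shrink_eps sh).
- move=> ij x; set E := delta_mx _ _.
  have dchi0 : is_derive (F (x + 0 *: E)) (1 : R) chi (dchi (F x)).
    by rewrite scale0r addr0; exact: (shrink_der sh (F0 x)).
  have dc := der0_comp dchi0 (@dF x E).
  have dPx := mxder0_entry (i := ij.1) (j := ij.2)
    (mxder0M (mxder0_cst Pi) (@mxder0_line _ _ _ x E)).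
  have := der0M dc dPx.
  have PiD : (Pi *m E) ij.1 ij.2 = Pi ij.1 ij.1.
    rewrite mxE (bigD1 ij.1)//= big1 ?addr0 => [|l li]; rewrite [E _ _]mxE.
      by rewrite !eqxx mulr1.
    by rewrite (negbTE li) mulr0.
  rewrite scale0r addr0 mul0mx add0r PiD mxtrace_delta_mx [(M *m x)^T _ _]mxE /D.
  congr der0.
    by apply/funext => t; rewrite /H [RHS]mxE.
  by rewrite /=; ring.
have tr1E w : \tr ((H (X w))^T *m (L *m (X w - theta))) = tr1 w.
  by rewrite /H linearZ/= -scalemxAl mxtraceZ.
have tr2E w : \sum_ij D ij (X w) = tr2 w.
  rewrite big_split/= -!mulr_sumr /tr2.
  have -> : \sum_(ij : 'I_p * 'I_q) Pi ij.1 ij.1 = q%:R * (\rank S)%:R.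
    rewrite -(pair_bigA _ (fun i (j : 'I_q) => Pi i i))/=.
    rewrite -mxtrace_mul_mppinvmx mulr_sumr; apply: eq_bigr => i _.
    by rewrite sumr_const card_ord mulr_natl.
  have -> : \sum_(ij : 'I_p * 'I_q) (M *m X w) ij.1 ij.2 * (Pi *m X w) ij.1 ij.2 = F (X w).
    transitivity (\tr ((M *m X w)^T *m (Pi *m X w))).
      rewrite [RHS]mxtrace_mulC mxtrace_mul_sum; apply: eq_bigr => ij _.
      by rewrite [(_^T) _ _]mxE mulrC.
    have h2 : M *m S *m M = M by have [] := mppinvmxP S.
    have -> : (M *m X w)^T = (X w)^T *m M by rewrite trmx_mul [M^T]gpinv_sym.
    rewrite -[_ *m M *m _]mulmxA (mulmxA M (S *m M)) (mulmxA M S M) h2.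
    by rewrite mulmxA.
  by rewrite mulrC.
split.
- by apply: eq_integrable i1 => // w _; rewrite /= tr1E.
- by apply: eq_integrable i2 => // w _; rewrite /= tr2E.
- rewrite -(eq_integral _ _ (fun w _ => congr1 EFin (tr1E w))) e.
  by apply: eq_integral => w _; rewrite tr2E.
Qed.

End shrinkage_stein.

(** * Comparison of the risks *)

Section pinv_measurable.
Context (R : realType).

(** [(s^T s)^+ s^T] satisfies the four Penrose equations. It is a limit of ridge matrices for every
    square [s], symmetric or not, so the Moore-Penrose inverse is Borel on the whole matrix
    space. *)
Lemma mppinvmx_gram n (s : 'M[R]_n) : mppinvmx s = gpinv s^T *m s^T.
Proof.
have [h1 h2 h3 h4] := mppinvmxP (gram s^T); rewrite -/(gpinv s^T) in h1 h2 h3 h4.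
have PU := gram_gpinv_U s^T.
have gE : gram s^T = s^T *m s by rewrite /gram trmxK.
have sP : s *m (gpinv s^T *m gram s^T) = s.
  apply: trmx_inj; rewrite trmx_mul h4 gpinv_comm; exact: PU.
apply: penrose_unique (mppinvmxP s) _; split.
- by rewrite -!mulmxA -gE sP.
- transitivity (gpinv s^T *m gram s^T *m gpinv s^T *m s^T); last by rewrite h2.
  by rewrite gE !mulmxA.
- by rewrite !trmx_mul trmxK gpinv_sym mulmxA.
- by rewrite -mulmxA -gE h4.
Qed.

Lemma mxmeas_mppinvmx d (T : measurableType d) n (S : T -> 'M[R]_n) :
  mxmeas S -> mxmeas (fun t => mppinvmx (S t)).
Proof.
move=> mS i j.
apply: (@measurable_fun_cvg _ T R setT
  (fun k t => rA k.+1%:R^-1 (S t)^T i j)).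
  by move=> k; apply: measurable_rA; [rewrite invr_gt0|exact: mxmeasT].
by move=> t _; rewrite mppinvmx_gram; exact: cvg_rA.
Qed.

End pinv_measurable.

Section independence.
Context d d1 d2 (T : measurableType d) (T1 : measurableType d1) (T2 : measurableType d2).
Context (R : realType) (P : probability T R) (X : T -> T1) (Y : T -> T2).
Hypotheses (mX : measurable_fun setT X) (mY : measurable_fun setT Y).
Hypothesis iXY : independent P X Y.
Local Open Scope ereal_scope.

(** The law of [(X, Y)] agrees on rectangles with that of two copies on the product space; there
    Tonelli's theorem can freeze either variable. *)
Lemma integral_independent (f : T1 * T2 -> \bar R) :
  measurable_fun setT f -> (forall z, 0 <= f z) ->
  \int[P]_w f (X w, Y w) = \int[P \x P]_z f (X z.1, Y z.2).
Proof.
move=> mf f0.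
have mXY : measurable_fun setT (fun w => (X w, Y w)) by exact: measurable_fun_pair.
have mXY2 : measurable_fun setT (fun z : T * T => (X z.1, Y z.2)).
  by apply: measurable_fun_pair; [exact: (measurableT_comp mX measurable_fst)|
    exact: (measurableT_comp mY measurable_snd)].
transitivity (\int[pushforward P (fun w => (X w, Y w))]_z f z).
  by rewrite ge0_integral_pushforward.
transitivity (\int[pushforward (P \x P) (fun z : T * T => (X z.1, Y z.2))]_z f z); last first.
  by rewrite ge0_integral_pushforward.
apply: eq_measure_integral => A mA _.
apply: (@measure_unique _ R (T1 * T2)%type
  [set A `*` B | A in measurable & B in measurable] (fun=> setT)) => //.
- by rewrite measurable_prod_measurableType.
- move=> _ _ [A1 mA1 [A2 mA2 <-]] [B1 mB1 [B2 mB2 <-]].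
  exists (A1 `&` B1); first exact: measurableI.
  by exists (A2 `&` B2); [exact: measurableI|rewrite setXI].
- by move=> _; exists setT => //; exists setT => //; rewrite setXTT.
- by rewrite bigcup_const//; exists 0%N.
- move=> _ [A1 mA1 [A2 mA2 <-]]; rewrite /= /pushforward.
  have mXA : measurable (X @^-1` A1) by rewrite -[X in measurable X]setTI; exact: mX.
  have mYA : measurable (Y @^-1` A2) by rewrite -[X in measurable X]setTI; exact: mY.
  have -> : (fun z : T * T => (X z.1, Y z.2)) @^-1` (A1 `*` A2) =
    (X @^-1` A1) `*` (Y @^-1` A2) by [].
  by rewrite product_measure1E//; exact: iXY.
- by move=> _; rewrite /= /pushforward preimage_setT probability_setT ltry.
Qed.

End independence.

Section positive_definite.
Context (R : realType) (p : nat).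

Lemma posdefmx_unit (Sigma : 'M[R]_p) : posdefmx Sigma -> Sigma \in unitmx.
Proof.
move=> [Ss S0]; rewrite -row_free_unit -kermx_eq0; apply/eqP/row_matrixP => i.
rewrite row0; apply/eqP; apply: contraT => u0.
have := S0 (row i (kermx Sigma))^T; rewrite -trmx0 (inj_eq trmx_inj) => /(_ u0).
by rewrite trmxK -row_mul mulmx_ker row0 mul0mx mxE ltxx.
Qed.

(** With [W = Sigma^-1 V] the trace is that of [W^T Sigma W], a sum over columns of values of the
    positive form. *)
Lemma posdefmx_inv_ge0 (Sigma : 'M[R]_p) q (V : 'M[R]_(p, q)) :
  posdefmx Sigma -> 0 <= \tr (V^T *m (invmx Sigma *m V)).
Proof.
move=> pS; have uS := posdefmx_unit pS; case: pS => Ss S0.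
pose W := invmx Sigma *m V.
have -> : V^T *m (invmx Sigma *m V) = W^T *m (Sigma *m W).
  by rewrite /W mulKVmx// trmx_mul trmx_inv Ss -mulmxA.
apply: sumr_ge0 => j _.
have -> : (W^T *m (Sigma *m W)) j j = ((col j W)^T *m Sigma *m col j W) 0 0.
  rewrite -mulmxA !mxE; apply: eq_bigr => i _; rewrite !mxE; congr (_ * _).
  by apply: eq_bigr => l _; rewrite !mxE.
have [->|c0] := eqVneq (col j W) 0; last exact/ltW/S0.
by rewrite mulmx0 mxE.
Qed.

Lemma mxtrace_quadratic q (L : 'M[R]_p) (x y : 'M[R]_(p, q)) (c : R) : L^T = L ->
  \tr ((x - c *: y)^T *m (L *m (x - c *: y))) =
  \tr (x^T *m (L *m x)) - 2 * (c * \tr (y^T *m (L *m x))) +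
  c ^+ 2 * \tr (y^T *m (L *m y)).
Proof.
move=> Ls.
have xy : \tr (x^T *m (L *m y)) = \tr (y^T *m (L *m x)).
  by rewrite -mxtrace_tr !trmx_mul trmxK Ls -mulmxA.
rewrite [(x - _)^T]linearB/= [(c *: y)^T]linearZ/= mulmxBl !mulmxBr.
rewrite -!scalemxAl -!scalemxAr !linearB/= !mxtraceZ xy; ring.
Qed.

End positive_definite.

Section integral_comparison.
Context d (T : measurableType d) (R : realType) (P : probability T R).

(** Only the difference [h] is known to be integrable: if the integral of [B] is infinite there is
    nothing to prove, otherwise [A = B - h] is integrated. *)
Lemma ge0_le_integral_diff (A B h : T -> R) :
  measurable_fun setT A -> measurable_fun setT B ->
  (forall w, 0 <= A w) -> (forall w, 0 <= B w) ->
  P.-integrable setT (EFin \o h) -> (forall w, B w - A w = h w) ->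
  (0 <= \int[P]_w (h w)%:E)%E -> (\int[P]_w (A w)%:E <= \int[P]_w (B w)%:E)%E.
Proof.
move=> mA mB A0 B0 ih BA h0.
have [->|Bfin] := eqVneq (\int[P]_w (B w)%:E)%E +oo%E; first exact: leey.
have iB : P.-integrable setT (EFin \o B).
  apply/integrableP; split; first exact/measurable_EFinP.
  rewrite ltey; apply: contra_neq Bfin => <-.
  by apply: eq_integral => w _ /=; rewrite ger0_norm.
have -> : (\int[P]_w (A w)%:E = \int[P]_w ((EFin \o B) w - (EFin \o h) w))%E.
  by apply: eq_integral => w _; rewrite /= -EFinB -BA opprB addrC subrK.
rewrite integralB// leeBlDr ?integrable_fin_num//.
by rewrite leeDl.
Qed.

End integral_comparison.

Lemma der0_inv (R : realType) (g : R -> R) dg : g 0 != 0 -> der0 g dg ->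
  der0 (fun t => (g t)^-1) (- dg / g 0 ^+ 2).
Proof.
move=> g0 hg.
have cg := der0_cvg hg.
have H : - ((g t - g 0) / t) * ((g t)^-1 / g 0) @[t --> (0 : R)^'] -->
    - dg * ((g 0)^-1 / g 0).
  apply: cvgM; first exact: cvgN.
  by apply: cvgM; [exact: cvgV|exact: cvg_cst].
rewrite (_ : - dg / g 0 ^+ 2 = - dg * ((g 0)^-1 / g 0)); last by field.
apply: cvg_trans H; apply: near_eq_cvg; near=> t.
have gt0 : g t != 0 by near: t; exact: cvgr_neq0 cg g0.
have t0 : t != 0 by near: t; exact: nbhs_dnbhs_neq.
by field; rewrite ?gt0 ?t0 ?g0.
Unshelve. all: by end_near. Qed.

(** * The regularized shrinkage factor *)

Section shrinkage_of.
Context (R : realType) (r : R -> R) (rho M eps : R).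
Hypothesis r_bounds : forall x : R, 0 < x -> 0 <= r x <= rho.
Hypothesis r_mono : forall x y : R, 0 < x -> x <= y -> r x <= r y.
Hypothesis r_diff : forall x : R, 0 < x -> derivable r x 1.
Hypothesis r_deriv : forall x : R, 0 < x -> `|derive1 r x| <= M.
Hypothesis eps0 : 0 < eps.

Definition rchi (y : R) : R := r (y + eps) / (y + eps).
Definition rdchi (y : R) : R := (derive1 r (y + eps) - rchi y) / (y + eps).

Lemma derive1_ge0 (x : R) : 0 < x -> 0 <= derive1 r x.
Proof.
move=> x0.
have d : is_derive x (1 : R) r (derive1 r x) by rewrite derive1E; exact/derivableP/r_diff.
have := cvg_difference_quotient (is_derive_der0 d).
move/cvgr_to_ge; apply; near=> n.
by rewrite addr0 divr_ge0// subr_ge0 r_mono// lerDl.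
Unshelve. all: by end_near. Qed.

(** The product [(y + eps) chi(y) = r(y + eps)] has derivative [r'], so [(y + eps) chi' = r' - chi]:
    it is at least [- chi], and bounded by [M + rho / eps] because [chi <= rho / eps]. *)
Lemma shrinkage_rchi : shrinkage eps rho (M + rho / eps) rchi rdchi.
Proof.
have ye y : 0 <= y -> 0 < y + eps by move=> y0; rewrite ltr_wpDl.
have chi0 y : 0 <= y -> 0 <= rchi y.
  move=> y0; apply: divr_ge0; last exact/ltW/ye.
  by case/andP: (r_bounds (ye _ y0)).
have rho0 : 0 <= rho by case/andP: (r_bounds eps0) => /le_trans; apply.
split=> // y y0; have := ye _ y0; have yne : y + eps != 0 by rewrite gt_eqF ?ye.
- by rewrite /rchi divfK//; case/andP: (r_bounds (ye _ y0)).
- move=> ye0; rewrite -(ger0_norm (ltW ye0)) -normrM /rdchi divfK//.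
  rewrite (le_trans (ler_normB _ _))// lerD ?r_deriv// ger0_norm ?chi0//.
  rewrite /rchi ler_pM ?invr_ge0 ?(ltW ye0)//.
  + by case/andP: (r_bounds ye0).
  + by case/andP: (r_bounds ye0).
  + by rewrite lef_pV2 ?posrE// lerDr.
- by move=> ye0; rewrite /rdchi mulrC divfK// lerBrDr addrC subrr derive1_ge0.
- move=> ye0.
  have d : is_derive (y + eps) (1 : R) r (derive1 r (y + eps)).
    by rewrite derive1E; exact/derivableP/r_diff.
  have dr := is_derive_der0 d.
  have dz : der0 (fun s => y + s + eps) 1.
    have := mxder0_entry (i := 0) (j := 0) (@mxder0_line R 1 1 (y + eps)%:M 1%:M).
    rewrite mxE eqxx mulr1n; congr der0; apply/funext => s.
    by rewrite !mxE eqxx !mulr1n mulr1 addrAC.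
  have dr' : der0 (fun s => r (y + s + eps)) (derive1 r (y + eps)).
    by move: dr; congr der0; apply/funext => s; rewrite addrAC.
  have z0 : y + 0 + eps != 0 by rewrite addr0.
  apply: der0_is_derive.
  have := der0M dr' (der0_inv z0 dz).
  rewrite addr0; congr der0.
  by rewrite /rdchi /rchi; field.
Qed.

End shrinkage_of.

(** * The risk of the regularized estimator *)

Section regularized_risk.
Context d (T : measurableType d) (R : realType) (P : probability T R).
Context (p q m : nat) (X : T -> 'M[R]_(p, q)) (S : T -> 'M[R]_p) (U : T -> 'M[R]_(p, m)).
Context (theta : 'M[R]_(p, q)) (L : 'M[R]_p).
Hypotheses (mX : mxmeas X) (mU : mxmeas U).
Hypothesis SE : forall w, S w = gram (U w).
Hypothesis gsX : gaussian_shift P X theta L.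
Hypothesis gsU : gaussian_shift P U 0 (q%:R *: L).
Hypothesis indXS : independent P (X : T -> borelmx R p q) (S : T -> borelmx R p p).
Hypothesis L_sym : L^T = L.
Hypothesis L_ge0 : forall V : 'M[R]_(p, q), 0 <= \tr (V^T *m (L *m V)).
Context (eps rho C : R) (chi dchi : R -> R).
Hypothesis sh : shrinkage eps rho C chi dchi.
Let mn := minn m p.
Let kappa : R := q%:R * mn%:R - 2.
Let c : R := m%:R + p%:R - 2 * mn%:R + 3.
Hypothesis q0 : (0 < q)%N.
Hypothesis kappa0 : 0 <= kappa.
Hypothesis rho_le : rho * c <= 2 * kappa.

Let Pi (z : borelmx R p q * borelmx R p p) : 'M[R]_(p, q) :=
  (z.2 : 'M[R]_p) *m mppinvmx (z.2 : 'M[R]_p) *m (z.1 : 'M[R]_(p, q)).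
Let F (z : borelmx R p q * borelmx R p p) : R :=
  Fstat (z.1 : 'M[R]_(p, q)) (z.2 : 'M[R]_p).
(* The absolute value only makes the shrinkage factor measurable everywhere:
   [F] is nonnegative as soon as [z.2] is positive semidefinite. *)
Let ch (z : borelmx R p q * borelmx R p p) := chi `|F z|.
Let Q (V : 'M[R]_(p, q)) := \tr (V^T *m (L *m V)).

(** Expanding the square gives [f1 = f3 - 2 (cross term) + f4]. The comparison is split into
    [E (f1 + f2) <= E (f3 + f4)], the lower bound [kappa chi] for the cross term, and
    [E f4 <= E f2]; all sides are nonnegative and may be infinite, except [E f2]. *)
Let f1 (z : borelmx R p q * borelmx R p p) := Q ((z.1 : 'M[R]_(p, q)) - ch z *: Pi z - theta).
Let f2 (z : borelmx R p q * borelmx R p p) := 2 * kappa * ch z.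
Let f3 (z : borelmx R p q * borelmx R p p) := Q ((z.1 : 'M[R]_(p, q)) - theta).
Let f4 (z : borelmx R p q * borelmx R p p) := ch z ^+ 2 * Q (Pi z).

Let ch0 z : 0 <= ch z. Proof. exact: (shrink_ge0 sh (normr_ge0 _)). Qed.
Let f1_ge0 z : 0 <= f1 z. Proof. exact: L_ge0. Qed.
Let f2_ge0 z : 0 <= f2 z. Proof. by rewrite !mulr_ge0. Qed.
Let f3_ge0 z : 0 <= f3 z. Proof. exact: L_ge0. Qed.
Let f4_ge0 z : 0 <= f4 z. Proof. by rewrite mulr_ge0 ?sqr_ge0 ?L_ge0. Qed.

Let FS x w : F (x, S w) = Fstat x (gram (U w)). Proof. by rewrite /F /= SE. Qed.
Let FS0 x w : 0 <= F (x, S w). Proof. by rewrite FS Fstat_ge0. Qed.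
Let chS x w : ch (x, S w) = chi (Fstat x (gram (U w))).
Proof. by rewrite /ch ger0_norm ?FS0 ?FS. Qed.

Let m1 : mxmeas (fun z : borelmx R p q * borelmx R p p => z.1 : 'M[R]_(p, q)).
Proof. by apply/mxmeasP; exact: measurable_fst. Qed.
Let m2 : mxmeas (fun z : borelmx R p q * borelmx R p p => z.2 : 'M[R]_p).
Proof. by apply/mxmeasP; exact: measurable_snd. Qed.
Let m2i : mxmeas (fun z : borelmx R p q * borelmx R p p => mppinvmx (z.2 : 'M[R]_p)).
Proof. exact: mxmeas_mppinvmx m2. Qed.
Let mPi : mxmeas Pi.
Proof. by apply: mxmeasM => //; exact: mxmeasM. Qed.
Let mF : measurable_fun setT F.
Proof.
apply: measurable_mxtrace; apply: mxmeasM => //; apply: mxmeasM => //.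
exact: mxmeasT.
Qed.
Let mch : measurable_fun setT ch.
Proof.
apply: (shrinkage_measurable sh) => //.
exact: measurableT_comp.
Qed.
Let mQ d' (T' : measurableType d') (V : T' -> 'M[R]_(p, q)) :
  mxmeas V -> measurable_fun setT (fun t => Q (V t)).
Proof.
move=> mV; apply: measurable_mxtrace; apply: mxmeasM; first exact: mxmeasT.
by apply: mxmeasM => //; exact: mxmeas_cst.
Qed.
Let mf1 : measurable_fun setT f1.
Proof.
apply: mQ; apply: mxmeasB; last exact: mxmeas_cst.
by apply: mxmeasB => //; exact: mxmeasZ.
Qed.
Let mf2 : measurable_fun setT f2. Proof. exact: measurable_funM. Qed.
Let mf3 : measurable_fun setT f3.
Proof. by apply: mQ; apply: mxmeasB => //; exact: mxmeas_cst. Qed.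
Let mf4 : measurable_fun setT f4.
Proof. by apply: measurable_funM; [exact: measurable_funX|exact: mQ]. Qed.

Let mXb : measurable_fun setT (X : T -> borelmx R p q). Proof. exact/mxmeasP. Qed.
Let mS : mxmeas S.
Proof.
have -> : S = fun w => U w *m (U w)^T by apply/funext => w; rewrite SE.
by apply: mxmeasM => //; exact: mxmeasT.
Qed.
Let mSb : measurable_fun setT (S : T -> borelmx R p p). Proof. exact/mxmeasP. Qed.

Let mxS (f : borelmx R p q * borelmx R p p -> R) x : measurable_fun setT f ->
  measurable_fun setT (fun w => f (x, S w)).
Proof.
move=> mf; apply: (measurableT_comp mf).
by apply: measurable_fun_pair => //; exact: measurable_cst.
Qed.

Let mXs (f : borelmx R p q * borelmx R p p -> R) s : measurable_fun setT f ->
  measurable_fun setT (fun w => f (X w, s)).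
Proof.
move=> mf; apply: (measurableT_comp mf).
by apply: measurable_fun_pair => //; exact: measurable_cst.
Qed.

Let rank_mn : {ae P, forall w, (\rank (S w) = mn)%N}.
Proof.
apply: filterS (gaussian_full_rank mU gsU) => w h.
apply/eqP; rewrite eqn_leq SE /gram; apply/andP; split.
  rewrite /mn leq_min rank_leq_row andbT.
  by apply: leq_trans (mxrankM_maxl _ _) _; exact: rank_leq_col.
rewrite /mn minnC; apply: leq_trans h _.
(* [U = S S^+ U], so the rank of [U] is at most that of [S]. *)
by rewrite -{1}(gram_gpinv_U (U w)) -mulmxA mxrankM_maxl.
Qed.

(** The difference of the two integrands is [h = 2 (cross term - kappa chi)]. Stein's identity in
    [X] replaces the cross term by [q R chi + 2 F chi'], and with [R = mn] the integrand becomes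
    pointwise nonnegative. *)
Let step_x w' : \rank (S w') = mn ->
  (\int[P]_w (f1 (X w, S w') + f2 (X w, S w'))%:E <=
   \int[P]_w (f3 (X w, S w') + f4 (X w, S w'))%:E)%E.
Proof.
move=> rk.
have [i1 i2 e] := shrinkage_stein mX gsX (U w') sh.
set tr1 := fun w => _ in i1 e; set tr2 := fun w => _ in i2 e.
pose h w := 2 * (tr1 w - kappa * ch (X w, S w')).
have ich : P.-integrable setT (fun w => (ch (X w, S w'))%:E).
  apply: (@integrable_bounded _ _ _ P (fun w => ch (X w, S w')) (rho / eps)); first exact: mXs.
  by move=> w; rewrite ger0_norm ?ch0//; exact: (shrink_ub sh (normr_ge0 _)).
have ikch : P.-integrable setT (fun w => (kappa * ch (X w, S w'))%:E).
  by apply: eq_integrable (integrableZl measurableT kappa ich).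
have ih0 : P.-integrable setT (fun w => (tr1 w - kappa * ch (X w, S w'))%:E).
  by apply: eq_integrable (integrableB measurableT i1 ikch).
have ih : P.-integrable setT (EFin \o h).
  by apply: eq_integrable (integrableZl measurableT 2 ih0).
apply: (ge0_le_integral_diff (h := h)) => //.
- by apply: measurable_funD; apply: mXs.
- by apply: measurable_funD; apply: mXs.
- by move=> w; rewrite addr_ge0.
- by move=> w; rewrite addr_ge0.
- move=> w; rewrite /f1 /f2 /f3 /f4 /h /Q.
  have -> : X w - ch (X w, S w') *: Pi (X w, S w') - theta =
      (X w - theta) - ch (X w, S w') *: Pi (X w, S w') by rewrite addrAC.
  rewrite mxtrace_quadratic// /tr1 chS /Pi /= SE /gpinv; ring.
- rewrite (_ : (\int[P]_w (h w)%:E =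
    2%:E * \int[P]_w (tr1 w - kappa * ch (X w, S w'))%:E)%E); last first.
    by rewrite -integralZl.
  rewrite mule_ge0//.
  have -> : (\int[P]_w (tr1 w - kappa * ch (X w, S w'))%:E =
      \int[P]_w (tr2 w - kappa * ch (X w, S w'))%:E)%E.
    under eq_integral do rewrite EFinB.
    under [RHS]eq_integral do rewrite EFinB.
    by rewrite !integralB//; congr (_ - _)%E; exact: e.
  apply: integral_ge0 => w _; rewrite lee_fin /tr2 -SE rk chS -SE /kappa.
  have f0 : 0 <= Fstat (X w) (S w') by rewrite SE Fstat_ge0.
  have := shrink_ge0 sh f0; have := shrink_dge sh f0; have e0 := shrink_eps sh.
  move: (chi _) (dchi _) => x x'; move: (Fstat _ _) f0 => f f0 dge x0.
  (* Subtracting [kappa chi] leaves [2 (chi + F chi')], whence the [2] in [kappa]. Multiplied by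
     [F + eps], the sum [chi + F chi'] is at least [eps chi]. *)
  have A : 0 <= x' * f + x.
    have fe : 0 < f + eps by rewrite ltr_wpDl.
    rewrite -(pmulr_lge0 _ fe) mulrDl.
    have : - x * f <= (f + eps) * x' * f by rewrite ler_wpM2r.
    have : 0 <= x * eps by rewrite mulr_ge0// ltW.
    by nra.
  by nra.
Qed.

(** The chain is [f4 <= q f4], then [q f4] against [B] by the inequality for [U], whose precision is
    [q L], and finally [B <= f2] wherever the rank is [mn]. *)
Let step_s x : (\int[P]_w (f4 (x, S w))%:E <= \int[P]_w (f2 (x, S w))%:E)%E.
Proof.
have [ig g0] := wishart_inequality x mU gsU sh.
pose A w := q%:R * f4 (x, S w).
(* The rank is written as the trace of [S S^+], whose measurability is already known. *)
pose B w := ch (x, S w) ^+ 2 * ((p%:R + m%:R - 2 * \tr (S w *m mppinvmx (S w)) + 3) * F (x, S w)).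
have q1 : 1 <= q%:R :> R by rewrite ler1n.
have mA : measurable_fun setT A by apply: measurable_funM => //; exact: mxS.
have mB : measurable_fun setT B.
  apply: (@mxS (fun z => ch z ^+ 2 * ((p%:R + m%:R -
    2 * \tr ((z.2 : 'M[R]_p) *m mppinvmx (z.2 : 'M[R]_p)) + 3) * F z))).
  apply: measurable_funM; first exact: measurable_funX.
  apply: measurable_funM => //; apply: measurable_funD => //.
  apply: measurable_funB => //; apply: measurable_funM => //.
  by apply: measurable_mxtrace; exact: mxmeasM.
have B0 w : 0 <= B w.
  rewrite /B mulr_ge0 ?sqr_ge0// mulr_ge0 ?FS0// mxtrace_mul_mppinvmx.
  have h1 : (\rank (S w))%:R <= p%:R :> R by rewrite ler_nat rank_leq_row.
  have h2 : (\rank (S w))%:R <= m%:R :> R.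
    by rewrite ler_nat SE (leq_trans (mxrankM_maxl _ _))// rank_leq_col.
  by lra.
apply: (@le_trans _ _ (\int[P]_w (A w)%:E)%E).
  apply: ge0_le_integral => //.
  - by move=> w _; rewrite lee_fin.
  - by apply/measurable_EFinP; exact: mxS.
  - exact/measurable_EFinP.
  - by move=> w _; rewrite lee_fin /A ler_peMl.
apply: (@le_trans _ _ (\int[P]_w (B w)%:E)%E).
  apply: (ge0_le_integral_diff _ _ _ _ ig) => //.
  - by move=> w; rewrite mulr_ge0.
  - move=> w; rewrite /A /B /f4 /wishart_gap chS FS mxtrace_mul_mppinvmx /Pi /= SE.
    rewrite /Q -scalemxAl -scalemxAr mxtraceZ; ring.
apply: ae_ge0_le_integral => //.
- by move=> w _; rewrite lee_fin.
- exact/measurable_EFinP.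
- by move=> w _; rewrite lee_fin.
- by apply/measurable_EFinP; exact: mxS.
apply: filterS rank_mn => w rk _; rewrite lee_fin /B /f2 mxtrace_mul_mppinvmx rk.
have f0 := FS0 x w; rewrite /ch (ger0_norm f0).
have := shrink_ge0 sh f0; have := shrink_mul_le sh f0.
move: (chi _) => y; move: (F _) f0 => f f0 yf y0.
have c0 : 0 <= c.
  have h1 : mn%:R <= p%:R :> R by rewrite ler_nat geq_minr.
  have h2 : mn%:R <= m%:R :> R by rewrite ler_nat geq_minl.
  by rewrite /c; lra.
(* One factor [chi] absorbs [F]: [chi F c <= rho c <= 2 kappa]. The other one remains, as in
   [f2]. *)
have -> : y ^+ 2 * ((p%:R + m%:R - 2 * mn%:R + 3) * f) = y * (y * f * c) by rewrite /c; ring.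
rewrite mulrC ler_wpM2r//; apply: le_trans rho_le.
by rewrite ler_wpM2r.
Qed.

Let zmeas (f : borelmx R p q * borelmx R p p -> R) : measurable_fun setT f ->
  measurable_fun setT (fun z : T * T => (f (X z.1, S z.2))%:E).
Proof.
move=> mf; apply/measurable_EFinP; apply: (measurableT_comp mf).
apply: measurable_fun_pair; first exact: (measurableT_comp mXb measurable_fst).
exact: (measurableT_comp mSb measurable_snd).
Qed.

(** [X] is integrated first, with [S] frozen at almost every value, that is, at full rank. In
    [f4_le_f2] the order is reversed: [X] is frozen and [S] integrated first. *)
Let sum_le : (\int[P]_w (f1 (X w, S w) + f2 (X w, S w))%:E <=
  \int[P]_w (f3 (X w, S w) + f4 (X w, S w))%:E)%E.
Proof.
have m12 : measurable_fun setT (fun z => f1 z + f2 z) by exact: measurable_funD.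
have m34 : measurable_fun setT (fun z => f3 z + f4 z) by exact: measurable_funD.
have p12 z : (0 <= (f1 z + f2 z)%:E)%E by rewrite lee_fin addr_ge0.
have p34 z : (0 <= (f3 z + f4 z)%:E)%E by rewrite lee_fin addr_ge0.
pose g12 z := (f1 z + f2 z)%:E; pose g34 z := (f3 z + f4 z)%:E.
have mg12 : measurable_fun setT g12 by exact/measurable_EFinP.
have mg34 : measurable_fun setT g34 by exact/measurable_EFinP.
rewrite -[leLHS]/(\int[P]_w g12 (X w, S w))%E -[leRHS]/(\int[P]_w g34 (X w, S w))%E.
rewrite (integral_independent mXb mSb indXS mg12 p12).
rewrite (integral_independent mXb mSb indXS mg34 p34).
pose h12 (z : T * T) := g12 (X z.1, S z.2); pose h34 (z : T * T) := g34 (X z.1, S z.2).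
have mh12 : measurable_fun setT h12 by exact: (zmeas m12).
have mh34 : measurable_fun setT h34 by exact: (zmeas m34).
have h12p z : (0 <= h12 z)%E by exact: p12.
have h34p z : (0 <= h34 z)%E by exact: p34.
rewrite -[leLHS]/(\int[P \x P]_z h12 z)%E -[leRHS]/(\int[P \x P]_z h34 z)%E.
rewrite (fubini_tonelli2 _ mh12 h12p) (fubini_tonelli2 _ mh34 h34p).
apply: ae_ge0_le_integral => //.
- by move=> w' _; apply: integral_ge0.
- exact: measurable_fun_fubini_tonelli_G.
- by move=> w' _; apply: integral_ge0.
- exact: measurable_fun_fubini_tonelli_G.
by apply: filterS rank_mn => w' rk _; exact: step_x.
Qed.

Let f4_le_f2 : (\int[P]_w (f4 (X w, S w))%:E <= \int[P]_w (f2 (X w, S w))%:E)%E.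
Proof.
have p2 z : (0 <= (f2 z)%:E)%E by rewrite lee_fin.
have p4 z : (0 <= (f4 z)%:E)%E by rewrite lee_fin.
pose g2 z := (f2 z)%:E; pose g4 z := (f4 z)%:E.
have mg2 : measurable_fun setT g2 by exact/measurable_EFinP.
have mg4 : measurable_fun setT g4 by exact/measurable_EFinP.
rewrite -[leLHS]/(\int[P]_w g4 (X w, S w))%E -[leRHS]/(\int[P]_w g2 (X w, S w))%E.
rewrite (integral_independent mXb mSb indXS mg2 p2).
rewrite (integral_independent mXb mSb indXS mg4 p4).
pose h2 (z : T * T) := g2 (X z.1, S z.2); pose h4 (z : T * T) := g4 (X z.1, S z.2).
have mh2 : measurable_fun setT h2 by exact: (zmeas mf2).
have mh4 : measurable_fun setT h4 by exact: (zmeas mf4).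
have h2p z : (0 <= h2 z)%E by exact: p2.
have h4p z : (0 <= h4 z)%E by exact: p4.
rewrite -[leLHS]/(\int[P \x P]_z h4 z)%E -[leRHS]/(\int[P \x P]_z h2 z)%E.
rewrite (fubini_tonelli1 _ mh2 h2p) (fubini_tonelli1 _ mh4 h4p).
apply: ge0_le_integral => //.
- by move=> w _; apply: integral_ge0.
- exact: measurable_fun_fubini_tonelli_F.
- exact: measurable_fun_fubini_tonelli_F.
by move=> w _; exact: (step_s (X w)).
Qed.

Let mXSw (f : borelmx R p q * borelmx R p p -> R) : measurable_fun setT f ->
  measurable_fun setT (fun w => (f (X w, S w))%:E).
Proof.
move=> mf; apply/measurable_EFinP; apply: (measurableT_comp mf).
exact: measurable_fun_pair.
Qed.

Lemma regularized_risk :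
  (\int[P]_w (Q (X w - chi (Fstat (X w) (S w)) *: (S w *m mppinvmx (S w) *m X w) - theta))%:E
   <= \int[P]_w (Q (X w - theta))%:E)%E.
Proof.
have -> : (\int[P]_w (Q (X w - chi (Fstat (X w) (S w)) *:
    (S w *m mppinvmx (S w) *m X w) - theta))%:E = \int[P]_w (f1 (X w, S w))%:E)%E.
  by apply: eq_integral => w _; rewrite /f1 chS -SE.
rewrite -[leRHS]/(\int[P]_w (f3 (X w, S w))%:E)%E.
have i2 : (\int[P]_w (f2 (X w, S w))%:E \is a fin_num)%E.
  apply: integrable_fin_num => //.
  apply: (@integrable_bounded _ _ _ P (fun w => f2 (X w, S w)) (2 * kappa * (rho / eps))).
    exact/measurable_EFinP/mXSw.
  move=> w; rewrite ger0_norm// /f2 ler_wpM2l ?mulr_ge0//.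
  exact: (shrink_ub sh (normr_ge0 _)).
have := sum_le.
under eq_integral do rewrite EFinD.
under [X in (_ <= X)%E -> _]eq_integral do rewrite EFinD.
rewrite !ge0_integralD//; try (by move=> w _; rewrite lee_fin); try exact: mXSw.
(* [f2] is bounded, so its finite integral can be added to both sides; [E f4] is then replaced by
   [E f2]. *)
move=> h; rewrite -(leeD2rE _ _ i2); apply: le_trans h _.
by rewrite leeD2l.
Qed.

End regularized_risk.

(** Where [F = 0], the matrix [sa] vanishes and with it [S S^+ x], so both estimators equal [x]
    whatever the factor; where [F > 0], [r] is continuous at [F]. *)
Lemma delta_r_cvg (R : realType) (p q m : nat) (r : R -> R) (x : 'M[R]_(p, q)) (u : 'M[R]_(p, m)) :
  (forall x : R, 0 < x -> derivable r x 1) ->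
  mxcvg \oo (fun n => x - rchi r n.+1%:R^-1 (Fstat x (gram u)) *:
    (gram u *m mppinvmx (gram u) *m x)) (delta_r r x (gram u)).
Proof.
move=> r_diff; set S := gram u; set F := Fstat x S.
have -> : delta_r r x S = x - (r F / F) *: (S *m mppinvmx S *m x).
  by rewrite /delta_r mulmxBl mul1mx -scalemxAl.
have F0 : 0 <= F by exact: Fstat_ge0.
have [F_eq0|F_neq0] := eqVneq F 0.
  have Pi0 : S *m mppinvmx S *m x = 0.
    have : \tr ((sa x u)^T *m sa x u) = 0 by rewrite sa_gram -[RHS]F_eq0.
    move/mxtrace_gram_eq0 => sa0; rewrite -/(gpinv u).
    have -> : S *m gpinv u *m x = u *m sa x u by rewrite /sa /S /gram !mulmxA.
    by rewrite sa0 mulmx0.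
  by rewrite Pi0 scaler0; under eq_fun do rewrite scaler0; exact: mxcvg_cst.
have F_gt0 : 0 < F by rewrite lt_neqAle eq_sym F_neq0.
apply: mxcvgB; first exact: mxcvg_cst.
apply: mxcvgZ; last exact: mxcvg_cst.
have cF : F + n.+1%:R^-1 @[n --> \oo] --> F.
  have : F + n.+1%:R^-1 @[n --> \oo] --> F + 0.
    by apply: cvgD; [exact: cvg_cst|exact: cvg_harmonic].
  by rewrite addr0.
apply: cvgM; last exact: cvgV.
apply: continuous_cvg => //.
exact/differentiable_continuous/derivable1_diffP/r_diff.
Qed.

Section fatou_bound.
Context d (T : measurableType d) (R : realType) (P : probability T R).

Lemma le_integral_limit (f_ : nat -> T -> R) (f : T -> R) (c : \bar R) :
  (forall n, measurable_fun setT (f_ n)) -> (forall n w, 0 <= f_ n w) ->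
  (forall w, f_ n w @[n --> \oo] --> f w) ->
  (forall n, (\int[P]_w (f_ n w)%:E <= c)%E) ->
  (\int[P]_w (f w)%:E <= c)%E.
Proof.
move=> mf f0 ff fc.
have fE w : (f w)%:E = limn_einf (fun n => (f_ n w)%:E).
  have h : (f_ n w)%:E @[n --> \oo] --> (f w)%:E.
    by apply: cvg_EFin; [by near=> n|exact: ff].
  by rewrite is_cvg_limn_einfE; [apply/esym/cvg_lim|apply/cvg_ex; exists (f w)%:E].
under eq_integral do rewrite fE.
apply: (le_trans (@fatou _ T R P setT measurableT (fun n w => (f_ n w)%:E) _ _)).
- by move=> n; exact/measurable_EFinP.
- by move=> n w _; rewrite lee_fin.
rewrite limn_einf_lim; apply: lime_le; first exact: is_cvg_einfs.
near=> n; apply: le_trans (fc n).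
by apply: ereal_inf_lbound; exists n => /=.
Unshelve. all: by end_near. Qed.

End fatou_bound.

Theorem theorem3p2 (R : realType) (n p q : nat)
  (hn : (1 <= n)%N) (hp : (1 <= p)%N) (hq : (1 <= q)%N)
  (d : measure_display) (T : measurableType d)
  (P : 'M[R]_(p, q) -> 'M[R]_p -> probability T R)
  (X : {mfun T >-> borelmx R p q}) (Y : {mfun T >-> borelmx R (n * q)%N p})
  (hmodel : forall (theta : 'M[R]_(p, q)) (Sigma : 'M[R]_p), posdefmx Sigma ->
    gaussian_model (P theta Sigma) X Y theta Sigma)
  (hrank : forall (theta : 'M[R]_(p, q)) (Sigma : 'M[R]_p), posdefmx Sigma ->
    P theta Sigma [set w | (2 < q * \rank (Smx Y w))%N] = 1%E)
  (r : R -> R)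
  (hr_bounds : forall x : R, 0 < x ->
    0 <= r x <= 2 * (q%:R * (minn (n * q) p)%N%:R - 2) /
                ((n * q)%N%:R + p%:R - 2 * (minn (n * q) p)%N%:R + 3))
  (hr_mono : forall x y : R, 0 < x -> x <= y -> r x <= r y)
  (hr_diff : forall x : R, 0 < x -> derivable r x 1)
  (hr_deriv_bounded : exists M : R, forall x : R, 0 < x -> `|derive1 r x| <= M) :
  dominates P X Y (delta_r r) (@delta_0 R p q).
Proof.
move=> theta Sigma pS; have [iX nX iY nY iXS] := hmodel theta Sigma pS.
set PP := P theta Sigma in iX nX iY nY iXS *.
have [M rM] := hr_deriv_bounded.
have uS := posdefmx_unit pS.
have q_gt0 : 0 < q%:R :> R by rewrite ltr0n.
pose L := invmx Sigma.
have Ls : L^T = L by rewrite /L trmx_inv; case: pS => ->.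
have L_ge0 (V : 'M[R]_(p, q)) : 0 <= \tr (V^T *m (L *m V)) by exact: posdefmx_inv_ge0.
have mX : mxmeas (X : T -> 'M[R]_(p, q)) by apply/mxmeasP; exact: measurable_funPT.
have mY : mxmeas (Y : T -> 'M[R]_(n * q, p)) by apply/mxmeasP; exact: measurable_funPT.
pose U (w : T) : 'M[R]_(p, n * q) := (Y w : 'M[R]_(n * q, p))^T.
have mU : mxmeas U by exact: mxmeasT.
have SE w : Smx Y w = gram (U w) by rewrite /Smx /gram /U trmxK.
have gsX : gaussian_shift PP (X : T -> 'M[R]_(p, q)) theta L.
  exact: gaussian_shift_columns.
(* The columns of [U] are the rows of [Y], of covariance [Sigma / q]. *)
have gsU : gaussian_shift PP U 0 (q%:R *: L).
  have -> : q%:R *: L = invmx (q%:R^-1 *: Sigma).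
    by rewrite invmxZ ?invrK// unitmxZ ?unitfE ?invr_neq0// gt_eqF.
  have colU j w : col j (U w) = (row j (Y w : 'M[R]_(n * q, p)))^T by rewrite tr_row.
  apply: gaussian_shift_columns => //.
  - by rewrite unitmxZ// unitfE invr_neq0// gt_eqF.
  - by under eq_fun do under eq_fun do rewrite colU.
  - by move=> j; rewrite col0; under eq_fun do rewrite colU; exact: nY.
set rho := 2 * _ / _ in hr_bounds.
set mn := minn (n * q) p in rho hr_bounds.
have c_gt0 : 0 < (n * q)%N%:R + p%:R - 2 * mn%:R + 3 :> R.
  have h1 : mn%:R <= (n * q)%N%:R :> R by rewrite ler_nat geq_minl.
  have h2 : mn%:R <= p%:R :> R by rewrite ler_nat geq_minr.
  by lra.
have rho_c : rho * ((n * q)%N%:R + p%:R - 2 * mn%:R + 3) = 2 * (q%:R * mn%:R - 2).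
  by rewrite /rho divfK// gt_eqF.
(* The bounds on [r] at the point [1] give [0 <= rho]; the denominator of [rho] being positive,
   [kappa >= 0] follows. *)
have rho0 : 0 <= rho by case/andP: (hr_bounds 1 ltr01) => /le_trans; apply.
have kappa0 : 0 <= q%:R * mn%:R - 2 :> R.
  by rewrite -(pmulr_rge0 _ (ltr0n _ 2)) -rho_c mulr_ge0// ltW.
have eps0 k : 0 < k.+1%:R^-1 :> R by rewrite invr_gt0.
have sh k := shrinkage_rchi hr_bounds hr_mono hr_diff rM (eps0 k).
have rho_le : rho * ((n * q)%N%:R + p%:R - 2 * mn%:R + 3) <= 2 * (q%:R * mn%:R - 2).
  by rewrite rho_c.
have rr k := regularized_risk mX mU SE gsX gsU iXS Ls L_ge0 (sh k) hq kappa0 rho_le.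
rewrite /risk unlock.
have lossE V : quadratic_loss Sigma theta V = \tr ((V - theta)^T *m (L *m (V - theta))).
  by rewrite /quadratic_loss mulmxA.
under eq_integral do rewrite lossE.
under [leRHS]eq_integral do rewrite lossE.
(* Fatou's lemma along [eps = 1/(k+1)]: the regularized losses are nonnegative, converge at every
   [w], and their integrals have a common bound, the risk of [X]. *)
apply: le_integral_limit rr.
- move=> k; apply: measurable_mxtrace.
  have mS : mxmeas (Smx Y) by apply: mxmeasM => //; exact: mxmeasT.
  have mSi : mxmeas (fun w => mppinvmx (Smx Y w)) by exact: mxmeas_mppinvmx.
  have mF : measurable_fun setT (fun w => Fstat (X w : 'M[R]_(p, q)) (Smx Y w)).
    apply: measurable_mxtrace; apply: mxmeasM => //; apply: mxmeasM => //.
    exact: mxmeasT.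
  have mchi : measurable_fun setT
      (fun w => rchi r k.+1%:R^-1 (Fstat (X w : 'M[R]_(p, q)) (Smx Y w))).
    by apply: (shrinkage_measurable (sh k)) => // w; rewrite SE Fstat_ge0.
  have mV : mxmeas (fun w => (X w : 'M[R]_(p, q)) -
      rchi r k.+1%:R^-1 (Fstat (X w : 'M[R]_(p, q)) (Smx Y w)) *:
      (Smx Y w *m mppinvmx (Smx Y w) *m (X w : 'M[R]_(p, q))) - theta).
    apply: mxmeasB; last exact: mxmeas_cst.
    apply: mxmeasB => //; apply: mxmeasZ => //.
    by apply: mxmeasM => //; exact: mxmeasM.
  apply: mxmeasM; first exact: mxmeasT.
  by apply: mxmeasM => //; exact: mxmeas_cst.
- by move=> k w; exact: L_ge0.
- move=> w; apply: cvg_mxtrace.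
  have c1 : mxcvg \oo (fun k => (X w : 'M[R]_(p, q)) -
      rchi r k.+1%:R^-1 (Fstat (X w : 'M[R]_(p, q)) (Smx Y w)) *:
      (Smx Y w *m mppinvmx (Smx Y w) *m (X w : 'M[R]_(p, q))) - theta)
      (delta_r r (X w : 'M[R]_(p, q)) (Smx Y w) - theta).
    by rewrite SE; apply: mxcvgB; [exact: delta_r_cvg|exact: mxcvg_cst].
  apply: mxcvgM; first exact: mxcvgT.
  by apply: mxcvgM c1; exact: mxcvg_cst.
Qed.
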